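(* Fix a deterministic target horizon $T\ge1$ and consider the FedHV process described in the context with all assumptions listed there. Set $\eta_g=\bar\eta_g>0$ and $$\eta_\ell=\frac{\eta_0}{\bar\eta_gK\sqrt T},\qquad 0<\eta_0\le\min\Big\{\frac{\bar\eta_g}{4L_w},\ \bar\eta_{\mathrm{eff}}\Big\},\qquad \bar\eta_{\mathrm{eff}}:=\frac{c_{\min}^2}{48\,c_{\max}L_\Phi}.$$ Put $\Phi_{\mathrm{lb}}:=-\sum_i\log r_i$, $\Sigma^2:=\sum_i\sigma_i^2$, $Q:=\sum_i\zeta_i^2+\Sigma^2$, $G_i^2:=2L_ir_i$, $G_{\max}:=\max_iG_i$, $\bar G^2:=2(G_{\max}^2+4Q)$, $\mathcal H_N(p;\zeta):=\frac{N-M}{M(N-1)}\sum_i\zeta_i^2$, $\Xi_{\mathrm{loss},T}:=\max_{0\le t<T}\mathbb E[\|\widehat{\mathbf F}^{\,t}-\mathbf F(\theta^t)\|_\infty^2]$, $$\mathcal V_T:=6G_{\max}^2+3\frac{\Sigma^2}K+6\mathcal H_N(p;\zeta)+\frac{L_w^2\bar G^2}2\,\frac{\eta_0^2}{\bar\eta_g^2K^2T}(K-1)(2K-1),$$ and, with $E_{\mathrm{wt}}:=c_{\max}+6L_\Phi\bar\eta_{\mathrm{eff}}$ and $C:=2/\rho_{\mathrm{clip}}$, $A_1=4c_{\max}$, $A_2=6c_{\max}L_\Phi$, $A_3=12c_{\max}L_\Phi$, $A_4=c_{\max}L_w^2\bar G^2(c_{\max}+L_\Phi\bar\eta_{\mathrm{eff}})$,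 $A_5=8c_{\max}E_{\mathrm{wt}}G_{\max}^2C^2$, $A_6=8c_{\max}E_{\mathrm{wt}}G_{\max}^4C^2$, $A_7=16c_{\max}E_{\mathrm{wt}}G_{\max}^2$. Then $\eta_{\mathrm{eff}}:=\eta_g\eta_\ell K=\eta_0/\sqrt T$ and $$\frac1T\sum_{t=0}^{T-1}\mathbb E\|\nabla\Phi(\theta^t)\|^2\le\frac{A_1(\Phi(\theta^0)-\Phi_{\mathrm{lb}})}{\eta_0\sqrt T}+\frac{A_2\eta_0\Sigma^2}{\sqrt T}+\frac{A_3\eta_0\mathcal H_N(p;\zeta)}{\sqrt T}+\frac{A_4\eta_0^2(K-1)(2K-1)}{\bar\eta_g^2K^2T}+A_5\Xi_{\mathrm{loss},T}+\frac{A_6\eta_0^2}T\mathcal V_T+\frac{A_7}T .$$ Consequently $\min_{0\le t<T}\mathbb E\|\nabla\Phi(\theta^t)\|^2$ is bounded by the same right-hand side, i.e. by $\mathcal O(T^{-1/2})+A_5\Xi_{\mathrm{loss},T}$, where the implied constant does not depend on $T$.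
   Context: **Objectives.** There are $N\ge2$ clients and $m\ge1$ tasks. Client $k$ holds $n_k=n/N$ examples $x_{k,1},\dots,x_{k,n_k}$ (all $n_k$ equal). For $\theta\in\mathbb R^d$, $f_i^{(k)}(\theta)=\frac1{n_k}\sum_j\ell_i(\theta;x_{k,j})$ (each $\ell_i(\cdot;x)$ differentiable), $f_i=\frac1N\sum_kf_i^{(k)}$, $\mathbf F=(f_1,\dots,f_m)^\top$. Each $f_i^{(k)}$ is nonnegative and $L_i$-smooth: $\|\nabla f_i^{(k)}(\theta)-\nabla f_i^{(k)}(\theta')\|\le L_i\|\theta-\theta'\|$ on $\mathbb R^d$; the $L_i\ge 0$ are not all $0$. $L_w:=\sum_iL_i$. $\Delta_m$ is the probability simplex in $\mathbb R^m$. The fixed reference $\mathbf r=(r_1,\dots,r_m)$ satisfies $r_i\ge\rho>0$. $\Phi(\theta):=-\sum_i\log(r_i-f_i(\theta))$ where all $r_i-f_i(\theta)>0$. $c_{\min}:=\sum_i1/r_i$, $c_{\max}:=m/\rho$. **Process.** $\theta^0$ is deterministic. In round $t=0,\dots,T-1$, $\mathcal F_t$ is the sigma-field of all randomness revealed before the client set $S_t$ is sampled; $\theta^t$ and the weight vector $w^t\in\Delta_m$ are $\mathcal F_t$-measurable. Given $\mathcal F_t$, $S_t$ is uniform among subsets of $\{1,\dots,N\}$ of size $M=pN$ (an integer $\ge1$, $p\in(0,1]$), independently of current-round minibatch randomness. After $S_t$ is chosen, objective reports are formed (randomness $\mathcal U_t^{\mathrm{rep}}$, see below). Then each $k\in S_t$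 sets $\theta_{k,0}^t=\theta^t$ and, for $s=0,\dots,K-1$ ($K\ge1$), $\theta_{k,s+1}^t=\theta_{k,s}^t-\eta_\ell\sum_iw_i^tg_i^{(k)}(\theta_{k,s}^t;B_{k,s}^t)$, where $g_i^{(k)}(\theta;B)$ is the average of $\nabla\ell_i(\theta;x_{k,j})$ over the indices $j$ in $B$, and, conditionally on $\mathcal G_{t,s}:=\sigma(\mathcal F_t,S_t,\mathcal U_t^{\mathrm{rep}},\{B_{k,u}^t:k\in S_t,u<s\})$, $B_{k,s}^t$ consists of $b$ indices drawn i.i.d. uniformly with replacement from $\{1,\dots,n_k\}$ (the same minibatch is used for all tasks; no cross-client independence is assumed). The variance bound $\mathbb E[\|g_i^{(k)}(\theta_{k,s}^t;B_{k,s}^t)-\nabla f_i^{(k)}(\theta_{k,s}^t)\|^2\mid\mathcal G_{t,s}]\le\sigma_i^2$ holds. The server sets $\theta^{t+1}=\theta^t+\eta_g\frac1M\sum_{k\in S_t}(\theta_{k,K}^t-\theta^t)$. $\mathcal F_{t+1}$ contains all round-$t$ randomness. **Reports.** At $\theta^t$, each $k\in S_t$ draws (given $\mathcal F_t,S_t$) a uniformly random subset of $\{1,\dots,n_k\}$ of size $b_{k,t}^{\mathrm{rep}}$ without replacement, where $b_{k,t}^{\mathrm{rep}}=n_k$ if the configured number of report batches $q_t$ is $0$ and $b_{k,t}^{\mathrm{rep}}=\min\{q_tb,n_k\}$ if $q_t\ge1$; $\widehat f_{i,k}^{\,t}$ is the average of $\ell_i(\theta^t;x_{k,j})$ over this subset.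 The server forms $\widehat f_i^{\,t}=\frac1M\sum_{k\in S_t}\widehat f_{i,k}^{\,t}\ (\ge0)$ and $\widehat{\mathbf F}^{\,t}=(\widehat f_1^{\,t},\dots,\widehat f_m^{\,t})^\top$. With $v_{i,k}(\theta)=\frac1{n_k}\sum_j(\ell_i(\theta;x_{k,j})-f_i^{(k)}(\theta))^2$ and $\gamma_{k,t}=\frac{n_k-b_{k,t}^{\mathrm{rep}}}{b_{k,t}^{\mathrm{rep}}(n_k-1)}$ ($=0$ if $n_k=1$), the quantities $\max_{t<T}\mathbb E[\frac1N\sum_k\gamma_{k,t}v_{i,k}(\theta^t)]$ and $\max_{t<T}\mathbb E[\frac1N\sum_k(f_i^{(k)}(\theta^t)-f_i(\theta^t))^2]$ are finite. **Weights.** $w^0=\frac1m\mathbf 1_m$ and, for $t\ge1$, $w_i^t=\dfrac{\max\{r_i-\widehat f_i^{\,t-1},\rho_{\mathrm{clip}}\}^{-1}}{\sum_j\max\{r_j-\widehat f_j^{\,t-1},\rho_{\mathrm{clip}}\}^{-1}}$, where $0<\rho_{\mathrm{clip}}\le\rho$. **Virtual trajectory.** $v_{t,0}=\theta^t$, $v_{t,s+1}=v_{t,s}-\eta_\ell\sum_iw_i^t\nabla f_i(v_{t,s})$, $0\le s<K$. **Safe reference.** $\mathcal D\subseteq\mathbb R^d$ is convex, $\mathcal D_\rho=\{\theta\in\mathcal D:\min_i(r_i-f_i(\theta))\ge\rho\}$, $\theta^0\in\mathcal D_\rho$. Almost surely, for every $t<T$, $\mathcal D_\rho$ contains $\theta^t,\theta^{t+1}$,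 all $\theta_{k,s}^t$ ($k\in S_t$, $0\le s\le K$), all $v_{t,s}$ ($0\le s\le K$), and the segments $[\theta^t,\theta^{t+1}]$, $[\theta_{k,s}^t,v_{t,s}]$, $[v_{t,s},\theta^t]$ ($k\in S_t$, $0\le s\le K-1$). **Heterogeneity.** With $\mathsf H_i(\theta)=\frac1N\sum_k\|\nabla f_i^{(k)}(\theta)-\nabla f_i(\theta)\|^2$, almost surely for all $t<T$: $\mathsf H_i(\theta^t)\le\zeta_i^2$ and $\mathsf H_i(v_{t,s})\le\zeta_i^2$ for $0\le s\le K$. **Smoothness of $\Phi$.** $L_\Phi>0$ is a constant with $L_\Phi\le\sum_iL_i/\rho+\sum_i2L_ir_i/\rho^2$ such that $\|\nabla\Phi(\theta)-\nabla\Phi(\theta')\|\le L_\Phi\|\theta-\theta'\|$ whenever $[\theta,\theta']\subseteq\mathcal D_\rho$. All constants ($\sigma_i,\zeta_i,L_i,\rho,\dots$) are understood not to depend on $T$ when the $\mathcal O(T^{-1/2})$ form is read as a family of horizon-$T$ guarantees. *)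

(* Defs.v *)
From HB Require Import structures.
From mathcomp Require Import all_boot all_order all_algebra.
From mathcomp Require Import all_classical all_reals all_analysis measurable_realfun.

Set Implicit Arguments.
Unset Strict Implicit.
Unset Printing Implicit Defensive.

Import Order.TTheory GRing.Theory Num.Theory.
Import numFieldNormedType.Exports.

Local Open Scope classical_set_scope.
Local Open Scope ring_scope.

Section Euclidean.
Context (R : realType) (d : nat).

(* The library norm on row vectors is the sup norm; [enorm] is Euclidean. *)
Definition enorm (u : 'rV[R]_d) : R := Num.sqrt (\sum_j u 0 j ^+ 2).

Definition grad (f : 'rV[R]_d -> R) (x : 'rV[R]_d) : 'rV[R]_d :=
  \row_j 'D_(delta_mx 0 j) f x.

Definition seg (x y : 'rV[R]_d) : set 'rV[R]_d :=
  [set (1 - a) *: x + a *: y | a in `[0, 1]%classic].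

End Euclidean.

Section Conditioning.
Context d (Omega : measurableType d) (R : realType) (P : probability Omega R).

(* [Y] is a version of E[X | G], for nonnegative [X] and a sub-sigma-field
   [G] of the ambient one. *)
Definition cond_exp (G : set_system Omega) (X : Omega -> R)
    (Y : Omega -> \bar R) : Prop :=
  [/\ forall w, (0 <= Y w)%E,
      forall B : set (\bar R), measurable B -> G (Y @^-1` B) &
      forall E, G E -> (\int[P]_(w in E) (X w)%:E = \int[P]_(w in E) Y w)%E].

Definition cond_prob (G : set_system Omega) (E : set Omega)
    (Y : Omega -> \bar R) : Prop := cond_exp G (\1_E) Y.

Definition cond_indep (G H1 H2 : set_system Omega) : Prop :=
  forall E1 E2, H1 E1 -> H2 E2 -> exists Y1 Y2,
    [/\ cond_prob G E1 Y1, cond_prob G E2 Y2 &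
        cond_prob G (E1 `&` E2) (fun w => Y1 w * Y2 w)%E].

(* sigma-field of a random element with values in a finite type, which
   carries the discrete sigma-field *)
Definition sigma_of (T : finType) (X : Omega -> T) : set_system Omega :=
  preimage_set_system setT X setT.

End Conditioning.

Record fedhv (R : realType) := Fedhv {
  dim : nat;
  tasks : nat;                                      (* m *)
  clients : nat;                                    (* N *)
  samples : nat;                                    (* n_k = n / N *)
  example : Type;
  loss : 'I_tasks -> 'rV[R]_dim -> example -> R;
  data : 'I_clients -> 'I_samples -> example;
  ref : 'I_tasks -> R;                              (* r_i *)
  rho : R;
  rho_clip : R;
  domain : set 'rV[R]_dim;                          (* calligraphic D *)
  init : 'rV[R]_dim;                                (* theta^0 *)
  smooth : 'I_tasks -> R;                           (* L_i *)
  smoothPhi : R;                                    (* L_Phi *)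
  noise : 'I_tasks -> R;                            (* sigma_i *)
  heter : 'I_tasks -> R;                            (* zeta_i *)
  fraction : R;                                     (* p *)
  selected : nat;                                   (* M = p N *)
  batch : nat;                                      (* b *)
  local_steps : nat                                 (* K *)
}.

Section Objectives.
Context (R : realType) (A : fedhv R).
Local Notation V := 'rV[R]_(dim A).
Local Notation m := (tasks A).
Local Notation N := (clients A).
Local Notation nk := (samples A).
Local Notation M := (selected A).
Local Notation b := (batch A).
Local Notation K := (local_steps A).

Definition f_client (i : 'I_m) (k : 'I_N) (x : V) : R :=
  nk%:R^-1 * \sum_(j < nk) loss i x (data k j).

Definition f_obj (i : 'I_m) (x : V) : R :=
  N%:R^-1 * \sum_(k < N) f_client i k x.

(* [ln] is 0 on nonpositive reals, so [Phi] is only meaningful on the open set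
   where all r_i - f_i are positive; it is only used on [safe]. *)
Definition Phi (x : V) : R := - \sum_(i < m) ln (ref i - f_obj i x).

Definition safe : set V :=
  [set x | domain x /\ forall i, rho A <= ref i - f_obj i x].

Definition heterogeneity (i : 'I_m) (x : V) : R :=
  N%:R^-1 * \sum_(k < N) enorm (grad (f_client i k) x - grad (f_obj i) x) ^+ 2.

Definition loss_var (i : 'I_m) (k : 'I_N) (x : V) : R :=
  nk%:R^-1 * \sum_(j < nk) (loss i x (data k j) - f_client i k x) ^+ 2.

Definition stoch_grad (i : 'I_m) (k : 'I_N) (x : V) (B : b.-tuple 'I_nk) : V :=
  b%:R^-1 *: \sum_(l < b) grad (fun y => loss i y (data k (tnth B l))) x.

Definition report_size (q : nat) : nat :=
  if q == 0 then nk else minn (q * b) nk.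

Definition report_gamma (q : nat) : R :=
  if nk == 1 then 0
  else (nk%:R - (report_size q)%:R) / ((report_size q)%:R * (nk%:R - 1)).

Definition Lw : R := \sum_(i < m) smooth i.
Definition c_min : R := \sum_(i < m) (ref i)^-1.
Definition c_max : R := m%:R / rho A.
Definition eta_eff_bar : R := c_min ^+ 2 / (48 * c_max * smoothPhi A).
Definition Phi_lb : R := - \sum_(i < m) ln (ref i).
Definition Sigma2 : R := \sum_(i < m) noise i ^+ 2.
Definition Qtot : R := \sum_(i < m) heter i ^+ 2 + Sigma2.
Definition Gi (i : 'I_m) : R := Num.sqrt (2 * smooth i * ref i).
Definition Gmax : R := \big[Num.max/0]_(i < m) Gi i.
Definition Gbar2 : R := 2 * (Gmax ^+ 2 + 4 * Qtot).
Definition HN : R :=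
  (N%:R - M%:R) / (M%:R * (N%:R - 1)) * \sum_(i < m) heter i ^+ 2.
Definition VT (eta_g eta0 : R) (T : nat) : R :=
  6 * Gmax ^+ 2 + 3 * (Sigma2 / K%:R) + 6 * HN
  + Lw ^+ 2 * Gbar2 / 2 * (eta0 ^+ 2 / (eta_g ^+ 2 * K%:R ^+ 2 * T%:R))
    * (K%:R - 1) * (2 * K%:R - 1).
Definition Ewt : R := c_max + 6 * smoothPhi A * eta_eff_bar.

Record setup_ok : Prop := {
  clients_ge2 : (2 <= N)%N;
  tasks_ge1 : (1 <= m)%N;
  samples_ge1 : (1 <= nk)%N;
  batch_ge1 : (1 <= b)%N;
  local_steps_ge1 : (1 <= K)%N;
  fraction_gt0 : 0 < fraction A;
  fraction_le1 : fraction A <= 1;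
  selectedE : M%:R = fraction A * N%:R;
  selected_ge1 : (1 <= M)%N;
  loss_diff : forall (i : 'I_m) (e : example A) (x : V),
    differentiable (fun y : V => loss i y e) x;
  f_client_ge0 : forall i k x, 0 <= f_client i k x;
  smooth_ge0 : forall i : 'I_m, 0 <= smooth i;
  smooth_neq0 : exists i : 'I_m, smooth i != 0;
  f_client_smooth : forall i k x y,
    enorm (grad (f_client i k) x - grad (f_client i k) y)
      <= smooth i * enorm (x - y);
  rho_gt0 : 0 < rho A;
  ref_ge_rho : forall i : 'I_m, rho A <= ref i;
  rho_clip_gt0 : 0 < rho_clip A;
  rho_clip_le : rho_clip A <= rho A;
  domain_convex : convex_set (@domain R A : set (convex_lmodType V));
  init_safe : safe (init A);
  smoothPhi_gt0 : 0 < smoothPhi A;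
  smoothPhi_le : smoothPhi A
    <= \sum_(i < m) smooth i / rho A
       + \sum_(i < m) 2 * smooth i * ref i / rho A ^+ 2;
  Phi_smooth : forall x y, seg x y `<=` safe ->
    enorm (grad Phi x - grad Phi y) <= smoothPhi A * enorm (x - y)
}.

(* One round, for a realized client set, report subsets and minibatches. *)
Section Round.
Context (eta_g eta_l : R).

Fixpoint local_iter (w : 'I_m -> R) (x : V) (B : nat -> b.-tuple 'I_nk)
    (k : 'I_N) (s : nat) : V :=
  if s is s'.+1 then
    let y := local_iter w x B k s' in
    y - eta_l *: \sum_(i < m) w i *: stoch_grad i k y (B s')
  else x.

Definition server_step (w : 'I_m -> R) (x : V) (S : {set 'I_N})
    (B : nat -> 'I_N -> b.-tuple 'I_nk) : V :=
  x + eta_g *: (M%:R^-1 *: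
    \sum_(k in S) (local_iter w x (B ^~ k) k K - x)).

Definition report (x : V) (S : {set 'I_N}) (J : 'I_N -> {set 'I_nk})
    (i : 'I_m) : R :=
  M%:R^-1 * \sum_(k in S) #|J k|%:R^-1 * \sum_(j in J k) loss i x (data k j).

Definition inv_slack (fhat : 'I_m -> R) (i : 'I_m) : R :=
  (Num.max (ref i - fhat i) (rho_clip A))^-1.

Definition next_weight (fhat : 'I_m -> R) (i : 'I_m) : R :=
  inv_slack fhat i / \sum_(j < m) inv_slack fhat j.

Fixpoint virtual_iter (w : 'I_m -> R) (x : V) (s : nat) : V :=
  if s is s'.+1 then
    let y := virtual_iter w x s' in
    y - eta_l *: \sum_(i < m) w i *: grad (f_obj i) y
  else x.

End Round.

(* Report subsets and minibatches are indexed by all clients; only those of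
   the clients in S_t are ever used. *)
Record randomness d (Omega : measurableType d) := Randomness {
  sel : nat -> Omega -> {set 'I_N};                       (* S_t *)
  rep_set : nat -> 'I_N -> Omega -> {set 'I_nk};
  minibatch : nat -> nat -> 'I_N -> Omega -> b.-tuple 'I_nk; (* B_{k,s}^t *)
  rep_batches : nat -> nat;                               (* q_t *)
  filt : nat -> set_system Omega                          (* F_t *)
}.

Section Process.
Context (eta_g eta_l : R) d (Omega : measurableType d) (P : probability Omega R)
  (Z : randomness Omega).

Fixpoint state (t : nat) (w : Omega) : V * ('I_m -> R) :=
  if t is t'.+1 then
    let: (x, u) := state t' w in
    (server_step eta_g eta_l u x (sel Z t' w) (fun s k => minibatch Z t' s k w),
     next_weight (report x (sel Z t' w) (fun k => rep_set Z t' k w)))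
  else (init A, fun=> m%:R^-1).

Definition theta t w : V := (state t w).1.

Definition weight t w : 'I_m -> R := (state t w).2.

Definition fhat t w : 'I_m -> R :=
  report (theta t w) (sel Z t w) (fun k => rep_set Z t k w).

Definition theta_loc t s (k : 'I_N) w : V :=
  local_iter eta_l (weight t w) (theta t w) (fun u => minibatch Z t u k w) k s.

Definition virt t s w : V := virtual_iter eta_l (weight t w) (theta t w) s.

Definition when_sel (T : Type) t (k : 'I_N) (X : Omega -> T) (w : Omega) :=
  if k \in sel Z t w then Some (X w) else None.

Definition sigma_FS t : set_system Omega := <<s filt Z t `|` sigma_of (sel Z t) >>.

(* G_{t,s}; the report randomness consists of the subsets drawn by the clients
   in S_t. *)
Definition sigma_G t s : set_system Omega :=
  <<s filt Z t `|` sigma_of (sel Z t)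
      `|` \bigcup_(k : 'I_N) sigma_of (when_sel t k (rep_set Z t k))
      `|` \bigcup_(u in [set u | (u < s)%N]) \bigcup_(k : 'I_N)
            sigma_of (when_sel t k (minibatch Z t u k)) >>.

Definition sigma_minibatch t : set_system Omega :=
  <<s \bigcup_(s in [set s | (s < K)%N]) \bigcup_(k : 'I_N)
        sigma_of (minibatch Z t s k) >>.

Record round_law t : Prop := {
  sel_meas : sigma_of (sel Z t) `<=` measurable;
  rep_meas : forall k, sigma_of (rep_set Z t k) `<=` measurable;
  minibatch_meas : forall s k, (s < K)%N ->
    sigma_of (minibatch Z t s k) `<=` measurable;
  filt_sigma : sigma_algebra setT (filt Z t);
  filt_meas : filt Z t `<=` measurable;
  filt_next : sigma_G t K `<=` filt Z t.+1;
  theta_meas : forall j (B : set R), measurable B ->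
    filt Z t ((fun w => theta t w 0 j) @^-1` B);
  weight_meas : forall i (B : set R), measurable B ->
    filt Z t ((fun w => weight t w i) @^-1` B);
  sel_unif : forall S : {set 'I_N}, #|S| = M ->
    cond_prob P (filt Z t) [set w | sel Z t w = S]
      (fun=> ('C(N, M)%:R^-1)%:E);
  sel_indep :
    cond_indep P (filt Z t) (sigma_of (sel Z t)) (sigma_minibatch t);
  rep_unif : forall k (J : {set 'I_nk}),
    #|J| = report_size (rep_batches Z t) ->
    cond_prob P (sigma_FS t) [set w | k \in sel Z t w /\ rep_set Z t k w = J]
      (fun w => ((k \in sel Z t w)%:R
                 * 'C(nk, report_size (rep_batches Z t))%:R^-1)%:E);
  (* b i.i.d. uniform indices *)
  minibatch_unif : forall s k (B : b.-tuple 'I_nk), (s < K)%N ->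
    cond_prob P (sigma_G t s)
      [set w | k \in sel Z t w /\ minibatch Z t s k w = B]
      (fun w => ((k \in sel Z t w)%:R * \prod_(l < b) nk%:R^-1)%:E);
  grad_var : forall s i k, (s < K)%N -> exists Y,
    cond_exp P (sigma_G t s)
      (fun w => (k \in sel Z t w)%:R *
        enorm (stoch_grad i k (theta_loc t s k w) (minibatch Z t s k w)
               - grad (f_client i k) (theta_loc t s k w)) ^+ 2) Y
    /\ {ae P, forall w, (Y w <= (noise i ^+ 2)%:E)%E}
}.

Record safe_round t w : Prop := {
  safe_theta : safe (theta t w);
  safe_theta_next : safe (theta t.+1 w);
  safe_loc : forall k s, k \in sel Z t w -> (s <= K)%N ->
    safe (theta_loc t s k w);
  safe_virt : forall s, (s <= K)%N -> safe (virt t s w);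
  safe_seg_theta : seg (theta t w) (theta t.+1 w) `<=` safe;
  safe_seg_loc : forall k s, k \in sel Z t w -> (s < K)%N ->
    seg (theta_loc t s k w) (virt t s w) `<=` safe;
  safe_seg_virt : forall s, (s < K)%N ->
    seg (virt t s w) (theta t w) `<=` safe
}.

Record process_ok (T : nat) : Prop := {
  process_round : forall t, (t < T)%N -> round_law t;
  process_safe : {ae P, forall w, forall t, (t < T)%N -> safe_round t w};
  process_fhat_ge0 :
    {ae P, forall w, forall t i, (t < T)%N -> 0 <= fhat t w i};
  process_heter : {ae P, forall w, forall t i, (t < T)%N ->
    heterogeneity i (theta t w) <= heter i ^+ 2 /\
    forall s, (s <= K)%N -> heterogeneity i (virt t s w) <= heter i ^+ 2};
  process_sample_fin : forall i,
    (\big[maxe/-oo]_(t < T) 'E_P[fun w => (N%:R^-1 * \sum_(k < N)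
       report_gamma (rep_batches Z t) * loss_var i k (theta t w))%R])%E
    \is a fin_num;
  process_client_fin : forall i,
    (\big[maxe/-oo]_(t < T) 'E_P[fun w => (N%:R^-1 * \sum_(k < N)
       (f_client i k (theta t w) - f_obj i (theta t w)) ^+ 2)%R])%E
    \is a fin_num
}.

Definition Xi_loss (T : nat) : \bar R :=
  (\big[maxe/-oo]_(t < T) 'E_P[fun w =>
     ((\big[Num.max/0]_(i < m) `|fhat t w i - f_obj i (theta t w)|) ^+ 2)%R])%E.

Definition grad_sq (t : nat) : \bar R :=
  'E_P[fun w => (enorm (grad Phi (theta t w)) ^+ 2)%R]%E.

End Process.
End Objectives.

(* Main.v *)
Require Import Defs.
From mathcomp Require Import all_boot all_order all_algebra perm.
From mathcomp Require Import all_classical all_reals all_analysis measurable_realfun.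
From mathcomp Require Import ring lra.

(* Every iterate is a function of the finitely many sampled sets and minibatch
   indices, so expectations are finite sums over histories, each history being
   represented by an outcome at which the almost sure assumptions hold.

   In one round, the descent inequality for Phi along [theta^t, theta^{t+1}]
   leaves the averaged update, which splits into minibatch noise (centred, and
   orthogonal across the local steps of a client), local drift (controlled by
   comparing the local trajectories with the virtual one) and the average over
   S_t of the clients' gradients at theta^t, whose variance is that of sampling
   without replacement.  The gradient of Phi is a positive multiple of the
   mixture of the grad f_i with the weights computed from the exact losses at
   theta^t; the weights actually used come from the reports at theta^{t-1} and
   differ from these in l^1-norm by at most 2 / rho_clip times the sup-distance
   between the reports and the losses, which costs Xi and one step length.
   Telescoping over t < T gives the rate. *)

Import Order.TTheory GRing.Theory Num.Theory.
Import numFieldNormedType.Exports.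
Set Implicit Arguments.
Unset Strict Implicit.
Unset Printing Implicit Defensive.
Local Open Scope classical_set_scope.
Local Open Scope ring_scope.

(** * Euclidean geometry and gradients *)

(** What is known when shapes the argument. The weights of round t are fixed before S_t is drawn, so
    they and theta^t can be frozen while S_t and the minibatches are integrated out. The virtual
    trajectory is a function of these two alone, and the heterogeneity bound, an average over all
    clients, is available along it; this is how it transfers to a uniform S_t. Minibatches are
    revealed for selected clients only, so noise is centred only on the selection event, and local
    iterates are masked off it. As minibatches of different clients may be dependent, clients are
    combined by Jensen alone: the noise shrinks by K, not by M K.

    The constants come from a budget in units of |grad Phi|^2 / (4 c_max). The ideal mixture
    supplies four units; Young's inequality spends one on drift and one on the wrong weights; the
    quadratic term of the descent inequality spends a quarter, thanks to the 48 in [eta_eff_bar]. At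
    least one unit remains, whence [A1]. *)

Section Euclidean.
Context (R : realType) (d : nat).
Implicit Types (u v x y : 'rV[R]_d).

Definition dot u v : R := \sum_j u 0 j * v 0 j.

Lemma dotC u v : dot u v = dot v u.
Proof. by apply: eq_bigr => j _; rewrite mulrC. Qed.

Lemma dotDl u v x : dot (u + v) x = dot u x + dot v x.
Proof. by rewrite -big_split; apply: eq_bigr => j _; rewrite mxE mulrDl. Qed.

Lemma dotZl a u v : dot (a *: u) v = a * dot u v.
Proof. by rewrite mulr_sumr; apply: eq_bigr => j _; rewrite mxE mulrA. Qed.

Lemma dot0l u : dot 0 u = 0.
Proof. by apply: big1 => j _; rewrite mxE mul0r. Qed.

Lemma dotDr u v x : dot x (u + v) = dot x u + dot x v.
Proof. by rewrite !(dotC x) dotDl. Qed.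

Lemma dotZr a u v : dot u (a *: v) = a * dot u v.
Proof. by rewrite !(dotC u) dotZl. Qed.

Lemma dot0r u : dot u 0 = 0.
Proof. by rewrite dotC dot0l. Qed.

Lemma dotNl u v : dot (- u) v = - dot u v.
Proof. by rewrite -scaleN1r dotZl mulN1r. Qed.

Lemma dotNr u v : dot u (- v) = - dot u v.
Proof. by rewrite dotC dotNl dotC. Qed.

Lemma dotBl u v x : dot (u - v) x = dot u x - dot v x.
Proof. by rewrite dotDl dotNl. Qed.

Lemma dotBr u v x : dot x (u - v) = dot x u - dot x v.
Proof. by rewrite dotDr dotNr. Qed.

Lemma dot_suml (I : Type) (r : seq I) (p : pred I) (F : I -> 'rV[R]_d) u :
  dot (\sum_(i <- r | p i) F i) u = \sum_(i <- r | p i) dot (F i) u.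
Proof. by apply: (big_morph (dot^~ u)) => [a b|]; rewrite ?dotDl ?dot0l. Qed.

Lemma dot_sumr (I : Type) (r : seq I) (p : pred I) (F : I -> 'rV[R]_d) u :
  dot u (\sum_(i <- r | p i) F i) = \sum_(i <- r | p i) dot u (F i).
Proof. by rewrite dotC dot_suml; apply: eq_bigr => i _; rewrite dotC. Qed.

Lemma dot_ge0 u : 0 <= dot u u.
Proof. by apply: sumr_ge0 => j _; rewrite -expr2 sqr_ge0. Qed.

Lemma dot_eq0 u : dot u u = 0 -> u = 0.
Proof.
move=> /eqP; rewrite psumr_eq0 => [/allP u0|j _]; last by rewrite -expr2 sqr_ge0.
apply/rowP => j; rewrite mxE; apply/eqP.
by have := u0 j (mem_index_enum _); rewrite -expr2 sqrf_eq0.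
Qed.

Lemma enorm_ge0 u : 0 <= enorm u.
Proof. exact: sqrtr_ge0. Qed.

Lemma enorm_sqr u : enorm u ^+ 2 = dot u u.
Proof.
rewrite sqr_sqrtr; first by apply: eq_bigr => j _; rewrite expr2.
by apply: sumr_ge0 => j _; rewrite sqr_ge0.
Qed.

Lemma enorm_le u a : 0 <= a -> dot u u <= a ^+ 2 -> enorm u <= a.
Proof. by move=> a0; rewrite -enorm_sqr ler_sqr ?nnegrE ?enorm_ge0. Qed.

Lemma enorm_sqr_le u a : enorm u <= a -> dot u u <= a ^+ 2.
Proof.
move=> ua; rewrite -enorm_sqr ler_sqr ?nnegrE ?enorm_ge0//.
exact: le_trans (enorm_ge0 u) ua.
Qed.

Lemma enorm0 : enorm (0 : 'rV[R]_d) = 0.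
Proof. by apply/eqP; rewrite -sqrf_eq0 enorm_sqr dot0l. Qed.

Lemma enormZ a u : enorm (a *: u) = `|a| * enorm u.
Proof.
apply/eqP; rewrite -(eqrXn2 (ltn0Sn 1)) ?mulr_ge0 ?enorm_ge0//.
by rewrite exprMn !enorm_sqr dotZl dotZr mulrA -expr2 real_normK ?num_real.
Qed.

Lemma enormN u : enorm (- u) = enorm u.
Proof. by rewrite -scaleN1r enormZ normrN1 mul1r. Qed.

Lemma enormB u v : enorm (u - v) = enorm (v - u).
Proof. by rewrite -enormN opprB. Qed.

(* The quadratic [t |-> |u - t v|^2] is nonnegative. *)
Lemma dot_sqr_le u v : dot u v ^+ 2 <= dot u u * dot v v.
Proof.
have [v0|v0] := eqVneq (dot v v) 0.
  by rewrite (dot_eq0 v0) !dot0r mulr0 expr0n.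
have vp : 0 < dot v v by rewrite lt_def v0 dot_ge0.
have := dot_ge0 (dot v v *: u - dot u v *: v).
rewrite !(dotBl, dotBr, dotZl, dotZr) (dotC v u) => h.
rewrite -subr_ge0 -(pmulr_rge0 _ vp).
suff -> : dot v v * (dot u u * dot v v - dot u v ^+ 2) =
  dot v v * (dot v v * dot u u - dot u v * dot u v) -
  dot u v * (dot v v * dot u v - dot u v * dot v v) by [].
by ring.
Qed.

Lemma ler_norm_dot u v : `|dot u v| <= enorm u * enorm v.
Proof.
rewrite -ler_sqr ?nnegrE ?mulr_ge0 ?enorm_ge0//.
by rewrite real_normK ?num_real// exprMn !enorm_sqr dot_sqr_le.
Qed.

Lemma ler_dot u v : dot u v <= enorm u * enorm v.
Proof. exact: le_trans (ler_norm _) (ler_norm_dot u v). Qed.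

Lemma ler_enormD u v : enorm (u + v) <= enorm u + enorm v.
Proof.
apply: enorm_le; first by rewrite addr_ge0 ?enorm_ge0.
rewrite !(dotDl, dotDr) (dotC v u) sqrrD !enorm_sqr.
by have := ler_dot u v; lra.
Qed.

Lemma ler_enorm_sum (I : Type) (r : seq I) (p : pred I) (F : I -> 'rV[R]_d) :
  enorm (\sum_(i <- r | p i) F i) <= \sum_(i <- r | p i) enorm (F i).
Proof.
apply: (big_ind2 (fun u a => enorm u <= a)) => //; first by rewrite enorm0.
by move=> u a v b ua vb; exact: le_trans (ler_enormD _ _) (lerD ua vb).
Qed.

End Euclidean.

(** Jensen for a sub-probability: expand the nonnegative [\sum_i p i * (x i - e) ^+ 2]; total mass
    at most one gives [e ^+ 2 * \sum_i p i <= e ^+ 2]. *)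
Lemma sqr_sum_le (R : realFieldType) (I : finType) (p x : I -> R) :
  (forall i, 0 <= p i) -> \sum_i p i <= 1 ->
  (\sum_i p i * x i) ^+ 2 <= \sum_i p i * x i ^+ 2.
Proof.
move=> p0 p1; set e := \sum_i p i * x i.
have h : 0 <= \sum_i p i * (x i - e) ^+ 2.
  by apply: sumr_ge0 => i _; rewrite mulr_ge0 ?sqr_ge0.
have hE : \sum_i p i * (x i - e) ^+ 2 =
    \sum_i p i * x i ^+ 2 - 2 * e * (\sum_i p i * x i) + e ^+ 2 * \sum_i p i.
  rewrite [2 * e * _]mulr_sumr [e ^+ 2 * _]mulr_sumr -sumrB -big_split /=.
  by apply: eq_bigr => i _; ring.
have : e ^+ 2 * \sum_i p i <= e ^+ 2 by rewrite ler_piMr ?sqr_ge0.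
by move: h; rewrite hE -/e; lra.
Qed.

Section DotConvexity.
Context (R : realType) (d : nat).
Implicit Types (u v x y : 'rV[R]_d).

Lemma dot_sum_le (I : finType) (p : I -> R) (F : I -> 'rV[R]_d) :
  (forall i, 0 <= p i) -> \sum_i p i <= 1 ->
  dot (\sum_i p i *: F i) (\sum_i p i *: F i) <= \sum_i p i * dot (F i) (F i).
Proof.
move=> p0 p1; rewrite /dot; under [leRHS]eq_bigr do rewrite mulr_sumr.
rewrite exchange_big /=; apply: ler_sum => j _.
rewrite -expr2 summxE.
rewrite (eq_bigr (fun i => p i * F i 0 j)); last by move=> i _; rewrite mxE.
apply: le_trans (sqr_sum_le _ p0 p1) _.
by apply: ler_sum => i _; rewrite expr2.
Qed.

Lemma dotD_le u v : dot (u + v) (u + v) <= 2 * dot u u + 2 * dot v v.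
Proof.
have := dot_ge0 (u - v); rewrite !(dotBl, dotBr, dotDl, dotDr) (dotC v u); lra.
Qed.

Lemma dotD3_le u v x : dot (u + v + x) (u + v + x) <=
  3 * (dot u u + dot v v + dot x x).
Proof.
have := dot_ge0 (u - v); have := dot_ge0 (v - x); have := dot_ge0 (u - x).
by rewrite !(dotBl, dotBr, dotDl, dotDr) (dotC v u) (dotC x u) (dotC x v); lra.
Qed.

(** Expand [|u - 2 c v|^2 >= 0] and divide by [4 c]. With [c = c_max] this prices both the drift and
    the weight error. *)
Lemma dot_young u v (c : R) : 0 < c ->
  dot u v <= dot u u / (4 * c) + c * dot v v.
Proof.
move=> c0; have := dot_ge0 (u - (2 * c) *: v).
rewrite !(dotBl, dotBr, dotZl, dotZr) (dotC v u) => h.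
rewrite -(ler_pM2l (_ : 0 < 4 * c)); last by lra.
by rewrite mulrDr mulrCA mulfV; lra.
Qed.

End DotConvexity.

(** * Gradients, descent inequality and Lipschitz bounds along segments *)

Section Gradient.
Context (R : realType) (d : nat).
Local Notation V := 'rV[R]_d.
Implicit Types (u v x y : V) (f : V -> R).

Lemma derive_grad f x v : differentiable f x -> 'D_v f x = dot (grad f x) v.
Proof.
move=> df; rewrite deriveE// {1}(row_sum_delta v) linear_sum /=.
apply: eq_bigr => j _; rewrite linearZ /= mxE deriveE//.
by rewrite mulrC.
Qed.

Lemma grad_sum n (F : 'I_n -> V -> R) x :
  (forall i, differentiable (F i) x) ->
  grad (fun y => \sum_i F i y) x = \sum_i grad (F i) x.
Proof.
move=> dF; apply/rowP => j; rewrite mxE summxE.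
have -> : (fun y => \sum_i F i y) = \sum_i F i.
  by apply/funext => y; rewrite fct_sumE.
rewrite derive_sum; first by apply: eq_bigr => i _; rewrite mxE.
by move=> i; exact: diff_derivable.
Qed.

Lemma gradZ (a : R) f x : differentiable f x ->
  grad (fun y => a * f y) x = a *: grad f x.
Proof.
move=> df; apply/rowP => j; rewrite !mxE.
by rewrite (_ : (fun y => _) = a *: f)// deriveZ//; exact: diff_derivable.
Qed.

Lemma differentiable_suml n (F : 'I_n -> V -> R) x :
  (forall i, differentiable (F i) x) ->
  differentiable (fun y => \sum_i F i y) x.
Proof.
move=> dF; have -> : (fun y => \sum_i F i y) = \sum_i F i.
  by apply/funext => y; rewrite fct_sumE.
exact: differentiable_sum.
Qed.

Lemma differentiable_scale (a : R) f x : differentiable f x ->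
  differentiable (fun y => a * f y) x.
Proof. by move=> df; apply: (@differentiableZ _ _ _ f a). Qed.

Lemma is_derive_line f x v (a : R) : differentiable f (x + a *: v) ->
  is_derive a 1 (fun b : R => f (x + b *: v)) (dot (grad f (x + a *: v)) v).
Proof.
move=> df.
have dl : is_diff a (fun b : R => x + b *: v) (fun b => b *: v).
  apply: (@is_diff_eq _ _ _ (fun b : R => x + b *: v) (0 + ( *:%R^~ v))).
  by rewrite add0r.
have dc : differentiable (f \o (fun b : R => x + b *: v)) a.
  exact: differentiable_comp.
apply: DeriveDef; first by apply/derivable1_diffP.
rewrite (deriveE (f := f \o (fun b : R => x + b *: v)))//.
rewrite (diff_comp (f := fun b : R => x + b *: v) (g := f))//=.
by rewrite diff_val scale1r -deriveE// derive_grad.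
Qed.

Lemma segE x y (a : R) : (1 - a) *: x + a *: y = x + a *: (y - x).
Proof. by rewrite scalerBl scale1r scalerBr addrAC addrA. Qed.

(** The mean value theorem for [f] along the line minus [g], whose derivative is nonpositive on the
    unit interval. A quadratic [g] gives [descent] and a linear one [lipschitz_line], without
    integrals. *)
Lemma line_mvt f x v (g : R -> R) (dg : R -> R) :
  (forall a : R, 0 <= a <= 1 -> differentiable f (x + a *: v)) ->
  (forall a : R, is_derive a 1 g (dg a)) ->
  (forall a : R, 0 <= a <= 1 -> dot (grad f (x + a *: v)) v <= dg a) ->
  f (x + v) - f x <= g 1 - g 0.
Proof.
move=> df ig le.
pose h a : R := f (x + a *: v) - g a.
have ih (a : R) : 0 <= a <= 1 -> is_derive a 1 h (dot (grad f (x + a *: v)) v - dg a).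
  move=> a01; have := is_derive_line (df _ a01); move=> il.
  exact: (@is_deriveB _ _ _ (fun b : R => f (x + b *: v)) g).
have [||c] := @MVT R h (fun a => dot (grad f (x + a *: v)) v - dg a) 0 1 ltr01.
- by move=> a; rewrite in_itv/= => /andP[a0 a1]; apply: ih; rewrite !ltW.
- apply: derivable_within_continuous => a; rewrite in_itv/= => a01.
  by have [] := ih _ a01.
move=> c01; rewrite subr0 mulr1 /h scale1r scale0r addr0.
have : dot (grad f (x + c *: v)) v <= dg c.
  by apply: le; move: c01; rewrite in_itv/= => /andP[? ?]; rewrite !ltW.
by lra.
Qed.

(** Regularity is asked only on the segment, and the gradient is compared only with its value at
    [x], because [Phi] is smooth only along segments inside [safe]. *)
Lemma descent f x v (L : R) :
  (forall a : R, 0 <= a <= 1 -> differentiable f (x + a *: v)) ->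
  (forall a : R, 0 <= a <= 1 ->
    enorm (grad f (x + a *: v) - grad f x) <= L * (a * enorm v)) ->
  f (x + v) <= f x + dot (grad f x) v + L / 2 * dot v v.
Proof.
move=> df sm.
have := @line_mvt f x v (fun a => a * dot (grad f x) v + a ^+ 2 * (L / 2 * dot v v))
  (fun a => dot (grad f x) v + a * (L * dot v v)) df.
rewrite !mul1r expr1n mul1r !mul0r expr0n /= mul0r.
suff h1 : forall a : R, is_derive a 1
   (fun a => a * dot (grad f x) v + a ^+ 2 * (L / 2 * dot v v))
   (dot (grad f x) v + a * (L * dot v v)).
  suff h2 : forall a : R, 0 <= a <= 1 ->
      dot (grad f (x + a *: v)) v <= dot (grad f x) v + a * (L * dot v v).
    by move=> /(_ h1 h2); lra.
  move=> a a01; have a0 : 0 <= a by case/andP: a01.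
  have := ler_dot (grad f (x + a *: v) - grad f x) v.
  rewrite dotBl => h.
  have : enorm (grad f (x + a *: v) - grad f x) * enorm v <=
     L * (a * enorm v) * enorm v by rewrite ler_wpM2r ?enorm_ge0// sm.
  by rewrite -enorm_sqr expr2; lra.
move=> a; apply: is_derive_eq.
by rewrite !scaler0 !add0r /GRing.scale /=; field.
Qed.

Lemma lipschitz_line f x v (G : R) :
  (forall a : R, 0 <= a <= 1 -> differentiable f (x + a *: v)) ->
  (forall a : R, 0 <= a <= 1 -> enorm (grad f (x + a *: v)) <= G) ->
  `|f (x + v) - f x| <= G * enorm v.
Proof.
move=> df bd.
have bd' (a : R) : 0 <= a <= 1 -> `|dot (grad f (x + a *: v)) v| <= G * enorm v.
  move=> a01; apply: le_trans (ler_norm_dot _ _) _.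
  by rewrite ler_wpM2r ?enorm_ge0// bd.
have lin (c a : R) : is_derive a 1 (fun b => b * c) c.
  by apply: is_derive_eq; rewrite scaler0 add0r /GRing.scale /= mulr1.
rewrite ler_norml; apply/andP; split.
  have dN (a : R) : 0 <= a <= 1 -> differentiable (fun y => - f y) (x + a *: v).
    by move=> a01; apply: differentiableN; exact: df.
  have := @line_mvt _ _ _ (fun a => a * (G * enorm v)) (fun=> G * enorm v) dN
    (lin _) _.
  rewrite mul1r mul0r => h; suff : - f (x + v) - - f x <= G * enorm v - 0 by lra.
  apply: h => a a01; have gN : grad (fun y => - f y) (x + a *: v) = - grad f (x + a *:
      v).
    rewrite -scaleN1r -gradZ; last exact: df.
    by congr grad; apply/funext => y; rewrite mulN1r.
  by rewrite gN dotNl; have := bd' _ a01; rewrite ler_norml; lra.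
have := @line_mvt _ _ _ (fun a => a * (G * enorm v)) (fun=> G * enorm v) df
  (lin _) _.
rewrite mul1r mul0r subr0; apply => a a01.
by have := bd' _ a01; rewrite ler_norml; lra.
Qed.

(* Evaluate the descent bound at [x - s grad f x]: with s = 1 / L when L > 0,
   and with s large when L = 0. *)
Lemma grad_sqr_le f (L : R) x : 0 <= L ->
  (forall y, differentiable f y) -> (forall y, 0 <= f y) ->
  (forall y z, enorm (grad f y - grad f z) <= L * enorm (y - z)) ->
  dot (grad f x) (grad f x) <= 2 * L * f x.
Proof.
move=> L0 df f0 sm; set g := grad f x.
have key (s : R) : 0 <= s -> 0 <= f x - s * dot g g + L / 2 * s ^+ 2 * dot g g.
  move=> s0; apply: le_trans (f0 (x + - s *: g)) _.
  have := @descent f x (- s *: g) L (fun _ _ => df _) _.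
  rewrite !(dotZl, dotZr) -/g => h.
  suff : f (x + - s *: g) <= f x + - s * dot g g + L / 2 * (- s * (- s * dot g g)) by
      lra.
  apply: h => a /andP[a0 a1]; apply: le_trans (sm _ _) _.
  by rewrite addrAC subrr add0r enormZ (ger0_norm a0).
have [L_0|L_0] := eqVneq L 0.
  rewrite L_0 mulr0 mul0r; rewrite leNgt; apply/negP => gp.
  have := key ((f x + 1) / dot g g) _.
  rewrite L_0 mul0r mul0r mul0r addr0 mulfVK ?gt_eqF// => h.
  have : 0 <= f x - (f x + 1) by apply: h; rewrite divr_ge0 ?dot_ge0// addr_ge0.
  by lra.
have Lp : 0 < L by rewrite lt_def L_0.
have := key L^-1; rewrite invr_ge0 => /(_ L0) h.
have -> : 2 * L * f x = dot g g +
   2 * L * (f x - L^-1 * dot g g + L / 2 * L^-1 ^+ 2 * dot g g) by field.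
by rewrite lerDl mulr_ge0// mulr_ge0.
Qed.

End Gradient.

(** * The objectives and the potential on the safe set *)

Section LogGradient.
Context (R : realType) (d : nat).
Local Notation V := 'rV[R]_d.
Implicit Types (f : V -> R) (x : V).

Lemma differentiable_ln_sub f (r : R) x : differentiable f x -> 0 < r - f x ->
  differentiable (fun y => ln (r - f y)) x.
Proof.
move=> df rf; apply: (@differentiable_comp _ _ _ _ (fun y => r - f y) (@ln R)).
  by apply: differentiableB => //; exact: differentiable_cst.
by apply/derivable1_diffP; have [] := is_derive1_ln rf.
Qed.

Lemma grad_ln_sub f (r : R) x : differentiable f x -> 0 < r - f x ->
  grad (fun y => ln (r - f y)) x = - (r - f x)^-1 *: grad f x.
Proof.
move=> df rf; apply/rowP => j; rewrite !mxE.
have dg : differentiable (fun y => r - f y) x.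
  by apply: differentiableB => //; exact: differentiable_cst.
have [dl lE] := is_derive1_ln rf.
rewrite deriveE; last exact: differentiable_ln_sub.
rewrite (diff_comp (f := fun y => r - f y) (g := @ln R))//=; last first.
  by apply/derivable1_diffP.
rewrite deriv1E// derive1E lE.
rewrite (_ : 'd (fun y => r - f y) x (delta_mx 0 j) = - 'D_(delta_mx 0 j) f x).
  by rewrite /GRing.scale /= !mulNr mulrC.
rewrite -deriveE// deriveB.
- by rewrite derive_cst sub0r.
- exact: derivable_cst.
- exact: diff_derivable.
Qed.

End LogGradient.

Section Objectives.
Context (R : realType) (A : fedhv R).
Hypothesis hA : setup_ok A.
Local Notation V := 'rV[R]_(Defs.dim A).
Local Notation m := (tasks A).
Local Notation N := (clients A).
Local Notation nk := (samples A).
Local Notation M := (selected A).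
Local Notation K := (local_steps A).
Implicit Types (x y v : V) (i : 'I_m) (k : 'I_N).

Let Ngt0 : 0 < N%:R :> R.
Proof. by rewrite ltr0n; apply: leq_trans (clients_ge2 hA). Qed.

Lemma differentiable_f_client i k x : differentiable (f_client i k) x.
Proof.
apply: differentiable_scale; apply: differentiable_suml => j.
exact: (loss_diff hA).
Qed.

Lemma grad_f_client i k x : grad (f_client i k) x =
  nk%:R^-1 *: \sum_(j < nk) grad (fun y => loss i y (data k j)) x.
Proof.
have dl j : differentiable (fun y => loss i y (data k j)) x.
  exact: (loss_diff hA).
by rewrite gradZ ?grad_sum//; exact: differentiable_suml.
Qed.

Lemma differentiable_f_obj i x : differentiable (f_obj i) x.
Proof.
apply: differentiable_scale; apply: differentiable_suml => k.
exact: differentiable_f_client.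
Qed.

Lemma grad_f_obj i x :
  grad (f_obj i) x = N%:R^-1 *: \sum_(k < N) grad (f_client i k) x.
Proof.
have dl k : differentiable (f_client i k) x by exact: differentiable_f_client.
by rewrite gradZ ?grad_sum//; exact: differentiable_suml.
Qed.

Lemma f_obj_ge0 i x : 0 <= f_obj i x.
Proof.
by rewrite mulr_ge0 ?invr_ge0 ?ler0n// sumr_ge0// => k _; exact: (f_client_ge0 hA).
Qed.

Lemma f_obj_smooth i x y :
  enorm (grad (f_obj i) x - grad (f_obj i) y) <= smooth i * enorm (x - y).
Proof.
rewrite !grad_f_obj -scalerBr -sumrB enormZ ger0_norm ?invr_ge0 ?ler0n//.
rewrite -ler_pdivlMl ?invr_gt0// invrK.
apply: le_trans (ler_enorm_sum _ _ _) _.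
have := ler_sum (index_enum 'I_N) (fun k (_ : true) => f_client_smooth hA i k x y).
by move=> /le_trans; apply; rewrite sumr_const card_ord mulr_natl.
Qed.

Lemma safe_slack x i : safe x -> rho A <= ref i - f_obj i x.
Proof. by case. Qed.

Lemma safe_slack_gt0 x i : safe x -> 0 < ref i - f_obj i x.
Proof. by move=> sx; apply: lt_le_trans (rho_gt0 hA) (safe_slack i sx). Qed.

Lemma ref_gt0 i : 0 < ref i.
Proof. exact: lt_le_trans (rho_gt0 hA) (ref_ge_rho hA i). Qed.

Lemma Gi_le_Gmax i : Gi i <= Gmax A.
Proof. exact: (@le_bigmax _ _ _ 0 (fun i => Gi i) i). Qed.

Lemma Gmax_ge0 : 0 <= Gmax A.
Proof. exact: bigmax_ge_id. Qed.

(** The squared gradient of a nonnegative smooth function is at most [2 L f] ([grad_sqr_le]), and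
    [f_obj i x < ref i] on the safe set; hence the form [2 * smooth i * ref i] inside [Gi]. *)
Lemma grad_f_obj_le i x : safe x -> enorm (grad (f_obj i) x) <= Gmax A.
Proof.
move=> sx; apply: le_trans (Gi_le_Gmax i).
have r0 := ref_gt0 i; have L0 := smooth_ge0 hA i.
apply: enorm_le; first exact: sqrtr_ge0.
rewrite sqr_sqrtr; last by rewrite mulr_ge0 ?mulr_ge0// ltW.
apply: le_trans (grad_sqr_le x L0 (differentiable_f_obj i) (f_obj_ge0 i) _) _.
  exact: f_obj_smooth.
rewrite ler_wpM2l ?mulr_ge0//.
by have := safe_slack_gt0 i sx; lra.
Qed.

Lemma grad_Phi x : safe x ->
  grad (@Phi R A) x = \sum_i (ref i - f_obj i x)^-1 *: grad (f_obj i) x.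
Proof.
move=> sx.
have -> : @Phi R A = (fun y => -1 * \sum_(i < m) ln (ref i - f_obj i y)).
  by apply/funext => y; rewrite mulN1r.
have dl i : differentiable (fun y => ln (ref i - f_obj i y)) x.
  by apply: differentiable_ln_sub; [exact: differentiable_f_obj|exact: safe_slack_gt0].
rewrite gradZ; last exact: differentiable_suml.
rewrite grad_sum// scaler_sumr; apply: eq_bigr => i _.
rewrite grad_ln_sub//; first by rewrite scalerA mulN1r opprK.
  exact: differentiable_f_obj.
exact: safe_slack_gt0.
Qed.

Lemma differentiable_Phi x : safe x -> differentiable (@Phi R A) x.
Proof.
move=> sx; have -> : @Phi R A = (fun y => -1 * \sum_(i < m) ln (ref i - f_obj i y)).
  by apply/funext => y; rewrite mulN1r.
apply: differentiable_scale; apply: differentiable_suml => i.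
by apply: differentiable_ln_sub; [exact: differentiable_f_obj|exact: safe_slack_gt0].
Qed.

Lemma Phi_ge x : safe x -> Phi_lb A <= Phi x.
Proof.
move=> sx; rewrite lerN2; apply: ler_sum => i _.
rewrite ler_ln ?posrE ?safe_slack_gt0 ?ref_gt0//.
by rewrite gerBl f_obj_ge0.
Qed.

Lemma segP x v (D : set V) (a : R) : seg x (x + v) `<=` D -> 0 <= a <= 1 -> D (x + a *:
    v).
Proof.
move=> sD a01; apply: sD; exists a; first by rewrite /= in_itv.
by rewrite segE addrAC subrr add0r.
Qed.

Lemma Phi_descent x v : seg x (x + v) `<=` @safe R A ->
  Phi (x + v) <= Phi x + dot (grad (@Phi R A) x) v + smoothPhi A / 2 * dot v v.
Proof.
move=> sD; apply: descent => a a01; first exact/differentiable_Phi/(segP sD).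
rewrite enormB; apply: le_trans (Phi_smooth hA _) _; last first.
  rewrite opprD addrA subrr add0r enormN enormZ ger0_norm//.
  by case/andP: a01.
(* A point of the subsegment from [x] to [x + a v] is [x + (b a) v], which lies on the full segment
   since [b * a] is again in the unit interval. *)
move=> y [b]; rewrite /= in_itv/= => /andP[b0 b1] <-.
rewrite segE addrAC subrr add0r scalerA; apply: (segP sD).
case/andP: a01 => a0 a1; rewrite mulr_ge0//=.
by rewrite mulr_ile1.
Qed.

Lemma f_obj_lipschitz i x v : seg x (x + v) `<=` @safe R A ->
  `|f_obj i (x + v) - f_obj i x| <= Gmax A * enorm v.
Proof.
move=> sD; apply: lipschitz_line => a a01; first exact: differentiable_f_obj.
exact/grad_f_obj_le/(segP sD).
Qed.

Lemma Lw_gt0 : 0 < Lw A.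
Proof.
have [i i0] := smooth_neq0 hA; rewrite /Lw (bigD1 i)//=.
apply: ltr_wpDr; last by rewrite lt_def i0 (smooth_ge0 hA).
by apply: sumr_ge0 => j _; exact: (smooth_ge0 hA).
Qed.

Lemma c_min_gt0 : 0 < c_min A.
Proof.
have m0 : (0 < m)%N := tasks_ge1 hA.
rewrite /c_min (bigD1 (Ordinal m0))//=.
apply: ltr_wpDr; last by rewrite invr_gt0 ref_gt0.
by apply: sumr_ge0 => j _; rewrite invr_ge0 ltW// ref_gt0.
Qed.

Lemma c_max_gt0 : 0 < c_max A.
Proof. by rewrite divr_gt0 ?(rho_gt0 hA)// ltr0n (tasks_ge1 hA). Qed.

Lemma eta_eff_bar_gt0 : 0 < eta_eff_bar A.
Proof.
rewrite divr_gt0 ?exprn_gt0 ?c_min_gt0// mulr_gt0 ?(smoothPhi_gt0 hA)//.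
by rewrite mulr_gt0 ?c_max_gt0.
Qed.

Lemma Sigma2_ge0 : 0 <= Sigma2 A.
Proof. by apply: sumr_ge0 => i _; rewrite sqr_ge0. Qed.

Lemma sum_heter_ge0 : 0 <= \sum_(i < m) heter i ^+ 2.
Proof. by apply: sumr_ge0 => i _; rewrite sqr_ge0. Qed.

Lemma selected_le : (M <= N)%N.
Proof.
rewrite -(ler_nat R) (selectedE hA) ler_piMl ?ler0n//.
exact: (fraction_le1 hA).
Qed.

Lemma HN_ge0 : 0 <= HN A.
Proof.
rewrite mulr_ge0 ?sum_heter_ge0// divr_ge0// ?mulr_ge0 ?ler0n//.
  by rewrite subr_ge0 ler_nat selected_le.
by rewrite subr_ge0 ler1n; apply: leq_trans (clients_ge2 hA).
Qed.

Lemma Gbar2_ge0 : 0 <= Gbar2 A.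
Proof.
have := sqr_ge0 (Gmax A); have := Sigma2_ge0; have := sum_heter_ge0.
by rewrite /Gbar2 /Qtot; lra.
Qed.

Lemma Ewt_gt0 : 0 < Ewt A.
Proof.
have := c_max_gt0; have := mulr_gt0 (smoothPhi_gt0 hA) eta_eff_bar_gt0.
by rewrite /Ewt -mulrA; lra.
Qed.

(** * Stability of the weights under errors in the losses *)

Section Weights.
Implicit Types (a b : 'I_m -> R).

Let slack_gt0 a i : 0 < Num.max (ref i - a i) (rho_clip A).
Proof. by rewrite lt_max (rho_clip_gt0 hA) orbT. Qed.

Lemma inv_slack_gt0 a i : 0 < inv_slack a i.
Proof. by rewrite invr_gt0. Qed.

Lemma sum_inv_slack_gt0 a : 0 < \sum_i inv_slack a i.
Proof.
have m0 : (0 < m)%N := tasks_ge1 hA.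
rewrite (bigD1 (Ordinal m0))//=; apply: ltr_wpDr; last exact: inv_slack_gt0.
by apply: sumr_ge0 => j _; rewrite ltW// inv_slack_gt0.
Qed.

Lemma next_weight_ge0 a i : 0 <= next_weight a i.
Proof. by rewrite divr_ge0 ?ltW ?inv_slack_gt0 ?sum_inv_slack_gt0. Qed.

Lemma next_weight_sum1 a : \sum_i next_weight a i = 1.
Proof. by rewrite -mulr_suml divff// gt_eqF// sum_inv_slack_gt0. Qed.

(** Write [1/p - 1/q = (q - p) / (p q)]: clipping is 1-Lipschitz and keeps [p] above [rho_clip]. The
    factor [1/q] is left in place, so the error is relative and can be summed against the normaliser
    without a factor [m]. *)
Lemma inv_slack_dist a b (e : R) i : `|a i - b i| <= e ->
  `|inv_slack a i - inv_slack b i| <= e / rho_clip A * inv_slack b i.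
Proof.
move=> ab; rewrite /inv_slack.
set p := Num.max (ref i - a i) _; set q := Num.max (ref i - b i) _.
have p0 : 0 < p by exact: slack_gt0.
have q0 : 0 < q by exact: slack_gt0.
have c0 := rho_clip_gt0 hA.
have -> : p^-1 - q^-1 = (q - p) * p^-1 * q^-1.
  by field; rewrite !gt_eqF.
rewrite !normrM (gtr0_norm (_ : 0 < q^-1)) ?invr_gt0//.
rewrite (gtr0_norm (_ : 0 < p^-1)) ?invr_gt0//.
rewrite ler_pM2r ?invr_gt0//; apply: ler_pM => //; first by rewrite invr_ge0 ltW.
  apply: le_trans ab; rewrite /p /q; move: (a i) (b i) => s t.
  rewrite ler_norml; have := ler_norm (s - t); have := ler_norm (t - s).
  rewrite (distrC t s) => h1 h2.
  case: (leP (ref i - t) (rho_clip A)) => ht;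
    case: (leP (ref i - s) (rho_clip A)) => hs; apply/andP; split; lra.
by rewrite lef_pV2 ?posrE// /p le_max lexx orbT.
Qed.

(** The difference splits as [(a_i - b_i) / q + (a_i / p) * (q - p) / q] in terms of the inverse
    slacks and their sums. The numerators and the normaliser each cost [S / q <= e / rho_clip],
    which explains the 2. *)
Lemma next_weight_dist a b (e : R) : (forall i, `|a i - b i| <= e) ->
  \sum_i `|next_weight a i - next_weight b i| <= 2 / rho_clip A * e.
Proof.
move=> ab; set p := \sum_i inv_slack a i; set q := \sum_i inv_slack b i.
have p0 : 0 < p := sum_inv_slack_gt0 a.
have q0 : 0 < q := sum_inv_slack_gt0 b.
set S := \sum_i `|inv_slack a i - inv_slack b i|.
have Sq : S <= e / rho_clip A * q.
  by rewrite mulr_sumr; apply: ler_sum => i _; exact: inv_slack_dist.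
have pq : `|q - p| <= S.
  by rewrite -sumrB /S; under [leRHS]eq_bigr do rewrite distrC; exact: ler_norm_sum.
have : \sum_i `|next_weight a i - next_weight b i| <= 2 * (S / q).
  have -> : 2 * (S / q) = S / q + p / p * (S / q) by rewrite divff ?gt_eqF// mul1r;
      ring.
  have -> : S / q + p / p * (S / q) = \sum_i (`|inv_slack a i - inv_slack b i| / q
      + inv_slack a i / p * (S / q)) by rewrite big_split /= -!mulr_suml.
  apply: ler_sum => i _.
  have -> : next_weight a i - next_weight b i =
     (inv_slack a i - inv_slack b i) / q + inv_slack a i / p * ((q - p) / q).
    by rewrite /next_weight -/p -/q; field; rewrite !gt_eqF.
  apply: le_trans (ler_normD _ _) _; apply: lerD.
    by rewrite normrM (gtr0_norm (_ : 0 < q^-1)) ?invr_gt0.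
  rewrite !normrM (gtr0_norm (inv_slack_gt0 a i)) !(gtr0_norm (_ : 0 < _^-1))
      ?invr_gt0//.
  rewrite ler_wpM2l ?divr_ge0 ?(ltW (inv_slack_gt0 a i)) ?(ltW p0)//.
  by rewrite ler_wpM2r// invr_ge0 ltW.
move=> /le_trans; apply.
have -> : 2 / rho_clip A * e = 2 * (e / rho_clip A) by ring.
by rewrite ler_pM2l// ler_pdivrMr.
Qed.

End Weights.

(** Since [rho_clip <= rho], clipping is inactive on the safe set; so [next_weight] at the exact
    losses weights the tasks as [grad Phi] does. *)
Lemma inv_slack_safe x i : safe x ->
  inv_slack (fun i => f_obj i x) i = (ref i - f_obj i x)^-1.
Proof.
move=> sx; rewrite /inv_slack; congr (_^-1); apply/max_idPl.
exact: le_trans (rho_clip_le hA) (safe_slack i sx).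
Qed.

(** The factor between the ideal mixture and [grad Phi] on the safe set. Nonnegative losses bound it
    below by [c_min], slacks of at least [rho] bound it above by [c_max]. *)
Definition slack_sum x : R := \sum_i inv_slack (fun i => f_obj i x) i.

Lemma slack_sum_ge x : safe x -> c_min A <= slack_sum x.
Proof.
move=> sx; apply: ler_sum => i _; rewrite inv_slack_safe//.
by rewrite lef_pV2 ?posrE ?ref_gt0 ?safe_slack_gt0// gerBl f_obj_ge0.
Qed.

Lemma slack_sum_le x : safe x -> slack_sum x <= c_max A.
Proof.
move=> sx; have -> : c_max A = \sum_(i < m) (rho A)^-1.
  by rewrite sumr_const card_ord -mulr_natl.
apply: ler_sum => i _; rewrite inv_slack_safe//.
by rewrite lef_pV2 ?posrE ?safe_slack_gt0 ?(rho_gt0 hA)// safe_slack.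
Qed.

Definition mix_grad (w : 'I_m -> R) x : V := \sum_i w i *: grad (f_obj i) x.

Lemma grad_Phi_mix x : safe x ->
  grad (@Phi R A) x = slack_sum x *: mix_grad (next_weight (fun i => f_obj i x)) x.
Proof.
move=> sx; rewrite grad_Phi// scaler_sumr; apply: eq_bigr => i _.
rewrite scalerA; congr (_ *: _); rewrite -inv_slack_safe// /next_weight.
by rewrite mulrCA divff ?mulr1// gt_eqF// sum_inv_slack_gt0.
Qed.

Lemma mix_grad_dist (w u : 'I_m -> R) x : safe x ->
  enorm (mix_grad w x - mix_grad u x) <= Gmax A * \sum_i `|w i - u i|.
Proof.
move=> sx; rewrite -sumrB; apply: le_trans (ler_enorm_sum _ _ _) _.
rewrite mulr_sumr; apply: ler_sum => i _.
by rewrite -scalerBl enormZ mulrC ler_wpM2r// grad_f_obj_le.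
Qed.

Lemma mix_grad_le (w : 'I_m -> R) x : safe x ->
  (forall i, 0 <= w i) -> \sum_i w i = 1 -> enorm (mix_grad w x) <= Gmax A.
Proof.
move=> sx w0 w1; apply: le_trans (ler_enorm_sum _ _ _) _.
rewrite -[leRHS]mul1r -w1 mulr_suml; apply: ler_sum => i _.
by rewrite enormZ ger0_norm// ler_wpM2l// grad_f_obj_le.
Qed.

End Objectives.

(** * Sampling without replacement *)

(* Inclusion counts are invariant under transpositions, so double counting
   determines them without computing binomial coefficients. *)
Section Sampling.
Context (R : realType) (T : finType) (M : nat).
Local Notation n := #|T|.
Local Notation draws := ([set S : {set T} | #|S| == M])%SET.
Local Notation total := (#|draws|%:R : R).

(** First-order and, next, second-order inclusion probabilities, multiplied by the number of
    draws. *)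
Definition incl (k : T) : R := \sum_(S in draws) (k \in S)%:R.
Definition incl2 (k l : T) : R := \sum_(S in draws) (k \in S)%:R * (l \in S)%:R.

Lemma incl2_perm (s : {perm T}) k l : incl2 (s k) (s l) = incl2 k l.
Proof.
rewrite /incl2 (reindex_inj (imset_inj (@perm_inj _ s))) /=.
apply: eq_big => [S|S _].
  by rewrite !inE card_imset//; exact: perm_inj.
by rewrite !mem_imset//; exact: perm_inj.
Qed.

Lemma incl2_diag k : incl2 k k = incl k.
Proof. by apply: eq_bigr => S _; case: (k \in S); rewrite ?mulr1 ?mulr0. Qed.

Lemma sum_mem (S : {set T}) : \sum_k (k \in S)%:R = #|S|%:R :> R.
Proof.
rewrite -sum1_card natr_sum [RHS]big_mkcond; apply: eq_bigr => k _.
by case: (k \in S).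
Qed.

Lemma inclE k : n%:R * incl k = M%:R * total.
Proof.
have incl_const l : incl l = incl k.
  by rewrite -!incl2_diag -(incl2_perm (tperm k l)) tpermR.
rewrite mulr_natl -sumr_const -(eq_bigr _ (fun l _ => incl_const l)) exchange_big /=.
rewrite mulr_natr -sumr_const; apply: eq_bigr => S; rewrite inE => /eqP SM.
by rewrite sum_mem SM.
Qed.

(** Count the elements of the draws containing [k]: each has [M] of them, one being [k] itself, and
    the other [n - 1] candidates occur equally often by symmetry. *)
Lemma incl2E k l : k != l -> (n%:R - 1) * incl2 k l = (M%:R - 1) * incl k.
Proof.
move=> kl.
have incl2_const j : j != k -> incl2 k j = incl2 k l.
  move=> jk; rewrite -(incl2_perm (tperm j l)) tpermL tpermD//.
  by rewrite eq_sym.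
have tot : \sum_j incl2 k j = M%:R * incl k.
  rewrite exchange_big mulr_sumr; apply: eq_bigr => S; rewrite inE => /eqP SM.
  by rewrite -mulr_sumr sum_mem SM mulrC.
move: tot; rewrite (bigD1 k)//= incl2_diag (eq_bigr _ incl2_const).
rewrite sumr_const => tot.
have -> : (n%:R - 1) * incl2 k l = incl2 k l *+ #|[pred j | j != k]|.
  have -> : #|[pred j | j != k]| = (n - 1)%N by rewrite subn1; exact: cardC1.
  rewrite -[RHS]mulr_natl natrB//.
  by apply/card_gt0P; exists k.
by rewrite mulrBl mul1r -tot; ring.
Qed.

Lemma sampling_mean (a : T -> R) :
  n%:R * \sum_(S in draws) \sum_(k in S) a k = M%:R * total * \sum_k a k.
Proof.
have -> : \sum_(S in draws) \sum_(k in S) a k = \sum_k incl k * a k.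
  rewrite (eq_bigr (fun S : {set T} => \sum_k (k \in S)%:R * a k)).
    by rewrite exchange_big; apply: eq_bigr => k _; rewrite mulr_suml.
  move=> S _; rewrite big_mkcond; apply: eq_bigr => k _.
  by case: (k \in S); rewrite ?mul1r ?mul0r.
by rewrite !mulr_sumr; apply: eq_bigr => k _; rewrite mulrA inclE.
Qed.

(** The second-order inclusions are a constant [b] off the diagonal. As the [x k] sum to zero, [b]
    can be subtracted everywhere and only [incl k - b] on the diagonal survives: the
    finite-population correction. *)
Lemma sampling_var d (x : T -> 'rV[R]_d) : (1 < n)%N -> \sum_k x k = 0 ->
  \sum_(S in draws) dot (\sum_(k in S) x k) (\sum_(k in S) x k) =
  total * (M%:R * (n%:R - M%:R) / (n%:R * (n%:R - 1))) * \sum_k dot (x k) (x k).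
Proof.
move=> n1 x0; have np : n%:R != 0 :> R by rewrite pnatr_eq0 -lt0n ltnW.
have nm : n%:R - 1 != 0 :> R by rewrite subr_eq0 pnatr_eq1 gtn_eqF.
have -> : \sum_(S in draws) dot (\sum_(k in S) x k) (\sum_(k in S) x k) =
    \sum_k \sum_l incl2 k l * dot (x k) (x l).
  rewrite (eq_bigr (fun S : {set T} =>
    \sum_k \sum_l (k \in S)%:R * (l \in S)%:R * dot (x k) (x l))).
    rewrite exchange_big; apply: eq_bigr => k _.
    by rewrite exchange_big; apply: eq_bigr => l _; rewrite mulr_suml.
  move=> S _; rewrite dot_suml big_mkcond; apply: eq_bigr => k _.
  rewrite dot_sumr big_mkcond /=; case: (k \in S); last first.
    by rewrite big1// => l _; rewrite !mul0r.
  by apply: eq_bigr => l _; case: (l \in S); rewrite ?mul1r ?mulr0 ?mul0r.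
rewrite mulr_sumr; apply: eq_bigr => k _.
pose b := (M%:R - 1) / (n%:R - 1) * incl k.
have -> : \sum_l incl2 k l * dot (x k) (x l) =
    \sum_l b * dot (x k) (x l) + (incl k - b) * dot (x k) (x k).
  rewrite [LHS](bigD1 k)//= [in RHS](bigD1 k)//= incl2_diag.
  rewrite (eq_bigr (fun l => b * dot (x k) (x l))); first by ring.
  move=> l lk; congr (_ * _); apply: (mulfI nm).
  by rewrite incl2E 1?eq_sym// /b mulrA mulrCA divff ?mulr1.
rewrite -mulr_sumr -dot_sumr x0 dot0r mulr0 add0r; congr (_ * _).
rewrite /b; have -> : incl k = M%:R * total / n%:R.
  by rewrite -(inclE k) mulrAC divff// mul1r.

by field; rewrite np nm.
Qed.

End Sampling.

(** * Local drift of one client *)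

Lemma sqr_sum_le_card (R : realFieldType) s (a : 'I_s -> R) :
  (\sum_u a u) ^+ 2 <= s%:R * \sum_u a u ^+ 2.
Proof.
case: s a => [|s] a; first by rewrite !big_ord0 expr0n mul0r.
have sp : 0 < s.+1%:R :> R by rewrite ltr0n.
have := @sqr_sum_le R _ (fun=> s.+1%:R^-1) a _ _.
rewrite -!mulr_sumr exprMn => h.
have : s.+1%:R^-1 ^+ 2 * (\sum_u a u) ^+ 2 <= s.+1%:R^-1 * \sum_u a u ^+ 2.
  apply: h => [_|]; first by rewrite invr_ge0 ltW.
  by rewrite sumr_const card_ord -[leLHS]mulr_natr mulVf ?gt_eqF.
rewrite -(ler_pM2l (exprn_gt0 2 sp)) mulrA -exprMn mulfV ?gt_eqF// expr1n mul1r.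
by rewrite expr2 -mulrA [s.+1%:R * (s.+1%:R^-1 * _)]mulrA mulfV ?gt_eqF// mul1r.
Qed.

Lemma dot_sum_le_card (R : realType) d s (F : 'I_s -> 'rV[R]_d) :
  dot (\sum_u F u) (\sum_u F u) <= s%:R * \sum_u dot (F u) (F u).
Proof.
rewrite /dot exchange_big /= mulr_sumr; apply: ler_sum => j _.
rewrite -expr2 summxE; under [in leRHS]eq_bigr do rewrite -expr2.
exact: sqr_sum_le_card.
Qed.

(** By induction [(1 + x)^n (1 - n x) <= 1], because [(1 + x)(1 - (n + 1) x) <= 1 - n x]; at
    [n x <= 1/4] the second factor is at least 3/4. *)
Lemma expr1D_le (R : realFieldType) (x : R) s : 0 <= x -> s%:R * x <= 1 / 4 ->
  (1 + x) ^+ s <= 4 / 3.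
Proof.
move=> x0 sx; have key n : n%:R * x <= 1 -> (1 + x) ^+ n * (1 - n%:R * x) <= 1.
  elim: n => [|n IH] nx; first by rewrite expr0 mul0r subr0 mulr1.
  have nx' : n%:R * x <= 1 by apply: le_trans nx; rewrite ler_wpM2r// ler_nat.
  apply: le_trans (IH nx'); rewrite exprSr -mulrA ler_wpM2l ?exprn_ge0 ?addr_ge0//.
  have : 0 <= n%:R * x ^+ 2 by rewrite mulr_ge0 ?sqr_ge0.
  by have := sqr_ge0 x; rewrite -natr1; lra.
have h : (1 + x) ^+ s * (1 - s%:R * x) <= 1 by apply: key; lra.
have : (1 + x) ^+ s * (3 / 4) <= (1 + x) ^+ s * (1 - s%:R * x).
  by rewrite ler_wpM2l ?exprn_ge0 ?addr_ge0//; lra.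
by lra.
Qed.

Section Drift.
Context (R : realType) (A : fedhv R).
Hypothesis hA : setup_ok A.
Local Notation V := 'rV[R]_(Defs.dim A).
Local Notation m := (tasks A).
Local Notation N := (clients A).
Local Notation nk := (samples A).
Local Notation b := (batch A).
Local Notation K := (local_steps A).

Definition client_grad (u : 'I_m -> R) (k : 'I_N) (x : V) : V :=
  \sum_i u i *: grad (f_client i k) x.

Definition het_grad (u : 'I_m -> R) (k : 'I_N) (x : V) : V :=
  \sum_i u i *: (grad (f_client i k) x - grad (f_obj i) x).

Definition noise_grad (u : 'I_m -> R) (k : 'I_N) (x : V) (B : b.-tuple 'I_nk) : V :=
  \sum_i u i *: (stoch_grad i k x B - grad (f_client i k) x).

Definition batch_grad (u : 'I_m -> R) (k : 'I_N) (x : V) (B : b.-tuple 'I_nk) : V :=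
  \sum_i u i *: stoch_grad i k x B.

Lemma client_gradE u k x : client_grad u k x = het_grad u k x + mix_grad u x.
Proof.
rewrite -big_split; apply: eq_bigr => i _.
by rewrite /= -scalerDr subrK.
Qed.

Lemma batch_gradE u k x B : batch_grad u k x B = noise_grad u k x B + client_grad u k x.
Proof.
rewrite -big_split; apply: eq_bigr => i _.
by rewrite /= -scalerDr subrK.
Qed.

Lemma sum_het_grad u x : \sum_k het_grad u k x = 0.
Proof.
rewrite exchange_big big1//= => i _; rewrite -scaler_sumr sumrB sumr_const card_ord.
rewrite grad_f_obj// -scaler_nat scalerA divff ?scale1r ?subrr ?scaler0//.
by rewrite pnatr_eq0 -lt0n; apply: leq_trans (clients_ge2 hA).
Qed.

Section Weighted.
Variable u : 'I_m -> R.
Hypotheses (u0 : forall i, 0 <= u i) (u1 : \sum_i u i = 1).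

Lemma weight_le1 i : u i <= 1.
Proof. by rewrite -u1 (bigD1 i)//= lerDl sumr_ge0. Qed.

(** After Jensen the weights are bounded by one and dropped. This is why [Sigma2] and the sum of the
    squared [heter] run over all tasks and do not see the weights. *)
Lemma dot_mix_le (F : 'I_m -> V) :
  dot (\sum_i u i *: F i) (\sum_i u i *: F i) <= \sum_i dot (F i) (F i).
Proof.
apply: le_trans (dot_sum_le _ u0 _) _; first by rewrite u1.
by apply: ler_sum => i _; rewrite ler_piMl ?dot_ge0// weight_le1.
Qed.

Lemma client_grad_smooth k x y :
  enorm (client_grad u k x - client_grad u k y) <= Lw A * enorm (x - y).
Proof.
rewrite -sumrB; apply: le_trans (ler_enorm_sum _ _ _) _.
rewrite mulr_suml; apply: ler_sum => i _; rewrite -scalerBr enormZ ger0_norm//.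
apply: le_trans (f_client_smooth hA i k x y).
by rewrite ler_piMl ?enorm_ge0// weight_le1.
Qed.

Lemma sum_dot_het_grad_le x :
  (forall i, heterogeneity i x <= heter i ^+ 2) ->
  N%:R^-1 * \sum_k dot (het_grad u k x) (het_grad u k x) <= \sum_(i < m) heter i ^+ 2.
Proof.
move=> hx; apply: le_trans (ler_sum _ (fun i _ => hx i)).
rewrite -mulr_sumr ler_wpM2l ?invr_ge0// [leRHS]exchange_big /=.
apply: ler_sum => k _; apply: le_trans (dot_mix_le _) _.
by apply: ler_sum => i _; rewrite enorm_sqr.
Qed.

Context (eta_l : R) (x : V) (B : nat -> b.-tuple 'I_nk) (k : 'I_N).
Hypotheses (eta0 : 0 <= eta_l) (etaL : K%:R * (eta_l * Lw A) <= 1 / 4).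

Local Notation y := (local_iter eta_l u x B k).
Local Notation v := (virtual_iter eta_l u x).
Local Notation noise s := (noise_grad u k (y s) (B s)).
Local Notation het s := (het_grad u k (v s)).
Local Notation q s := (batch_grad u k (y s) (B s)).
Local Notation err s := (dot (noise s) (noise s) + dot (het s) (het s)).

Let Kgt0 : 0 < K%:R :> R.
Proof. by rewrite ltr0n (local_steps_ge1 hA). Qed.

Let Lw0 : 0 <= Lw A.
Proof. exact/ltW/Lw_gt0. Qed.

Lemma local_iterE s : y s - x = - (eta_l *: \sum_(r < s) q r).
Proof.
elim: s => [|s IH]; first by rewrite big_ord0 scaler0 oppr0 subrr.
by rewrite /= big_ord_recr /= scalerDr opprD -IH addrAC.
Qed.

Lemma local_iter_dist s :
  dot (y s - x) (y s - x) <= eta_l ^+ 2 * (s%:R * \sum_(r < s) dot (q r) (q r)).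
Proof.
rewrite local_iterE dotNl dotNr opprK dotZl dotZr mulrA -expr2.
by rewrite ler_wpM2l ?sqr_ge0// dot_sum_le_card.
Qed.

(** Discrete Gronwall: a step expands the distance by at most [1 + eta_l * Lw] and adds [eta_l]
    times noise and heterogeneity. The client gradient is compared between the two trajectories
    first, so that heterogeneity is needed only at the virtual iterate. *)
Lemma local_virtual_dist s : enorm (y s - v s) <=
  eta_l * (1 + eta_l * Lw A) ^+ s * \sum_(r < s) (enorm (noise r) + enorm (het r)).
Proof.
elim: s => [|s IH]; first by rewrite subrr enorm0 big_ord0 mulr0.
set x1 := 1 + eta_l * Lw A in IH *.
have x1ge : 1 <= x1 by rewrite lerDl mulr_ge0.
have -> : y s.+1 - v s.+1 = (y s - v s)
    - eta_l *: (client_grad u k (y s) - client_grad u k (v s)) - eta_l *: (noise s +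
        het s).
  rewrite /= -/(batch_grad u k (y s) (B s)) -/(mix_grad u (v s)) batch_gradE.
  rewrite (client_gradE u k (v s)).
  move: (y s) (v s) (noise s) (client_grad u k (y s)) (mix_grad u (v s)) (het s).
  by move=> y0 v0 n0 c0 m0 h0; apply/rowP => j; rewrite !mxE; ring.
rewrite big_ord_recr /= mulrDr.
apply: le_trans (ler_enormD _ _) _; rewrite enormN enormZ (ger0_norm eta0).
apply: lerD; last first.
  apply: le_trans (ler_wpM2l eta0 (ler_enormD _ _)) _.
  rewrite -mulrA ler_wpM2l// ler_peMl ?addr_ge0 ?enorm_ge0//.
  by rewrite exprn_ege1.
apply: le_trans (ler_enormD _ _) _; rewrite enormN enormZ (ger0_norm eta0).
rewrite exprS.
have := client_grad_smooth k (y s) (v s).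
move=> /(ler_wpM2l eta0) h.
have : x1 * enorm (y s - v s) <= x1 * (eta_l * x1 ^+ s *
   \sum_(r < s) (enorm (noise r) + enorm (het r))).
  by rewrite ler_wpM2l// (le_trans _ x1ge).
rewrite {1}/x1; move: h; set S := \sum_(r < s) _; set a := x1 ^+ s; lra.
Qed.

Lemma sum_le_trunc s (F : nat -> R) : (forall r, 0 <= F r) -> (s <= K)%N ->
  \sum_(r < s) F r <= \sum_(r < K) F r.
Proof.
move=> F0 sK; rewrite -(subnKC sK) big_split_ord /= lerDl.
by apply: sumr_ge0.
Qed.

(** The growth factor is at most 4/3 and [K * eta_l * Lw <= 1/4], so their product squared is 1/9;
    the 2 separates noise from heterogeneity. Summing up to [K] makes the bound uniform in [s]. *)
Lemma smooth_drift s : (s <= K)%N ->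
  Lw A ^+ 2 * dot (y s - v s) (y s - v s) <=
  2 / 9 * (K%:R^-1 * \sum_(r < K) err r).
Proof.
move=> sK; set x1 := eta_l * Lw A.
have x10 : 0 <= x1 by rewrite mulr_ge0.
have sK' : s%:R <= K%:R :> R by rewrite ler_nat.
have pw : (1 + x1) ^+ s <= 4 / 3.
  by apply: expr1D_le => //; apply: le_trans etaL; rewrite ler_wpM2r.
set S := \sum_(r < s) (enorm (noise r) + enorm (het r)).
have S0 : 0 <= S by apply: sumr_ge0 => r _; rewrite addr_ge0 ?enorm_ge0.
have Lw_e : Lw A * enorm (y s - v s) <= 4 / 3 * x1 * S.
  apply: le_trans (ler_wpM2l Lw0 (local_virtual_dist s)) _; rewrite -/S -/x1.
  have -> : Lw A * (eta_l * (1 + x1) ^+ s * S) = (1 + x1) ^+ s * (x1 * S).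
    by rewrite /x1; ring.
  by rewrite -mulrA ler_wpM2r// mulr_ge0.
have S2 : S ^+ 2 <= K%:R * (2 * \sum_(r < K) err r).
  apply: le_trans (sqr_sum_le_card _) _.
  apply: ler_pM => //; first by apply: sumr_ge0 => r _; rewrite sqr_ge0.
  rewrite mulr_sumr.
  apply: le_trans (@sum_le_trunc s (fun r => 2 * err r) _ sK); last first.
    by move=> r; rewrite mulr_ge0// addr_ge0 ?dot_ge0.
  have sqrD_le (p z : R) : (p + z) ^+ 2 <= 2 * (p ^+ 2 + z ^+ 2).
    by have := sqr_ge0 (p - z); lra.
  by apply: ler_sum => r _; rewrite -!enorm_sqr; exact: sqrD_le.
have x1K : (4 / 3 * x1) ^+ 2 * K%:R ^+ 2 <= 1 / 9.
  have : (K%:R * x1) ^+ 2 <= (1 / 4) ^+ 2.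
    by rewrite ler_sqr ?nnegrE ?mulr_ge0 ?(ltW Kgt0)//; lra.
  by rewrite !exprMn; lra.
rewrite -enorm_sqr -exprMn; apply: (@le_trans _ _ ((4 / 3 * x1 * S) ^+ 2)).
  by rewrite ler_sqr ?nnegrE ?mulr_ge0 ?enorm_ge0//; lra.
rewrite exprMn; apply: le_trans (ler_wpM2l (sqr_ge0 _) S2) _.
set E := \sum_(r < K) err r.
have E0 : 0 <= E by apply: sumr_ge0 => r _; rewrite addr_ge0 ?dot_ge0.
have -> : (4 / 3 * x1) ^+ 2 * (K%:R * (2 * E)) =
    (4 / 3 * x1) ^+ 2 * K%:R ^+ 2 * (2 * (K%:R^-1 * E)).
  by field; rewrite gt_eqF.
have -> : 2 / 9 * (K%:R^-1 * E) = 1 / 9 * (2 * (K%:R^-1 * E)) by ring.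
by rewrite ler_wpM2r// !mulr_ge0// invr_ge0 ltW.
Qed.

(** The reference point is the mixture at the virtual iterate, which is safe and thus bounded by
    [Gmax]; the remainder is noise, heterogeneity and [smooth_drift], with 6 = 2 * 3 from the two
    convexity inequalities. *)
Lemma batch_grad_le s : (s <= K)%N -> safe (v s) ->
  dot (q s) (q s) <= 2 * Gmax A ^+ 2 +
    6 * (err s + 2 / 9 * (K%:R^-1 * \sum_(r < K) err r)).
Proof.
move=> sK sv; have -> : q s = mix_grad u (v s) +
    (noise s + het s + (client_grad u k (y s) - client_grad u k (v s))).
  rewrite batch_gradE (client_gradE u k (v s)).
  move: (noise s) (client_grad u k (y s)) (mix_grad u (v s)) (het s) => n0 c0 m0 h0.
  by apply/rowP => j; rewrite !mxE; ring.
have arith (m2 e2 c2 L2 E t G2 : R) : c2 <= L2 -> L2 <= 2 / 9 * E ->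
    t <= 3 * (e2 + c2) -> m2 <= G2 -> 2 * m2 + 2 * t <= 2 * G2 + 6 * (e2 + 2 / 9 * E).
  by lra.
have sm : dot (client_grad u k (y s) - client_grad u k (v s))
    (client_grad u k (y s) - client_grad u k (v s)) <=
    Lw A ^+ 2 * dot (y s - v s) (y s - v s).
  rewrite -(enorm_sqr (y s - v s)) -exprMn.
  exact: enorm_sqr_le (client_grad_smooth k _ _).
apply: le_trans (dotD_le _ _) _; apply: (arith _ _ _ _ _ _ _ sm (smooth_drift sK)).
  exact: dotD3_le.
exact: enorm_sqr_le (mix_grad_le hA sv u0 u1).
Qed.

End Weighted.
End Drift.

(** * Expectations as finite sums over histories *)

Section FiniteModel.
Context d (Omega : measurableType d) (R : realType) (P : probability Omega R).
Context (H : finType) (hist : Omega -> H).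
Hypothesis mhist : forall h, measurable (hist @^-1` [set h]).

Definition mass (h : H) : R := fine (P (hist @^-1` [set h])).

Lemma mass_ge0 h : 0 <= mass h.
Proof. exact/fine_ge0/measure_ge0. Qed.

Lemma massE h : P (hist @^-1` [set h]) = (mass h)%:E.
Proof. by rewrite fineK// fin_num_measure. Qed.

(** A history of positive mass cannot be contained in the null set of bad outcomes, so it has a good
    representative. Attained histories of mass zero get any representative, and unattained ones an
    arbitrary outcome. *)
Lemma exists_pick (good : set Omega) : {ae P, forall w, good w} ->
  exists pick : H -> Omega, (forall w, hist (pick (hist w)) = hist w) /\
    (forall h, 0 < mass h -> good (pick h)).
Proof.
move=> [B [mB PB badB]].
(* [Omega] is inhabited, since otherwise [P setT] would be 0. *)
have [w0 _] : exists w : Omega, True.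
  apply: contrapT => /forallNP emp; have : P setT = 0%:E.
    rewrite (_ : setT = set0) ?measure0//; apply/seteqP; split => // x _.

  by rewrite probability_setT => -[] /eqP; rewrite oner_eq0.
have ex h : exists w, ((exists w', hist w' = h) -> hist w = h) /\
    (0 < mass h -> good w).
  have [h0|h0] := ltP 0 (mass h).
    suff [w [hw gw]] : exists w, hist w = h /\ good w by exists w.
    apply: contrapT => /forallNP no.
    have : (P (hist @^-1` [set h]) <= P B)%E.
      apply: le_measure; rewrite ?inE//.
      by move=> w hw; apply: badB => gw; apply: (no w).
    by rewrite massE PB lee_fin leNgt h0.
  have [[w hw]|no] := pselect (exists w', hist w' = h).
    by exists w.
  by exists w0.
have [pick pP] := choice ex; exists pick; split=> [w|h].
  by have [-> //] := pP (hist w); exists w.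
by have [] := pP h.
Qed.

Variable pick : H -> Omega.
Hypothesis pickK : forall w, hist (pick (hist w)) = hist w.

(* Evaluating at representatives makes this linear and monotone without side
   conditions; it is the expectation of any function of [hist]. *)
Definition mean (X : Omega -> R) : R := \sum_h mass h * X (pick h).

Definition factored (T : Type) (X : Omega -> T) :=
  forall w w', hist w = hist w' -> X w = X w'.

Lemma factored_pick T (X : Omega -> T) w : factored X -> X w = X (pick (hist w)).
Proof. by move=> fX; apply: fX; rewrite pickK. Qed.

Lemma measurable_factored T (X : Omega -> T) (B : set T) : factored X ->
  measurable (X @^-1` B).
Proof.
move=> fX; rewrite (_ : _ @^-1` _ =
    \bigcup_(h in [set h | B (X (pick h))]) hist @^-1` [set h]).
  by apply: fin_bigcup_measurable => //; exact: finite_finset.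
apply/seteqP; split => [w Bw|w [h Bh /= hw]].
  by exists (hist w) => //=; rewrite -(factored_pick _ fX).
by rewrite /= (factored_pick _ fX) hw.
Qed.

Lemma measurable_event (E : set Omega) : factored E -> measurable E.
Proof.
move=> fE; rewrite (_ : E = (E : Omega -> Prop) @^-1` [set True]).
  exact: measurable_factored.
by apply/seteqP; split => w /=; [move=> Ew; exact/propT|move=> ->].
Qed.

(** The gate through which almost sure assumptions enter: only representatives of positive mass have
    to be compared, and those are good. *)
Lemma ler_mean (X Y : Omega -> R) :
  (forall h, 0 < mass h -> X (pick h) <= Y (pick h)) -> mean X <= mean Y.
Proof.
move=> XY; apply: ler_sum => h _; have := mass_ge0 h; rewrite le_eqVlt.
by move=> /predU1P[<-|h0]; rewrite ?mul0r// ler_wpM2l ?(ltW h0)// XY.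
Qed.

Lemma eq_mean (X Y : Omega -> R) :
  (forall h, 0 < mass h -> X (pick h) = Y (pick h)) -> mean X = mean Y.
Proof.
move=> XY; apply/eqP; rewrite eq_le !ler_mean// => h h0.
  by rewrite XY.
by rewrite XY.
Qed.

Lemma meanD X Y : mean (fun w => X w + Y w) = mean X + mean Y.
Proof. by rewrite -big_split; apply: eq_bigr => h _; rewrite mulrDr. Qed.

Lemma meanZ a X : mean (fun w => a * X w) = a * mean X.
Proof. by rewrite mulr_sumr; apply: eq_bigr => h _; rewrite mulrCA. Qed.

Lemma meanB X Y : mean (fun w => X w - Y w) = mean X - mean Y.
Proof. by rewrite -sumrB; apply: eq_bigr => h _; rewrite mulrBr. Qed.

Lemma mean_sum (I : Type) (r : seq I) (p : pred I) (X : I -> Omega -> R) :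
  mean (fun w => \sum_(i <- r | p i) X i w) = \sum_(i <- r | p i) mean (X i).
Proof.
rewrite exchange_big /=; apply: eq_bigr => h _; exact: mulr_sumr.
Qed.

Lemma mean_ge0 X : (forall w, 0 <= X w) -> 0 <= mean X.
Proof. by move=> X0; apply: sumr_ge0 => h _; rewrite mulr_ge0 ?mass_ge0. Qed.

Lemma integral_mean (X : Omega -> R) : factored X -> (forall w, 0 <= X w) ->
  (\int[P]_w (X w)%:E = (mean X)%:E)%E.
Proof.
move=> fX X0.
have XE w : (X w)%:E =
    (\sum_h (X (pick h))%:E * (\1_(hist @^-1` [set h]) w)%:E)%E.
  rewrite (bigD1 (hist w))//= big1 ?adde0.
    by rewrite indicE mem_set// mule1 -(factored_pick _ fX).
  by move=> h hw; rewrite indicE memNset ?mule0//= => /esym/eqP; apply/negP.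
under eq_integral do rewrite XE.
have mI h : measurable_fun setT (fun w => (\1_(hist @^-1` [set h]) w)%:E : \bar R).
  by apply/measurable_EFinP; exact: measurable_indic.
rewrite ge0_integral_sum//; last first.
- by move=> h w _; rewrite mule_ge0 ?lee_fin.
- by move=> h; apply: measurable_funeM.
rewrite -sumEFin; apply: eq_bigr => h _.
rewrite ge0_integralZl_EFin//.
rewrite integral_indic// setIT.
transitivity ((X (pick h))%:E * (mass h)%:E)%E; last by rewrite -EFinM mulrC.
by congr (_ * _)%E; exact: massE.
Qed.

Lemma prob_mean (E : set Omega) : factored E -> P E = (mean \1_E)%:E.
Proof.
move=> fE; have mE := measurable_event fE.
rewrite -integral_mean; first by rewrite integral_indic// setIT.
- move=> w w' /fE ww'; rewrite !indicE; congr (_%:R).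
  have [Ew|Ew] := pselect (E w); first by rewrite !mem_set// -ww'.
  by rewrite !memNset// -ww'.
- by move=> w; rewrite indicE ler0n.
Qed.

Lemma mean_cst c : mean (fun=> c) = c.
Proof.
rewrite (_ : (fun=> c) = fun w => c * \1_(setT : set Omega) w).
  rewrite meanZ; suff -> : mean \1_setT = 1 by rewrite mulr1.
  by apply: EFin_inj; rewrite -prob_mean// probability_setT.
by apply/funext => w; rewrite indicE in_setT mulr1.
Qed.

(** The freezing lemma of conditional expectation: on the event [a], [Y] has law [q] given [X], so
    [Y] is integrated out with [X] held fixed. The event is needed because the law of a client's
    minibatch is given only where the client is selected. Both sides are expanded over the values of
    [X] and [Y]. *)
Lemma mean_cond_fin (T F : finType) (X : Omega -> T) (Y : Omega -> F)
    (a : pred T) (q : F -> R) (phi : T -> F -> R) :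
  factored X -> factored Y ->
  (forall x y, P (X @^-1` [set x] `&` [set w | a (X w) /\ Y w = y]) =
    ((q y)%:E * P (X @^-1` [set x] `&` [set w | a (X w)]))%E) ->
  mean (fun w => if a (X w) then phi (X w) (Y w) else 0) =
  mean (fun w => if a (X w) then \sum_y q y * phi (X w) y else 0).
Proof.
move=> fX fY law.
have fE1 x y : factored (X @^-1` [set x] `&` [set w | a (X w) /\ Y w = y]).
  by move=> w w' ww'; rewrite /setI /= (fX _ _ ww') (fY _ _ ww').
have fE2 x : factored (X @^-1` [set x] `&` [set w | a (X w)]).
  by move=> w w' ww'; rewrite /setI /= (fX _ _ ww').
have law' x y : mean \1_(X @^-1` [set x] `&` [set w | a (X w) /\ Y w = y]) =
    q y * mean \1_(X @^-1` [set x] `&` [set w | a (X w)]).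
  by apply: EFin_inj; rewrite EFinM -!prob_mean// law.
transitivity (mean (fun w => \sum_x \sum_y phi x y *
    \1_(X @^-1` [set x] `&` [set w | a (X w) /\ Y w = y]) w)).
  congr mean; apply/funext => w; rewrite (bigD1 (X w))//= [X in _ + X]big1 => [|x xw].
    rewrite addr0; case: ifPn => aw; last first.
      rewrite big1// => y _; rewrite indicE memNset ?mulr0// => -[_ [] /=].
      by rewrite (negbTE aw).
    rewrite (bigD1 (Y w))//= big1 ?addr0 ?indicE ?mem_set ?mulr1// => y yw.
    by rewrite indicE memNset ?mulr0// => -[_ [_ /= ywE]]; rewrite ywE eqxx in yw.
  rewrite big1// => y _; rewrite indicE memNset ?mulr0// => -[/= xwE _].
  by rewrite xwE eqxx in xw.
transitivity (mean (fun w => \sum_x (\sum_y q y * phi x y) *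
    \1_(X @^-1` [set x] `&` [set w | a (X w)]) w)); last first.
  congr mean; apply/funext => w; rewrite (bigD1 (X w))//= [X in _ + X]big1 => [|x xw].
    rewrite addr0; case: ifPn => aw; first by rewrite indicE mem_set// mulr1.
    by rewrite indicE memNset ?mulr0// => -[_ /=]; rewrite (negbTE aw).
  rewrite indicE memNset ?mulr0// => -[/= xwE _].
  by rewrite xwE eqxx in xw.
rewrite !mean_sum; apply: eq_bigr => x _; rewrite mean_sum meanZ mulr_suml.
by apply: eq_bigr => y _; rewrite meanZ law'; ring.
Qed.

(* [X] takes finitely many values; index them by representatives in [H]. *)
Lemma mean_cond (T : Type) (F : finType) (X : Omega -> T) (Y : Omega -> F)
    (a : pred T) (q : F -> R) (phi : T -> F -> R) :
  factored X -> factored Y ->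
  (forall x y, P (X @^-1` [set x] `&` [set w | a (X w) /\ Y w = y]) =
    ((q y)%:E * P (X @^-1` [set x] `&` [set w | a (X w)]))%E) ->
  mean (fun w => if a (X w) then phi (X w) (Y w) else 0) =
  mean (fun w => if a (X w) then \sum_y q y * phi (X w) y else 0).
Proof.
move=> fX fY law.
(* The choice depends only on the value of [X], so histories with equal values share one code, and
   [xi] takes values in a finite type. *)
pose cls h := odflt h [pick h' | `[< X (pick h') = X (pick h) >]].
have clsE h : X (pick (cls h)) = X (pick h).
  by rewrite /cls; case: pickP => //= h' /asboolP.
have cls_eq h h' : X (pick h) = X (pick h') -> cls h = cls h'.
  move=> hh'; rewrite /cls.
  rewrite (eq_pick (_ : _ =1 (fun h0 => `[< X (pick h0) = X (pick h') >]))).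
    by case: pickP => //= /(_ h'); rewrite asboolT.
  by move=> h0; rewrite /= hh'.
pose xi w := cls (hist w).
have xiE w : X w = X (pick (xi w)) by rewrite /xi clsE -(factored_pick _ fX).
have := @mean_cond_fin _ _ xi Y (fun h => a (X (pick h))) q
  (fun h y => phi (X (pick h)) y) _ fY _.
have -> : (fun w => if a (X (pick (xi w))) then phi (X (pick (xi w))) (Y w) else 0) =
    (fun w => if a (X w) then phi (X w) (Y w) else 0).
  by apply/funext => w; rewrite -xiE.
have -> : (fun w => if a (X (pick (xi w)))
      then \sum_y q y * phi (X (pick (xi w))) y else 0) =
    (fun w => if a (X w) then \sum_y q y * phi (X w) y else 0).
  by apply/funext => w; rewrite -xiE.
apply=> //; first by move=> w w' ww'; rewrite /xi ww'.
move=> x y.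
have -> : [set w | a (X (pick (xi w)))] = [set w | a (X w)].
  by apply/seteqP; split => w /=; rewrite -xiE.
have -> : [set w | a (X (pick (xi w))) /\ Y w = y] = [set w | a (X w) /\ Y w = y].
  by apply/seteqP; split => w /=; rewrite -xiE.
have [[w xw]|no] := pselect (exists w, xi w = x).
  rewrite (_ : xi @^-1` [set x] = X @^-1` [set X w]) ?law//.
  apply/seteqP; split => w' /=; first by rewrite -xw (xiE w) (xiE w') => ->.
  move=> ww'; rewrite -xw; apply: cls_eq.
  by rewrite -!(factored_pick _ fX).
rewrite (_ : xi @^-1` [set x] = set0) ?set0I ?measure0 ?mule0//.
by apply/seteqP; split => // w xw; apply: no; exists w.
Qed.

(** Measurability for the discrete structure on [T], so that it composes with arbitrary functions,
    gradients included. For variables with finitely many values the preimages of singletons suffice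
    ([gmeas_singletons]). *)
Definition gmeas (G : set_system Omega) (T : Type) (X : Omega -> T) :=
  forall B : set T, G (X @^-1` B).

Lemma gmeas_comp G (T U : Type) (f : T -> U) (X : Omega -> T) :
  gmeas G X -> gmeas G (fun w => f (X w)).
Proof. by move=> gX B; exact: (gX (f @^-1` B)). Qed.

Lemma gmeas_sub (G G' : set_system Omega) (T : Type) (X : Omega -> T) :
  G `<=` G' -> gmeas G X -> gmeas G' X.
Proof. by move=> GG' gX B; exact/GG'/gX. Qed.

Lemma sigma_algebra_bigcup_fin (G : set_system Omega) (F : H -> set Omega) :
  sigma_algebra setT G -> (forall h, G (F h)) -> G (\bigcup_h F h).
Proof.
move=> /sigma_algebra_id GE GF; rewrite -GE.
have : @measurable _ (g_sigma_algebraType G) (\bigcup_h F h).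
  apply: fin_bigcup_measurable; first exact: finite_finset.
  by move=> h _; rewrite /measurable /= GE.
by [].
Qed.

Lemma sigma_algebra_setI (G : set_system Omega) (E1 E2 : set Omega) :
  sigma_algebra setT G -> G E1 -> G E2 -> G (E1 `&` E2).
Proof.
move=> /sigma_algebra_id GE G1 G2; rewrite -GE.
have : @measurable _ (g_sigma_algebraType G) (E1 `&` E2).
  by apply: measurableI; rewrite /measurable /= GE.
by [].
Qed.

(** As [X] has finitely many values, any preimage under the pair is a finite union of
    intersections. *)
Lemma gmeas_pair (G : set_system Omega) (T U : Type) (X : Omega -> T) (Y : Omega -> U) :
  sigma_algebra setT G -> factored X -> gmeas G X -> gmeas G Y ->
  gmeas G (fun w => (X w, Y w)).
Proof.
move=> sG fX gX gY B.
rewrite (_ : _ @^-1` B = \bigcup_(h : H)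
   (X @^-1` [set X (pick h)] `&` Y @^-1` [set y | B (X (pick h), y)])).
  by apply: sigma_algebra_bigcup_fin => // h; exact: sigma_algebra_setI.
apply/seteqP; split => [w Bw|w [h _ [/= -> //]]].
by exists (hist w) => //=; rewrite -(factored_pick _ fX).
Qed.

(** Integrating over [E] instead of the whole space keeps the factor P(E). With [E] the selection of
    a client, these factors add up to [M] over the clients and cancel the [1/M] of the average. *)
Lemma cond_exp_mean_le (G : set_system Omega) (X : Omega -> R) Y (E : set Omega) (s :
    R) :
  G `<=` measurable -> cond_exp P G X Y -> {ae P, forall w, (Y w <= s%:E)%E} ->
  G E -> factored E -> factored X -> (forall w, 0 <= X w) -> 0 <= s ->
  (forall w, ~ E w -> X w = 0) -> mean X <= s * mean \1_E.
Proof.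
move=> Gm [Y0 mY YE] Ys GE fE fX X0 s0 XE.
have mE : measurable E by exact: Gm.
rewrite -lee_fin -integral_mean// EFinM -prob_mean//.
have -> : (\int[P]_w (X w)%:E = \int[P]_(w in E) (X w)%:E)%E.
  rewrite [RHS]integral_mkcond; apply: eq_integral => w _.
  rewrite /patch; case: ifPn => // /negP Ew; rewrite XE// => Ew'.
  by apply: Ew; rewrite inE.
rewrite YE// -(integral_cst P mE s%:E).
apply: ae_ge0_le_integral => //.
- by move=> _ B mB; apply: measurableI => //; exact/Gm/mY.
- by case: Ys => B [mB PB sub]; exists B; split => // w Yw; apply: sub => /= h; apply:
    Yw.
Qed.

Lemma cond_prob_cst (G : set_system Omega) (E B : set Omega) (c : R) :
  G `<=` measurable -> measurable B -> cond_prob P G B (fun=> c%:E) -> G E ->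
  P (B `&` E) = (c%:E * P E)%E.
Proof.
move=> Gm mB [_ _ cE] GE; have mE := Gm _ GE.
by rewrite -integral_indic// cE// -(integral_cst P mE).
Qed.

End FiniteModel.

(** * The process *)

Lemma sigma_of_preimage d (Omega : measurableType d) (T : finType) (X : Omega -> T)
  (B : set T) : sigma_of X (X @^-1` B).
Proof. by exists B => //; rewrite setTI. Qed.

(** * Unbiasedness of the minibatch gradients *)

Section Minibatch.
Context (R : realType) (A : fedhv R).
Hypothesis hA : setup_ok A.
Local Notation V := 'rV[R]_(Defs.dim A).
Local Notation nk := (samples A).
Local Notation b := (batch A).
Local Notation K := (local_steps A).

(** Transposing two indices in every tuple shows that each index occupies position [l] equally
    often; these counts add up to the number of tuples. *)
Lemma sum_tnth (l : 'I_b) (g : 'I_nk -> V) :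
  nk%:R *: \sum_(B : b.-tuple 'I_nk) g (tnth B l) = (nk ^ b)%:R *: \sum_j g j.
Proof.
pose cnt j : R := \sum_(B : b.-tuple 'I_nk) (tnth B l == j)%:R.
have cntC j j' : cnt j = cnt j'.
  pose s := tperm j j'.
  rewrite /cnt (reindex_inj (h := fun B : b.-tuple 'I_nk => [tuple of map s B])).
    apply: eq_bigr => B _; rewrite tnth_map; congr (_%:R).
    transitivity (s (tnth B l) == s j'); first by rewrite [s j']tpermR.
    by rewrite (inj_eq (@perm_inj _ s)).
  by move=> B B' /(congr1 val) /= /inj_map h; apply: val_inj; apply: h; exact: perm_inj.
have cnt_tot : \sum_j cnt j = (nk ^ b)%:R.
  rewrite exchange_big /=; rewrite (eq_bigr (fun=> 1)) => [|B _].
    by rewrite sumr_const card_tuple card_ord.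
  by rewrite (bigD1 (tnth B l))//= eqxx big1 ?addr0// => j; rewrite eq_sym => /negbTE->.
have cntE j : nk%:R * cnt j = (nk ^ b)%:R.
  by rewrite -cnt_tot (eq_bigr _ (fun j' _ => cntC j' j)) sumr_const card_ord mulr_natl.
have -> : \sum_(B : b.-tuple 'I_nk) g (tnth B l) = \sum_j cnt j *: g j.
  rewrite (eq_bigr (fun B : b.-tuple 'I_nk => \sum_j (tnth B l == j)%:R *: g j)).
    by rewrite exchange_big; apply: eq_bigr => j _; rewrite scaler_suml.
  move=> B _; rewrite (bigD1 (tnth B l))//= eqxx scale1r big1 ?addr0// => j.
  by rewrite eq_sym => /negbTE ->; rewrite scale0r.
by rewrite !scaler_sumr; apply: eq_bigr => j _; rewrite scalerA cntE.
Qed.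

Lemma stoch_grad_unbiased i (k : 'I_(clients A)) (x : V) :
  \sum_(B : b.-tuple 'I_nk) (\prod_(l < b) nk%:R^-1) *: stoch_grad i k x B =
  grad (f_client i k) x.
Proof.
have n0 : nk%:R != 0 :> R by rewrite pnatr_eq0 -lt0n (samples_ge1 hA).
have b0 : b%:R != 0 :> R by rewrite pnatr_eq0 -lt0n (batch_ge1 hA).
rewrite -scaler_sumr /stoch_grad -scaler_sumr exchange_big /=.
pose g j := grad (fun y => loss i y (data k j)) x.
rewrite (eq_bigr (fun=> (nk%:R^-1 * (nk ^ b)%:R) *: \sum_j g j)) => [|l _]; last first.
  rewrite -scalerA -(sum_tnth l g) scalerA mulVf// scale1r.
  by [].
rewrite sumr_const card_ord grad_f_client// -/g.
have -> (v : V) : v *+ b = b%:R *: v by rewrite scaler_nat.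
rewrite !scalerA prodr_const card_ord.
congr (_ *: _); rewrite natrX exprVn.
by field; rewrite n0 b0 expf_neq0.
Qed.

Lemma noise_grad_unbiased u (k : 'I_(clients A)) (x : V) :
  \sum_(B : b.-tuple 'I_nk) (\prod_(l < b) nk%:R^-1) *: noise_grad u k x B = 0.
Proof.
have n0 : nk%:R != 0 :> R by rewrite pnatr_eq0 -lt0n (samples_ge1 hA).
rewrite /noise_grad; under eq_bigr do rewrite scaler_sumr.
rewrite exchange_big big1//= => i _.
rewrite (eq_bigr (fun B => u i *: ((\prod_(l < b) nk%:R^-1) *: stoch_grad i k x B -
    (\prod_(l < b) nk%:R^-1) *: grad (f_client i k) x))) => [|B _]; last first.
  by rewrite -scalerBr !scalerA mulrC.
rewrite -scaler_sumr sumrB stoch_grad_unbiased -scaler_suml sumr_const card_tuple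
    card_ord.
rewrite prodr_const card_ord -[_ *+ _]mulr_natr natrX exprVn mulVf ?expf_neq0//.
by rewrite scale1r subrr scaler0.
Qed.

End Minibatch.

Section Process.
Context (R : realType) (A : fedhv R).
Hypothesis hA : setup_ok A.
Local Notation V := 'rV[R]_(Defs.dim A).
Local Notation m := (tasks A).
Local Notation N := (clients A).
Local Notation nk := (samples A).
Local Notation M := (selected A).
Local Notation b := (batch A).
Local Notation K := (local_steps A).
Context (eta_g eta_l : R) (T : nat) (d : measure_display)
  (Omega : measurableType d) (P : probability Omega R) (Z : randomness A Omega).
Hypothesis hP : process_ok eta_g eta_l P Z T.

Local Notation theta := (Defs.theta eta_g eta_l Z).
Local Notation weight := (Defs.weight eta_g eta_l Z).
Local Notation state := (Defs.state eta_g eta_l Z).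
Local Notation theta_loc := (Defs.theta_loc eta_g eta_l Z).
Local Notation virt := (Defs.virt eta_g eta_l Z).

Local Notation hist_t := {ffun 'I_T -> {set 'I_N} * {ffun 'I_N -> {set 'I_nk}} *
  {ffun 'I_K * 'I_N -> b.-tuple 'I_nk}}%type.

(** Rounds before [T], local steps before [K], and all clients whether selected or not: local
    iterates and noise are defined for every client, and this covers all they depend on. *)
Definition hist (w : Omega) : hist_t :=
  [ffun t : 'I_T => (sel Z t w, [ffun k => rep_set Z t k w],
    [ffun sk : 'I_K * 'I_N => minibatch Z t sk.1 sk.2 w])].

Local Notation factored := (factored hist).

Lemma factored_sel t : (t < T)%N -> factored (sel Z t).
Proof.
by move=> tT w w' /ffunP /(_ (Ordinal tT)); rewrite !ffunE /= => -[].
Qed.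

Lemma factored_rep t k : (t < T)%N -> factored (rep_set Z t k).
Proof.
move=> tT w w' /ffunP /(_ (Ordinal tT)); rewrite !ffunE /= => -[_ /ffunP /(_ k)].
by rewrite !ffunE.
Qed.

Lemma factored_minibatch t s k : (t < T)%N -> (s < K)%N -> factored (minibatch Z t s k).
Proof.
move=> tT sK w w' /ffunP /(_ (Ordinal tT)); rewrite !ffunE /= => -[_ _].
by move=> /ffunP /(_ (Ordinal sK, k)); rewrite !ffunE.
Qed.

Lemma measurable_hist h : measurable (hist @^-1` [set h]).
Proof.
rewrite (_ : _ @^-1` _ = \bigcap_(t : 'I_T) (
   sel Z t @^-1` [set (h t).1.1] `&`
   (\bigcap_(k : 'I_N) (rep_set Z t k @^-1` [set (h t).1.2 k])) `&`
   (\bigcap_(sk : 'I_K * 'I_N) (minibatch Z t sk.1 sk.2 @^-1` [set (h t).2 sk])))).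
  apply: fin_bigcap_measurable => [|t _]; first exact: finite_finset.
  have rl := process_round hP (ltn_ord t).
  apply: measurableI; [apply: measurableI|].
  - exact/(sel_meas rl)/sigma_of_preimage.
  - apply: fin_bigcap_measurable => [|k _]; first exact: finite_finset.
    exact/(rep_meas rl)/sigma_of_preimage.
  - apply: fin_bigcap_measurable => [|sk _]; first exact: finite_finset.
    exact/(minibatch_meas rl)/sigma_of_preimage.
apply/seteqP; split => [w /= <- t _|w hw /=].
  by rewrite !ffunE /=; split; [split|] => // k _ /=; rewrite ffunE.
apply/ffunP => t; have [[/= h1 h2] h3] := hw t I; rewrite ffunE.
rewrite (surjective_pairing (h t)) (surjective_pairing (h t).1).
by congr (_, _, _) => //; apply/ffunP => k; rewrite ffunE; [exact: h2|exact: h3].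
Qed.

Lemma local_iter_ext u (x : V) (B B' : nat -> b.-tuple 'I_nk) k s :
  (forall r, (r < s)%N -> B r = B' r) ->
  local_iter eta_l u x B k s = local_iter eta_l u x B' k s.
Proof.
elim: s => [//|s IH] BB'; rewrite [LHS]/= [RHS]/= (BB' s (ltnSn s)) IH// => r rs.
by apply: BB'; exact: ltnW.
Qed.

Lemma factored_state t : (t <= T)%N -> factored (state t).
Proof.
elim: t => //= t IH tT w w' ww'; rewrite (IH (ltnW tT) _ _ ww').
case: (state t w') => x u; congr pair.
  rewrite /server_step (factored_sel tT ww'); congr (_ + _ *: (_ *: _)).
  apply: eq_bigr => k _; congr (_ - _); apply: local_iter_ext => s sK.
  exact: factored_minibatch.
congr next_weight; apply/funext => i; rewrite /report (factored_sel tT ww').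
by congr (_ * _); apply: eq_bigr => k _; rewrite (factored_rep k tT ww').
Qed.

Lemma factored_theta t : (t <= T)%N -> factored (theta t).
Proof. by move=> tT w w' ww'; rewrite /Defs.theta (factored_state tT ww'). Qed.

Lemma factored_weight t : (t <= T)%N -> factored (weight t).
Proof. by move=> tT w w' ww'; rewrite /Defs.weight (factored_state tT ww'). Qed.

Lemma factored_fhat t : (t < T)%N -> factored (fhat eta_g eta_l Z t).
Proof.
move=> tT w w' ww'; apply/funext => i; rewrite /fhat /report (factored_sel tT ww').
rewrite (factored_theta (ltnW tT) ww').
by congr (_ * _); apply: eq_bigr => k _; rewrite (factored_rep k tT ww').
Qed.

Lemma factored_theta_loc t s k : (t < T)%N -> (s <= K)%N -> factored (theta_loc t s k).
Proof.
move=> tT sK w w' ww'; rewrite /Defs.theta_loc.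
rewrite (factored_theta (ltnW tT) ww') (factored_weight (ltnW tT) ww').
apply: local_iter_ext => r rs; apply: factored_minibatch => //.
exact: leq_trans sK.
Qed.

Lemma weight_ge0 t w i : 0 <= weight t w i.
Proof.
rewrite /Defs.weight; case: t => [|t] /=; first by rewrite invr_ge0.
by case: (state t w) => x u; exact: next_weight_ge0.
Qed.

Lemma weight_sum1 t w : \sum_i weight t w i = 1.
Proof.
rewrite /Defs.weight; case: t => [|t] /=.
  rewrite sumr_const card_ord -[LHS]mulr_natl divff//.
  by rewrite pnatr_eq0 -lt0n (tasks_ge1 hA).
by case: (state t w) => x u; exact: next_weight_sum1.
Qed.

Variable pick : hist_t -> Omega.
Hypothesis pickK : forall w, hist (pick (hist w)) = hist w.
Local Notation mean := (mean P hist pick).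

Definition good_run w := forall t, (t < T)%N ->
  safe_round eta_g eta_l Z t w /\ forall i, heterogeneity i (theta t w) <= heter i ^+ 2
      /\
    forall s, (s <= K)%N -> heterogeneity i (virt t s w) <= heter i ^+ 2.

Hypothesis good : forall h, 0 < mass P hist h -> good_run (pick h).

Hypotheses (eta_l_ge0 : 0 <= eta_l) (eta_l_le : K%:R * (eta_l * Lw A) <= 1 / 4).

(** Any preimage is the union of the fibres over the values taken at the representatives, a finite
    union. *)
Lemma gmeas_singletons (G : set_system Omega) (U : Type) (X : Omega -> U) :
  sigma_algebra setT G -> factored X -> (forall x, G (X @^-1` [set x])) -> gmeas G X.
Proof.
move=> sG fX GX B.
rewrite (_ : _ @^-1` B = \bigcup_(h : hist_t)
   (if `[< B (X (pick h)) >] then X @^-1` [set X (pick h)] else set0)).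
  apply: sigma_algebra_bigcup_fin => // h; case: ifP => // _.
  by have [] := sG.
apply/seteqP; split => [w Bw|w [h _]].
  by exists (hist w) => //=; rewrite -(factored_pick pickK _ fX) asboolT.
by case: ifPn => // /asboolP Bh /= ->.
Qed.

Lemma sigma_algebra_bigcap_ord (G : set_system Omega) n (F : 'I_n -> set Omega) :
  sigma_algebra setT G -> (forall i, G (F i)) -> G (\bigcap_i F i).
Proof.
move=> sG GF; rewrite -(sigma_algebra_id sG).
have : @measurable _ (g_sigma_algebraType G) (\bigcap_i F i).
  apply: fin_bigcap_measurable; first exact: finite_finset.
  by move=> h _; rewrite /measurable /= (sigma_algebra_id sG).
by [].
Qed.

(** * One round: measurability of the state and of the revealed randomness *)

Section Round.
Variable t : nat.
Hypothesis tT : (t < T)%N.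
Let rl := process_round hP tT.
Local Notation G s := (sigma_G Z t s).

Lemma gmeas_theta : gmeas (filt Z t) (theta t).
Proof.
apply: gmeas_singletons; [exact: filt_sigma rl|exact: factored_theta (ltnW tT)|].
move=> x; rewrite (_ : _ @^-1` _ =
    \bigcap_(j : 'I_(Defs.dim A)) (fun w => theta t w 0 j) @^-1` [set x 0 j]).
  apply: sigma_algebra_bigcap_ord; first exact: filt_sigma rl.
  by move=> j; apply: (theta_meas rl); exact: measurable_set1.
apply/seteqP; split => [w /= tw j _ /=|w wx /=]; first by rewrite tw.
by apply/rowP => j; exact: wx.
Qed.

Lemma gmeas_weight : gmeas (filt Z t) (weight t).
Proof.
apply: gmeas_singletons; [exact: filt_sigma rl|exact: factored_weight (ltnW tT)|].
move=> x; rewrite (_ : _ @^-1` _ =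
    \bigcap_(j : 'I_m) (fun w => weight t w j) @^-1` [set x j]).
  apply: sigma_algebra_bigcap_ord; first exact: filt_sigma rl.
  by move=> j; apply: (weight_meas rl); exact: measurable_set1.
apply/seteqP; split => [w /= tw j _ /=|w wx /=]; first by rewrite tw.
by apply/funext => j; exact: wx.
Qed.

Lemma sigma_algebra_G s : sigma_algebra setT (G s).
Proof. exact: smallest_sigma_algebra. Qed.

Lemma filt_sub_G s : filt Z t `<=` G s.
Proof. by move=> E FE; apply: sub_sigma_algebra; left; left; left. Qed.

Lemma gmeas_sel s : gmeas (G s) (sel Z t).
Proof.
by move=> B; apply: sub_sigma_algebra; left; left; right; exact: sigma_of_preimage.
Qed.

Lemma gmeas_when_sel r s k : (r < s)%N -> gmeas (G s) (when_sel Z t k (minibatch Z t r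
    k)).
Proof.
move=> rs B; apply: sub_sigma_algebra; right; exists r => //; exists k => //.
exact: sigma_of_preimage.
Qed.

Lemma sub_G r s : (r <= s)%N -> G r `<=` G s.
Proof.
move=> rs; apply: smallest_sub; first exact: smallest_sigma_algebra.
move=> E hE; apply: sub_sigma_algebra.
case: hE => [hE|[i ir hE]]; [by left|right; exists i => //].
exact: leq_trans rs.
Qed.

Lemma G_measurable s : (s <= K)%N -> G s `<=` measurable.
Proof.
move=> sK; apply: smallest_sub; first exact: sigma_algebra_measurable.
have fin (U : finType) (X : Omega -> U) : factored X -> sigma_of X `<=` measurable.
  by move=> fX E [B _ <-]; rewrite setTI; exact: (@measurable_factored _ _ _ _
      measurable_hist _ pickK _ _ _ fX).
have wf r k : (r < K)%N -> factored (when_sel Z t k (minibatch Z t r k)).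
  move=> rK w w' ww'; rewrite /when_sel (factored_sel tT ww').
  by rewrite (factored_minibatch k tT rK ww').
have wr k : factored (when_sel Z t k (rep_set Z t k)).
  move=> w w' ww'; rewrite /when_sel (factored_sel tT ww').
  by rewrite (factored_rep k tT ww').
move=> E [[[FE|SE]|[k _ kE]]|[r rs [k _ kE]]].
- exact: filt_meas rl _ FE.
- exact: sel_meas rl _ SE.
- exact: fin kE.
- by apply: fin kE; apply: wf; exact: leq_trans sK.
Qed.


(** * Averaging over the sampled clients *)

Local Notation draws := ([set S : {set 'I_N} | #|S| == M])%SET.

Let C0 : 'C(N, M)%:R != 0 :> R.
Proof. by rewrite pnatr_eq0 -lt0n bin_gt0 selected_le. Qed.

Let M0 : M%:R != 0 :> R.
Proof. by rewrite pnatr_eq0 -lt0n (selected_ge1 hA). Qed.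

Let N0 : N%:R != 0 :> R.
Proof. by rewrite pnatr_eq0 -lt0n; apply: leq_trans (clients_ge2 hA). Qed.

Let K0 : K%:R != 0 :> R.
Proof. by rewrite pnatr_eq0 -lt0n (local_steps_ge1 hA). Qed.

Lemma prob_sel (E : set Omega) (S : {set 'I_N}) : filt Z t E -> #|S| = M ->
  P ([set w | sel Z t w = S] `&` E) = ((('C(N, M)%:R)^-1)%:E * P E)%E.
Proof.
move=> FE SM; apply: (cond_prob_cst (filt_meas rl)) FE; last exact: sel_unif rl _ SM.
apply: (measurable_event measurable_hist pickK) => w w' ww'.
by rewrite /= (factored_sel tT ww').
Qed.

(** [sel_unif] speaks only of sets of size [M]. There are C(N, M) of them, each of probability
    1/C(N, M), so they exhaust the mass and no other set is drawn with positive probability. *)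
Lemma card_sel h : 0 < mass P hist h -> #|sel Z t (pick h)| = M.
Proof.
move=> h0; apply/eqP; apply: contraT => hM.
have fS S : factored [set w | sel Z t w = S].
  by move=> w w' ww'; rewrite /= (factored_sel tT ww').
have tot : mean (fun w => \sum_(S in draws) \1_[set w | sel Z t w = S] w) = 1.
  rewrite mean_sum (eq_bigr (fun=> ('C(N, M)%:R)^-1)) => [|S]; last first.
    rewrite inE => /eqP SM; apply: EFin_inj; rewrite -(prob_mean P measurable_hist
        pickK)//.
    rewrite -[X in P X]setIT prob_sel ?probability_setT ?mule1//.
    by have [] := filt_sigma rl; move=> F0 FC _; rewrite -(setD0 setT); exact: FC.
  by rewrite sumr_const card_draws card_ord -[LHS]mulr_natr mulVf.
have : mean (fun=> 1) - mean (fun w => \sum_(S in draws) \1_[set w | sel Z t w = S] w)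
    = 0.
  by rewrite tot (mean_cst P measurable_hist pickK) subrr.
rewrite -meanB => /eqP; rewrite psumr_eq0 => [/allP /(_ h (mem_index_enum _))|h' _].
  rewrite /= mulf_eq0 gt_eqF//= big1 ?subr0 ?oner_eq0// => S; rewrite inE => /eqP SM.
  by rewrite indicE memNset//= => selS; rewrite selS SM eqxx in hM.
rewrite mulr_ge0 ?mass_ge0// subr_ge0.
have [hM'|hM'] := boolP (sel Z t (pick h') \in draws).
  rewrite (bigD1 (sel Z t (pick h')))//= indicE mem_set// big1 ?addr0// => S /andP[_
      SS].
  by rewrite indicE memNset//= => selS; rewrite selS eqxx in SS.
rewrite big1// => S SM; rewrite indicE memNset//= => selS.
by rewrite selS SM in hM'.
Qed.

Lemma mean_sel (U : Type) (X : Omega -> U) (phi : U -> {set 'I_N} -> R) :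
  factored X -> gmeas (filt Z t) X ->
  mean (fun w => phi (X w) (sel Z t w)) =
  mean (fun w => ('C(N, M)%:R)^-1 * \sum_(S in draws) phi (X w) S).
Proof.
move=> fX gX.
have := @mean_cond _ _ _ P _ hist measurable_hist pick pickK U _ X (sel Z t) xpredT
  (fun S => if S \in draws then ('C(N, M)%:R)^-1 else 0) phi fX (factored_sel tT) _.
rewrite /= => ->; last first.
  move=> x S; rewrite (_ : [set w | true /\ sel Z t w = S] = [set w | sel Z t w = S]).
    rewrite (_ : [set w | true] = setT) ?setIT; last exact/seteqP.
    case: ifPn => [|SM]; first by rewrite inE => /eqP SM; rewrite setIC prob_sel.
    rewrite mul0e (prob_mean P measurable_hist pickK); last first.
      by move=> w w' ww'; rewrite /setI /= (fX _ _ ww') (factored_sel tT ww').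
    congr _%:E; rewrite /mean big1// => h _.
    have := mass_ge0 P hist h; rewrite le_eqVlt => /predU1P[<-|h0]; first by rewrite
        mul0r.
    rewrite indicE memNset ?mulr0// => -[_ /= selS]; move: SM.
    by rewrite inE -selS card_sel// eqxx.
  by apply/seteqP; split => w //= [].
congr mean; apply/funext => w; rewrite big_mkcond mulr_sumr [in RHS]big_mkcond /=.
by apply: eq_bigr => S _; case: ifP => _; rewrite ?mul0r ?mulr0.
Qed.

(** Turns an average over S_t into a convex combination over the fixed set of all clients, so that
    Jensen and linearity of [mean] apply. *)
Definition sel_weight (w : Omega) (k : 'I_N) : R := M%:R^-1 * (k \in sel Z t w)%:R.

Lemma sel_weight_ge0 w k : 0 <= sel_weight w k.
Proof. by rewrite mulr_ge0 ?invr_ge0. Qed.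

Lemma sum_sel_weight h : 0 < mass P hist h -> \sum_k sel_weight (pick h) k = 1.
Proof.
by move=> h0; rewrite -mulr_sumr sum_mem card_sel// mulVf.
Qed.

Lemma mean_sel_weight (U : Type) (X : Omega -> U) (a : U -> 'I_N -> R) :
  factored X -> gmeas (filt Z t) X ->
  mean (fun w => \sum_k sel_weight w k * a (X w) k) =
  mean (fun w => N%:R^-1 * \sum_k a (X w) k).
Proof.
move=> fX gX.
rewrite (mean_sel (fun x S => \sum_k M%:R^-1 * (k \in S)%:R * a x k))//.
congr mean; apply/funext => w.
rewrite (eq_bigr (fun S : {set 'I_N} => M%:R^-1 * \sum_(k in S) a (X w) k)); last first.
  move=> S _; rewrite mulr_sumr [RHS]big_mkcond; apply: eq_bigr => k _.
  by case: (k \in S); rewrite ?mulr1 ?mulr0 ?mul0r.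
rewrite -mulr_sumr; have := sampling_mean M (a (X w)); rewrite card_ord card_draws
    card_ord.
move=> h; apply: (mulfI N0); rewrite mulrCA (mulrCA N%:R) h.
by field; rewrite N0 M0 C0.
Qed.

Lemma mean_card_sel : \sum_k mean \1_[set w | k \in sel Z t w] = M%:R.
Proof.
rewrite -mean_sum -[RHS](mean_cst P measurable_hist pickK); apply: eq_mean => h h0.
rewrite -(card_sel h0) -sum_mem; apply: eq_bigr => k _; rewrite indicE; congr _%:R.
by case: (boolP (k \in sel Z t (pick h))) => ks; [rewrite mem_set|rewrite memNset//=;
    exact/negP].
Qed.

(** * Minibatch noise: variance, centring and orthogonality *)

Definition mb_noise s k w := noise_grad (weight t w) k (theta_loc t s k w) (minibatch Z
    t s k w).

Lemma factored_noise s k : (s < K)%N -> factored (mb_noise s k).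
Proof.
move=> sK w w' ww'; rewrite /mb_noise (factored_weight (ltnW tT) ww').
by rewrite (factored_theta_loc k tT (ltnW sK) ww') (factored_minibatch k tT sK ww').
Qed.

Lemma mean_noise_client s k : (s < K)%N ->
  mean (fun w => (k \in sel Z t w)%:R * dot (mb_noise s k w) (mb_noise s k w)) <=
  Sigma2 A * mean \1_[set w | k \in sel Z t w].
Proof.
move=> sK.
apply: (@le_trans _ _ (mean (fun w => \sum_i (k \in sel Z t w)%:R *
    enorm (stoch_grad i k (theta_loc t s k w) (minibatch Z t s k w)
               - grad (f_client i k) (theta_loc t s k w)) ^+ 2))).
  apply: ler_mean => h _; rewrite -mulr_sumr ler_wpM2l//.
  apply: le_trans (dot_mix_le (weight_ge0 _ _) (weight_sum1 _ _) _) _.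
  by apply: ler_sum => i _; rewrite enorm_sqr.
rewrite mean_sum mulr_suml; apply: ler_sum => i _.
have [Y [cY Ys]] := grad_var rl i k sK.
apply: (cond_exp_mean_le measurable_hist pickK (G_measurable (ltnW sK)) cY Ys).
- rewrite (_ : [set w | _] = sel Z t @^-1` [set S : {set 'I_N} | k \in S])//.
  exact: gmeas_sel.
- by move=> w w' ww'; rewrite /= (factored_sel tT ww').
- move=> w w' ww'; rewrite (factored_sel tT ww').
  by rewrite (factored_theta_loc k tT (ltnW sK) ww') (factored_minibatch k tT sK ww').
- by move=> w; rewrite mulr_ge0 ?sqr_ge0.
- by rewrite sqr_ge0.
- by move=> w /= /negP/negbTE ->; rewrite mul0r.
Qed.

Lemma mean_noise s : (s < K)%N ->
  mean (fun w => \sum_k sel_weight w k * dot (mb_noise s k w) (mb_noise s k w)) <=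
      Sigma2 A.
Proof.
move=> sK; rewrite mean_sum.
have -> : Sigma2 A = \sum_k M%:R^-1 * (Sigma2 A * mean \1_[set w | k \in sel Z t w]).
  by rewrite -!mulr_sumr mean_card_sel; field.
apply: ler_sum => k _.
have -> : mean (fun w => sel_weight w k * dot (mb_noise s k w) (mb_noise s k w)) =
    M%:R^-1 * mean (fun w => (k \in sel Z t w)%:R * dot (mb_noise s k w) (mb_noise s k
        w)).
  by rewrite -meanZ; congr mean; apply/funext => w; rewrite mulrA.
by rewrite ler_pM2l ?invr_gt0 ?ltr0n ?(selected_ge1 hA)// mean_noise_client.
Qed.

(* [theta_loc t s k] is [G s]-measurable only on the event that [k] is selected,
   since [G s] reveals the minibatches of the selected clients only. *)
Definition masked_loc s k w : V := if k \in sel Z t w then theta_loc t s k w else 0.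

Lemma factored_masked_loc s k : (s <= K)%N -> factored (masked_loc s k).
Proof.
move=> sK w w' ww'; rewrite /masked_loc (factored_sel tT ww').
by rewrite (factored_theta_loc k tT sK ww').
Qed.

Lemma gmeas_masked_loc s k : (s <= K)%N -> gmeas (G s) (masked_loc s k).
Proof.
elim: s => [|s IH] sK.
  have gX : gmeas (G 0) (fun w => (theta t w, sel Z t w)).
    apply: (gmeas_pair pickK).
    - exact: sigma_algebra_G.
    - exact: factored_theta (ltnW tT).
    - exact: gmeas_sub (@filt_sub_G 0) gmeas_theta.
    - exact: gmeas_sel.
  exact: (gmeas_comp (fun xS : V * {set 'I_N} => if k \in xS.2 then xS.1 else 0) gX).
(* The next masked iterate is a function of the masked iterate, the weights and the minibatch as
   revealed; [None] means not selected and gives the masked value 0. *)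
pose f (z : V * ('I_m -> R) * option (b.-tuple 'I_nk)) : V :=
  if z.2 is Some B then z.1.1 - eta_l *: batch_grad z.1.2 k z.1.1 B else 0.
pose X w := (masked_loc s k w, weight t w, when_sel Z t k (minibatch Z t s k) w).
rewrite (_ : masked_loc s.+1 k = fun w => f (X w)).
  apply: gmeas_comp; apply: (gmeas_pair pickK); last exact: gmeas_when_sel.
  - exact: sigma_algebra_G.
  - move=> w w' ww'; rewrite (factored_masked_loc k (ltnW sK) ww').
    by rewrite (factored_weight (ltnW tT) ww').
  - apply: (gmeas_pair pickK).
    + exact: sigma_algebra_G.
    + exact: factored_masked_loc (ltnW sK).
    + exact: gmeas_sub (sub_G (leqnSn s)) (IH (ltnW sK)).
    + exact: gmeas_sub (@filt_sub_G _) gmeas_weight.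
apply/funext => w; rewrite /f /X /masked_loc /when_sel /=.
by case: (k \in sel Z t w).
Qed.

(** Freeze [v], the weights, the selection and the masked iterate, all known at [G s]. The fresh
    minibatch is then uniform on the selection event and [noise_grad_unbiased] applies. *)
Lemma mean_dot_noise s k (v : Omega -> V) : (s < K)%N -> factored v -> gmeas (G s) v ->
  mean (fun w => (k \in sel Z t w)%:R * dot (v w) (mb_noise s k w)) = 0.
Proof.
move=> sK fv gv.
pose X w := (masked_loc s k w, weight t w, (v w, sel Z t w)).
have fX : factored X.
  move=> w w' ww'; rewrite /X (factored_masked_loc k (ltnW sK) ww').
  by rewrite (factored_weight (ltnW tT) ww') (fv _ _ ww') (factored_sel tT ww').
have gX : gmeas (G s) X.
  apply: (gmeas_pair pickK).
  - exact: sigma_algebra_G.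
  - move=> w w' ww'; rewrite (factored_masked_loc k (ltnW sK) ww').
    by rewrite (factored_weight (ltnW tT) ww').
  - apply: (gmeas_pair pickK).
    + exact: sigma_algebra_G.
    + exact: factored_masked_loc (ltnW sK).
    + exact: gmeas_masked_loc (ltnW sK).
    + exact: gmeas_sub (@filt_sub_G _) gmeas_weight.
  - apply: (gmeas_pair pickK) => //; [exact: sigma_algebra_G|exact: gmeas_sel].
have := @mean_cond _ _ _ P _ hist measurable_hist pick pickK _ _ X (minibatch Z t s k)
  (fun x : V * ('I_m -> R) * (V * {set 'I_N}) => k \in x.2.2) (fun=> \prod_(l < b)
      nk%:R^-1)
  (fun x B => dot x.2.1 (noise_grad x.1.2 k x.1.1 B)) fX (factored_minibatch k tT sK) _.
have -> : mean (fun w => (k \in sel Z t w)%:R * dot (v w) (mb_noise s k w)) =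
  mean (fun w => if k \in (X w).2.2 then dot (X w).2.1
    (noise_grad (X w).1.2 k (X w).1.1 (minibatch Z t s k w)) else 0).
  congr mean; apply/funext => w; rewrite /X /= /mb_noise /masked_loc.
  by case: (k \in sel Z t w); rewrite ?mul1r ?mul0r.
move=> ->; last first.
  move=> x B; have GE : G s (X @^-1` [set x]) by exact: gX.
  have mE := G_measurable (ltnW sK) GE.
  have mk : measurable [set w | k \in sel Z t w].
    exact: (sel_meas rl (sigma_of_preimage _ [set S : {set 'I_N} | k \in S])).
  have mB : measurable [set w | k \in sel Z t w /\ minibatch Z t s k w = B].
    apply: (measurable_event measurable_hist pickK) => w w' ww'.
    by rewrite /= (factored_sel tT ww') (factored_minibatch k tT sK ww').
  have [_ _ /(_ _ GE)] := minibatch_unif rl k B sK.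
  rewrite integral_indic// setIC => ->.
  set c := \prod_(l < b) _.
  rewrite (eq_integral (fun w => (c%:E * (\1_[set w | k \in sel Z t w] w)%:E)%E)).
    rewrite ge0_integralZl_EFin//.
    - by rewrite integral_indic// setIC.
    - by apply/measurable_EFinP; exact: measurable_indic.
    - by rewrite prodr_ge0// => l _; rewrite invr_ge0.
  move=> w _; rewrite -EFinM indicE mulrC; congr (_ * _%:R)%:E.
  by case: (boolP (k \in sel Z t w)) => ks; [rewrite mem_set|rewrite memNset//=;
      exact/negP].
rewrite -[RHS](mean_cst P measurable_hist pickK 0); congr mean; apply/funext => w.
case: ifP => // _; under eq_bigr do rewrite -dotZr.
by rewrite -dot_sumr noise_grad_unbiased// dot0r.
Qed.


Definition masked_noise_sum r k w : V := (k \in sel Z t w)%:R *: \sum_(s < r) mb_noise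
    s k w.

Lemma factored_masked_noise_sum r k : (r <= K)%N -> factored (masked_noise_sum r k).
Proof.
move=> rK w w' ww'; rewrite /masked_noise_sum (factored_sel tT ww').
have E (s : 'I_r) : mb_noise s k w = mb_noise s k w'.
  exact: (factored_noise k (leq_trans (ltn_ord s) rK) ww').
by rewrite (eq_bigr _ (fun s _ => E s)).
Qed.

Lemma gmeas_masked_noise_sum r k : (r <= K)%N -> gmeas (G r) (masked_noise_sum r k).
Proof.
elim: r => [|r IH] rK.
  rewrite (_ : masked_noise_sum 0 k = fun w => (fun=> 0 : V) (sel Z t w)).
    exact: (gmeas_comp (fun=> 0 : V) (@gmeas_sel 0)).
  by apply/funext => w; rewrite /masked_noise_sum big_ord0 scaler0.
pose f (z : V * (V * ('I_m -> R)) * option (b.-tuple 'I_nk)) : V :=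
  if z.2 is Some B then z.1.1 + noise_grad z.1.2.2 k z.1.2.1 B else 0.
pose X w := (masked_noise_sum r k w, (masked_loc r k w, weight t w),
  when_sel Z t k (minibatch Z t r k) w).
have fX1 : factored (fun w => (masked_loc r k w, weight t w)).
  move=> w w' ww'; rewrite (factored_masked_loc k (ltnW rK) ww').
  by rewrite (factored_weight (ltnW tT) ww').
rewrite (_ : masked_noise_sum r.+1 k = fun w => f (X w)).
  apply: gmeas_comp; apply: (gmeas_pair pickK); last exact: gmeas_when_sel.
  - exact: sigma_algebra_G.
  - move=> w w' ww'; rewrite (factored_masked_noise_sum k (ltnW rK) ww').
    by have := fX1 _ _ ww' => /= ->.
  - apply: (gmeas_pair pickK).
    + exact: sigma_algebra_G.
    + exact: factored_masked_noise_sum (ltnW rK).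
    + exact: gmeas_sub (sub_G (leqnSn r)) (IH (ltnW rK)).
    + apply: (gmeas_pair pickK).
      * exact: sigma_algebra_G.
      * exact: factored_masked_loc (ltnW rK).
      * exact: gmeas_sub (sub_G (leqnSn r)) (gmeas_masked_loc k (ltnW rK)).
      * exact: gmeas_sub (@filt_sub_G _) gmeas_weight.
apply/funext => w; rewrite /f /X /masked_noise_sum /masked_loc /when_sel big_ord_recr
    /=.
by case: (k \in sel Z t w); rewrite ?scale0r// !scale1r.
Qed.

(** Pythagoras for martingale differences: on the selection event the partial sum is known at [G r],
    so its cross term with the next noise has mean zero. *)
Lemma mean_dot_noise_sum r k : (r <= K)%N ->
  mean (fun w => (k \in sel Z t w)%:R *
    dot (\sum_(s < r) mb_noise s k w) (\sum_(s < r) mb_noise s k w)) =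
  \sum_(s < r) mean (fun w => (k \in sel Z t w)%:R * dot (mb_noise s k w) (mb_noise s k
      w)).
Proof.
elim: r => [|r IH] rK.
  rewrite big_ord0 -[RHS](mean_cst P measurable_hist pickK 0); congr mean.
  by apply/funext => w; rewrite big_ord0 dot0l mulr0.
rewrite big_ord_recr /= -(IH (ltnW rK)) -meanD.
have cross := mean_dot_noise k rK (factored_masked_noise_sum k (ltnW rK))
  (gmeas_masked_noise_sum k (ltnW rK)).
rewrite -[RHS]addr0 -[in RHS](mulr0 2) -[in RHS]cross -meanZ -meanD.
congr mean; apply/funext => w; rewrite big_ord_recr /= /masked_noise_sum.
case: (k \in sel Z t w); last by rewrite !mul0r mulr0 !addr0.
rewrite !mul1r scale1r; move: (\sum_(s < r) _) (mb_noise r k w) => a n.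
by rewrite !(dotDl, dotDr) (dotC n a); ring.
Qed.

Definition noise_avg w : V :=
  \sum_k sel_weight w k *: (K%:R^-1 *: \sum_(s < K) mb_noise s k w).

(** Jensen across clients gains nothing in [M]; orthogonality across the [K] steps of each client
    turns [K^-2] into [K^-1]. *)
Lemma mean_noise_avg : mean (fun w => dot (noise_avg w) (noise_avg w)) <= Sigma2 A /
    K%:R.
Proof.
apply: (@le_trans _ _ (mean (fun w => \sum_k sel_weight w k *
    (K%:R^-1 ^+ 2 * dot (\sum_(s < K) mb_noise s k w) (\sum_(s < K) mb_noise s k w))))).
  apply: ler_mean => h h0.
  apply: le_trans (dot_sum_le _ (sel_weight_ge0 _) _) _; first by rewrite
      sum_sel_weight.
  by apply: ler_sum => k _; rewrite dotZl dotZr [K%:R^-1 * (_ * _)]mulrA -expr2.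
rewrite mean_sum.
have -> : \sum_k mean (fun w => sel_weight w k * (K%:R^-1 ^+ 2 *
      dot (\sum_(s < K) mb_noise s k w) (\sum_(s < K) mb_noise s k w))) =
    K%:R^-1 ^+ 2 * \sum_(s < K) mean (fun w => \sum_k sel_weight w k *
      dot (mb_noise s k w) (mb_noise s k w)).
  transitivity (\sum_k K%:R^-1 ^+ 2 * (M%:R^-1 * \sum_(s < K) mean (fun w =>
      (k \in sel Z t w)%:R * dot (mb_noise s k w) (mb_noise s k w)))).
    apply: eq_bigr => k _; rewrite -mean_dot_noise_sum// -!meanZ.
    by congr mean; apply/funext => w; rewrite /sel_weight; ring.
  rewrite -mulr_sumr; congr (_ * _).
  under [RHS]eq_bigr do rewrite mean_sum.
  rewrite [RHS]exchange_big /=; apply: eq_bigr => k _; rewrite mulr_sumr.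
  apply: eq_bigr => s _; rewrite -meanZ; congr mean.
  by apply/funext => w; rewrite /sel_weight mulrA.
have : \sum_(s < K) mean (fun w => \sum_k sel_weight w k *
      dot (mb_noise s k w) (mb_noise s k w)) <= K%:R * Sigma2 A.
  rewrite mulr_natl -[X in _ *+ X]card_ord -sumr_const; apply: ler_sum => s _.
  exact: mean_noise.
move=> /(ler_wpM2l (sqr_ge0 (K%:R^-1))) /le_trans; apply.
rewrite le_eqVlt; apply/orP; left; apply/eqP; by field.
Qed.

Lemma mean_dot_noise_avg (v : Omega -> V) : factored v -> gmeas (filt Z t) v ->
  mean (fun w => dot (v w) (noise_avg w)) = 0.
Proof.
move=> fv gv.
have -> : (fun w => dot (v w) (noise_avg w)) = fun w => \sum_k \sum_(s < K)
    (M%:R^-1 * K%:R^-1) * ((k \in sel Z t w)%:R * dot (v w) (mb_noise s k w)).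
  apply/funext => w; rewrite dot_sumr; apply: eq_bigr => k _.
  rewrite !dotZr dot_sumr !mulr_sumr; apply: eq_bigr => s _.
  by rewrite /sel_weight; ring.
rewrite mean_sum big1// => k _; rewrite mean_sum big1// => s _.
rewrite meanZ mean_dot_noise ?mulr0//.
exact: gmeas_sub (@filt_sub_G s) gv.
Qed.

(** * Client gradients at the start of the round: mean and sampling variance *)

Definition base_avg w : V :=
  \sum_k sel_weight w k *: client_grad (weight t w) k (theta t w).

Definition round_mix w : V := mix_grad (weight t w) (theta t w).

Lemma factored_theta_weight : factored (fun w => (theta t w, weight t w)).
Proof.
move=> w w' ww'; rewrite (factored_theta (ltnW tT) ww').
by rewrite (factored_weight (ltnW tT) ww').
Qed.

Lemma gmeas_theta_weight : gmeas (filt Z t) (fun w => (theta t w, weight t w)).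
Proof.
apply: (gmeas_pair pickK); [exact: filt_sigma rl| |exact: gmeas_theta|exact:
    gmeas_weight].
exact: factored_theta (ltnW tT).
Qed.

Lemma mix_grad_mean u x : mix_grad u x = N%:R^-1 *: \sum_k client_grad u k x :> V.
Proof.
under eq_bigr do rewrite client_gradE.
rewrite big_split /= sum_het_grad// add0r sumr_const card_ord.
have -> (v : V) : v *+ N = N%:R *: v by rewrite scaler_nat.
by rewrite scalerA mulVf// scale1r.
Qed.

Lemma mean_dot_base_avg (v : Omega -> V) : factored v -> gmeas (filt Z t) v ->
  mean (fun w => dot (v w) (base_avg w)) = mean (fun w => dot (v w) (round_mix w)).
Proof.
move=> fv gv; pose X w := (v w, (theta t w, weight t w)).
have fX : factored X.
  by move=> w w' ww'; rewrite /X (fv _ _ ww'); have := factored_theta_weight ww' => /=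
      ->.
have gX : gmeas (filt Z t) X.
  by apply: (gmeas_pair pickK); [exact: filt_sigma rl| | |exact: gmeas_theta_weight].
have := mean_sel_weight (fun (x : V * (V * ('I_m -> R))) k =>
  dot x.1 (client_grad x.2.2 k x.2.1)) fX gX.
rewrite /X /= => h.
have -> : (fun w => dot (v w) (base_avg w)) = (fun w => \sum_k sel_weight w k *
    dot (v w) (client_grad (weight t w) k (theta t w))).
  by apply/funext => w; rewrite dot_sumr; apply: eq_bigr => k _; rewrite dotZr.
rewrite h; congr mean; apply/funext => w.
by rewrite /round_mix mix_grad_mean dotZr dot_sumr.
Qed.

(** The average over S_t is [round_mix] plus [1/M] times the sampled deviations [het_grad]. These
    sum to zero over all clients, so the cross term averages out and [sampling_var] produces the
    factor in [HN]. *)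
Lemma mean_base_avg : mean (fun w => dot (base_avg w) (base_avg w)) <=
  mean (fun w => dot (round_mix w) (round_mix w)) + HN A.
Proof.
pose phi (x : V * ('I_m -> R)) (S : {set 'I_N}) : R :=
  dot (\sum_k (M%:R^-1 * (k \in S)%:R) *: client_grad x.2 k x.1)
      (\sum_k (M%:R^-1 * (k \in S)%:R) *: client_grad x.2 k x.1).
have := mean_sel phi factored_theta_weight gmeas_theta_weight; rewrite {1}/phi /= => h.
rewrite [X in X <= _](_ : _ = mean (fun w => ('C(N, M)%:R)^-1 *
   \sum_(S in draws) phi (theta t w, weight t w) S))//.
rewrite -[HN A](mean_cst P measurable_hist pickK) -meanD.
apply: ler_mean => h' h'0.
have [_ local_het] := good h'0 tT.
move: (pick h') local_het => w local_het.
set u := weight t w; set x := theta t w.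
have phiE (S : {set 'I_N}) : S \in draws -> phi (x, u) S =
   dot (round_mix w) (round_mix w) + 2 * M%:R^-1 * (\sum_(k in S) dot (round_mix w)
       (het_grad u k x)) +
   M%:R^-1 ^+ 2 * dot (\sum_(k in S) het_grad u k x) (\sum_(k in S) het_grad u k x).
  rewrite inE => /eqP SM; rewrite /phi /=.
  have -> : \sum_k (M%:R^-1 * (k \in S)%:R) *: client_grad u k x =
      round_mix w + M%:R^-1 *: \sum_(k in S) het_grad u k x.
    under eq_bigr do rewrite client_gradE scalerDr.
    rewrite big_split /= addrC; congr (_ + _).
      by rewrite -scaler_suml -mulr_sumr sum_mem SM mulVf// scale1r.
    rewrite scaler_sumr [RHS]big_mkcond; apply: eq_bigr => k _.
    by case: (k \in S); rewrite ?mulr1// mulr0 scale0r.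
  rewrite -dot_sumr; move: (round_mix w) (\sum_(k in S) _) => a c.
  by rewrite !(dotDl, dotDr, dotZl, dotZr) (dotC c a); ring.
rewrite (eq_bigr _ phiE) !big_split /= sumr_const -!mulr_sumr.
have N1 : (1 < #|'I_N|)%N by rewrite card_ord (clients_ge2 hA).
rewrite (sampling_var M N1 (sum_het_grad hA u x)).
have -> : \sum_(S in draws) \sum_(k in S) dot (round_mix w) (het_grad u k x) = 0.
  apply: (mulfI N0); rewrite mulr0.
  have := sampling_mean M (fun k => dot (round_mix w) (het_grad u k x)).
  by rewrite card_ord => ->; rewrite -dot_sumr sum_het_grad// dot0r mulr0.
rewrite mulr0 addr0 card_draws card_ord.
have hs := sum_dot_het_grad_le (weight_ge0 t w) (weight_sum1 t w) (fun i => (local_het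
    i).1).
rewrite /HN -/u -/x in hs *.
set S2 := \sum_k dot (het_grad u k x) _ in hs *.
have N10 : N%:R - 1 != 0 :> R.
  by rewrite subr_eq0 pnatr_eq1 gtn_eqF// (clients_ge2 hA).
have -> : dot (round_mix w) (round_mix w) *+ 'C(N, M) = 'C(N, M)%:R * dot (round_mix w)
    (round_mix w).
  by rewrite mulr_natl.
rewrite mulrDr mulKf// lerD2l.
have -> : 'C(N, M)%:R^-1 * (M%:R^-1 ^+ 2 * ('C(N, M)%:R *
     (M%:R * (N%:R - M%:R) / (N%:R * (N%:R - 1))) * S2)) =
   (N%:R - M%:R) / (M%:R * (N%:R - 1)) * (N%:R^-1 * S2).
  by field; rewrite N0 N10 M0 C0.
rewrite ler_wpM2l// divr_ge0 ?mulr_ge0 ?subr_ge0 ?ler_nat ?selected_le//.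
by rewrite ler1n; apply: leq_trans (clients_ge2 hA).
Qed.


(** * Second moments of the local directions and of the drift *)

Definition local_dir s k w : V := batch_grad (weight t w) k (theta_loc t s k w)
    (minibatch Z t s k w).
Definition local_het s k w : V := het_grad (weight t w) k (virt t s w).
Definition local_err s k w : R := dot (mb_noise s k w) (mb_noise s k w) + dot
    (local_het s k w) (local_het s k w).

(** Virtual iterates are functions of theta^t and the weights, hence known before S_t is drawn; the
    average over S_t has the mean of the average over all clients, which [heterogeneity] bounds. *)
Lemma mean_het s : (s <= K)%N ->
  mean (fun w => \sum_k sel_weight w k * dot (local_het s k w) (local_het s k w)) <=
  \sum_(i < m) heter i ^+ 2.
Proof.
move=> sK; have := mean_sel_weight (fun (x : V * ('I_m -> R)) k =>
  dot (het_grad x.2 k (virtual_iter eta_l x.2 x.1 s))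
      (het_grad x.2 k (virtual_iter eta_l x.2 x.1 s)))
  factored_theta_weight gmeas_theta_weight.
rewrite /= => h.
rewrite [leLHS](_ : _ = mean (fun w => N%:R^-1 * \sum_k
  dot (het_grad (weight t w) k (virt t s w)) (het_grad (weight t w) k (virt t s w))))//.
rewrite -[leRHS](mean_cst P measurable_hist pickK).
apply: ler_mean => h' h'0; have [_ hh] := good h'0 tT.
apply: (sum_dot_het_grad_le (weight_ge0 _ _) (weight_sum1 _ _)) => i.
by have [_ ->] := hh i.
Qed.

Lemma mean_err s : (s < K)%N ->
  mean (fun w => \sum_k sel_weight w k * local_err s k w) <= Qtot A.
Proof.
move=> sK; rewrite /Qtot addrC; apply: le_trans (lerD (mean_noise sK) (mean_het (ltnW
    sK))).
rewrite -meanD le_eqVlt; apply/orP; left; apply/eqP; congr mean; apply/funext => w.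
by rewrite -big_split; apply: eq_bigr => k _; rewrite /local_err mulrDr.
Qed.

Lemma mean_dir s : (s < K)%N ->
  mean (fun w => \sum_k sel_weight w k * dot (local_dir s k w) (local_dir s k w)) <=
      Gbar2 A.
Proof.
move=> sK; set q := mean _.
have : q <= mean (fun w => 2 * Gmax A ^+ 2 +
    (6 * (\sum_k sel_weight w k * local_err s k w) +
     4 / 3 * (K%:R^-1 * \sum_(r < K) \sum_k sel_weight w k * local_err r k w))).
  apply: ler_mean => h h0; have [sr _] := good h0 tT.
  have sv : safe (virt t s (pick h)) := safe_virt sr (ltnW sK).
  have -> : 2 * Gmax A ^+ 2 + (6 * (\sum_k sel_weight (pick h) k * local_err s k (pick
      h)) +
      4 / 3 * (K%:R^-1 * \sum_(r < K) \sum_k sel_weight (pick h) k * local_err r k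
          (pick h))) =
    \sum_k sel_weight (pick h) k * (2 * Gmax A ^+ 2 + 6 * (local_err s k (pick h) +
      2 / 9 * (K%:R^-1 * \sum_(r < K) local_err r k (pick h)))).
    have -> : \sum_(r < K) \sum_k sel_weight (pick h) k * local_err r k (pick h) =
        \sum_k sel_weight (pick h) k * \sum_(r < K) local_err r k (pick h).
      by rewrite exchange_big; apply: eq_bigr => k _; rewrite mulr_sumr.
    rewrite [X in X + _](_ : _ = \sum_k sel_weight (pick h) k * (2 * Gmax A ^+ 2));
        last first.
      by rewrite -mulr_suml sum_sel_weight// mul1r.
    rewrite !mulr_sumr -!big_split; apply: eq_bigr => k _ /=.
    by field.
  apply: ler_sum => k _; rewrite ler_wpM2l ?sel_weight_ge0//.
  exact: (@batch_grad_le _ _ hA _ (weight_ge0 t (pick h)) (weight_sum1 t (pick h)) eta_l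
    _ (fun s => minibatch Z t s k (pick h)) k eta_l_ge0 eta_l_le _ (ltnW sK) sv).
rewrite meanD (mean_cst P measurable_hist pickK) meanD !meanZ.
have Es : \sum_(r < K) mean (fun w => \sum_k sel_weight w k * local_err r k w) <= K%:R
    * Qtot A.
  rewrite mulr_natl -[X in _ *+ X]card_ord -sumr_const; apply: ler_sum => r _.
  exact: mean_err.
have Q0 : 0 <= Qtot A by rewrite addr_ge0 ?sum_heter_ge0 ?Sigma2_ge0.
(* The multiple of [Qtot] is [6 + 4/3], rounded up to the 8 hidden in [Gbar2]. *)
have arith (a c g Q : R) : a <= Q -> c <= Q -> 0 <= Q ->
  2 * g + (6 * a + 4 / 3 * c) <= 2 * (g + 4 * Q) by lra.
move=> /le_trans; apply; apply: arith (mean_err sK) _ Q0.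
by rewrite mean_sum ler_pdivrMl ?ltr0n ?(local_steps_ge1 hA).
Qed.

Definition drift s k w : V :=
  client_grad (weight t w) k (theta_loc t s k w) - client_grad (weight t w) k (theta t
      w).

Definition drift_avg w : V :=
  \sum_k sel_weight w k *: (K%:R^-1 *: \sum_(s < K) drift s k w).

(** After [s] local steps the mean squared displacement is at most [eta_l^2 s^2 Gbar2], and
    [(K - 1)(2 K - 1) / 6] is the average of [s^2] over [s < K]. *)
Definition drift_bound : R :=
  Lw A ^+ 2 * eta_l ^+ 2 * Gbar2 A * ((K%:R - 1) * (2 * K%:R - 1) / 6).

Lemma sum_sqr_nat n : \sum_(s < n) s%:R ^+ 2 = n%:R * (n%:R - 1) * (2 * n%:R - 1) / 6
    :> R.
Proof.
elim: n => [|n IH]; first by rewrite big_ord0 !mul0r.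
by rewrite big_ord_recr /= IH -natr1; field.
Qed.

Lemma mean_drift_avg : mean (fun w => dot (drift_avg w) (drift_avg w)) <= drift_bound.
Proof.
pose c : R := Lw A ^+ 2 * eta_l ^+ 2 / K%:R.
apply: (@le_trans _ _ (mean (fun w => \sum_(s < K) (c * s%:R) *
    \sum_(r < s) \sum_k sel_weight w k * dot (local_dir r k w) (local_dir r k w)))).
  apply: ler_mean => h h0.
  apply: le_trans (dot_sum_le _ (sel_weight_ge0 _) _) _; first by rewrite
      sum_sel_weight.
  have -> : \sum_(s < K) c * s%:R * (\sum_(r < s) \sum_k sel_weight (pick h) k *
        dot (local_dir r k (pick h)) (local_dir r k (pick h))) =
      \sum_k sel_weight (pick h) k * \sum_(s < K) c * s%:R *
        \sum_(r < s) dot (local_dir r k (pick h)) (local_dir r k (pick h)).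
    under [RHS]eq_bigr do rewrite mulr_sumr.
    rewrite [RHS]exchange_big; apply: eq_bigr => s _.
    rewrite exchange_big mulr_sumr; apply: eq_bigr => k _.
    by rewrite -mulr_sumr mulrCA.
  apply: ler_sum => k _; rewrite ler_wpM2l ?sel_weight_ge0//.
  rewrite dotZl dotZr mulrA.
  apply: le_trans (ler_wpM2l _ (dot_sum_le_card _)) _.
    by rewrite mulr_ge0 ?invr_ge0.
  rewrite mulrA [_ * K%:R](_ : _ = K%:R^-1); last by field.
  rewrite mulr_sumr; apply: ler_sum => s _.
  have := client_grad_smooth hA (weight_ge0 t (pick h)) (weight_sum1 t (pick h)) k
    (theta_loc t s k (pick h)) (theta t (pick h)).
  move=> /enorm_sqr_le; rewrite exprMn enorm_sqr -/(drift s k (pick h)) => h1.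
  have h2 := local_iter_dist (weight t (pick h)) eta_l (theta t (pick h))
    (fun s => minibatch Z t s k (pick h)) k s.
  have h3 := le_trans h1 (ler_wpM2l (sqr_ge0 (Lw A)) h2).
  have Ki : 0 <= K%:R^-1 :> R by rewrite invr_ge0.
  apply: le_trans (ler_wpM2l Ki h3) _.
  rewrite le_eqVlt; apply/orP; left; apply/eqP; rewrite /c.
  set e := \sum_(r < s) dot (local_dir r k _) _.
  by ring.
rewrite mean_sum.
have c0 : 0 <= c by apply: divr_ge0 => //; apply: mulr_ge0; exact: sqr_ge0.
apply: (@le_trans _ _ (\sum_(s < K) c * s%:R * (s%:R * Gbar2 A))).
  apply: ler_sum => s _; rewrite meanZ; apply: ler_wpM2l; first by rewrite mulr_ge0.
  rewrite mean_sum.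
  rewrite [leRHS]mulr_natl -[X in _ *+ X]card_ord -sumr_const; apply: ler_sum => r _.
  by apply: mean_dir; exact: ltn_trans (ltn_ord r) (ltn_ord s).
rewrite (eq_bigr (fun s : 'I_K => (c * Gbar2 A) * s%:R ^+ 2)) => [|s _]; last by ring.
rewrite -mulr_sumr sum_sqr_nat /c /drift_bound le_eqVlt; apply/orP; left; apply/eqP.
by field.
Qed.

(** * Expected decrease of the potential in one round *)

Definition round_step w : V := \sum_k sel_weight w k *: (K%:R^-1 *: \sum_(s < K)
    local_dir s k w).

Lemma stepE w : round_step w = noise_avg w + drift_avg w + base_avg w.
Proof.
rewrite -!big_split /=; apply: eq_bigr => k _; rewrite -!scalerDr; congr (_ *: _).
have -> : client_grad (weight t w) k (theta t w) =
    K%:R^-1 *: \sum_(s < K) client_grad (weight t w) k (theta t w).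
  rewrite sumr_const card_ord; have -> (v : V) : v *+ K = K%:R *: v by rewrite
      scaler_nat.
  by rewrite scalerA mulVf// scale1r.
rewrite -!scalerDr -!big_split; congr (_ *: _); apply: eq_bigr => s _ /=.
by rewrite /drift -addrA subrK -batch_gradE.
Qed.

Lemma theta_next w : theta t.+1 w = theta t w + - (eta_g * eta_l * K%:R) *: round_step
    w.
Proof.
rewrite /theta /=.
have -> : state t w = (theta t w, weight t w) by exact: surjective_pairing.
rewrite /= /server_step; congr (_ + _).
rewrite /round_step scaler_sumr scaler_sumr scaler_sumr [LHS]big_mkcond; apply: eq_bigr
    => k _.
rewrite /sel_weight; case: (k \in sel Z t w); last by rewrite mulr0 scale0r scaler0.
rewrite local_iterE -/(theta_loc t _ k w) mulr1 scalerN !scalerN scaleNr; congr (- _).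
rewrite !scalerA; congr (_ *: _).
by field; rewrite K0.
Qed.

Lemma mean_step : mean (fun w => dot (round_step w) (round_step w)) <=
  3 * (Sigma2 A / K%:R + drift_bound + (mean (fun w => dot (round_mix w) (round_mix w))
      + HN A)).
Proof.
apply: (@le_trans _ _ (mean (fun w => 3 * (dot (noise_avg w) (noise_avg w) +
   dot (drift_avg w) (drift_avg w) + dot (base_avg w) (base_avg w))))).
  by apply: ler_mean => h _; rewrite stepE; exact: dotD3_le.
rewrite meanZ !meanD ler_pM2l//.
by apply: lerD mean_base_avg; exact: lerD mean_noise_avg mean_drift_avg.
Qed.

Definition gradPhi w : V := grad (@Phi R A) (theta t w).
Definition ideal_mix w : V := mix_grad (next_weight (fun i => f_obj i (theta t w)))
    (theta t w).

Lemma round_descent : 0 < eta_g * eta_l * K%:R <= eta_eff_bar A ->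
  mean (fun w => dot (gradPhi w) (gradPhi w)) / (4 * c_max A) <=
  (mean (fun w => Phi (theta t w)) - mean (fun w => Phi (theta t.+1 w))) /
    (eta_g * eta_l * K%:R) +
  3 / 2 * smoothPhi A * (eta_g * eta_l * K%:R) * (Sigma2 A / K%:R + HN A) +
  (c_max A + 3 / 2 * smoothPhi A * (eta_g * eta_l * K%:R)) * drift_bound +
  Ewt A * mean (fun w => dot (round_mix w - ideal_mix w) (round_mix w - ideal_mix w)).
Proof.
set eta := eta_g * eta_l * K%:R => /andP[eta0 eta_le].
have c0 := c_max_gt0 hA; have cm0 := c_min_gt0 hA; have L0 := smoothPhi_gt0 hA.
have fg : factored gradPhi.
  by move=> w w' ww'; rewrite /gradPhi (factored_theta (ltnW tT) ww').
have gg : gmeas (filt Z t) gradPhi.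
  exact: (gmeas_comp (grad (@Phi R A)) gmeas_theta).
set gg2 := mean (fun w => dot (gradPhi w) (gradPhi w)).
set del := mean (fun w => dot (round_mix w - ideal_mix w) (round_mix w - ideal_mix w)).
have idealE h : 0 < mass P hist h ->
    gradPhi (pick h) = slack_sum (theta t (pick h)) *: ideal_mix (pick h).
  by move=> h0; apply: grad_Phi_mix => //; have [[]] := good h0 tT.
have ss h : 0 < mass P hist h ->
    c_min A <= slack_sum (theta t (pick h)) <= c_max A.
  by move=> h0; have [[sx]] := good h0 tT; rewrite slack_sum_ge ?slack_sum_le.
have desc : mean (fun w => Phi (theta t.+1 w)) <= mean (fun w => Phi (theta t w)) -
    eta * mean (fun w => dot (gradPhi w) (round_step w)) +
    smoothPhi A / 2 * eta ^+ 2 * mean (fun w => dot (round_step w) (round_step w)).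
  rewrite -!meanZ -meanB -meanD; apply: ler_mean => h h0.
  have [sr _] := good h0 tT; have := safe_seg_theta sr.
  rewrite theta_next => /(Phi_descent hA); rewrite !(dotZl, dotZr) -/gradPhi -/eta.
  move=> /le_trans; apply; rewrite le_eqVlt; apply/orP; left; apply/eqP.
  by rewrite -/(gradPhi (pick h)); ring.
have cross : mean (fun w => dot (gradPhi w) (round_step w)) =
    mean (fun w => dot (gradPhi w) (drift_avg w)) + mean (fun w => dot (gradPhi w)
        (round_mix w)).
  rewrite -(mean_dot_base_avg fg gg) -[RHS]add0r -(mean_dot_noise_avg fg gg) addrA
      -!meanD.
  by congr mean; apply/funext => w; rewrite stepE !dotDr.
(* The drift is not centred, so its inner product with the gradient is paid for by Young's
   inequality. *)
have h1 : - mean (fun w => dot (gradPhi w) (drift_avg w)) <=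
    gg2 / (4 * c_max A) + c_max A * drift_bound.
  apply: (@le_trans _ _ (gg2 / (4 * c_max A) +
      c_max A * mean (fun w => dot (drift_avg w) (drift_avg w)))); last first.
    by rewrite lerD2l ler_pM2l// mean_drift_avg.
  rewrite -[leLHS]mulN1r [gg2 / _]mulrC /gg2 -!meanZ -meanD; apply: ler_mean => h _.
  have := dot_young (gradPhi (pick h)) (- drift_avg (pick h)) c0.
  by rewrite !dotNr dotNl opprK mulN1r [_^-1 * _]mulrC.
(* Alignment: [gradPhi] is [slack_sum] times [ideal_mix], so their inner product is |gradPhi|^2 /
   [slack_sum], at least |gradPhi|^2 / [c_max]. Young's inequality absorbs the difference of the
   mixtures. *)
have h2 : gg2 / c_max A - gg2 / (4 * c_max A) - c_max A * del <=
    mean (fun w => dot (gradPhi w) (round_mix w)).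
  rewrite ![gg2 / _]mulrC /gg2 /del -!meanZ -!meanB; apply: ler_mean => h h0.
  have := dot_young (gradPhi (pick h)) (- (round_mix (pick h) - ideal_mix (pick h))) c0.
  rewrite !dotNr dotNl opprK dotBr.
  have : (c_max A)^-1 * dot (gradPhi (pick h)) (gradPhi (pick h)) <=
     dot (gradPhi (pick h)) (ideal_mix (pick h)).
    rewrite (idealE _ h0) !(dotZl, dotZr) mulrA.
    have /andP[s1 s2] := ss _ h0; have s0 : 0 < slack_sum (theta t (pick h)).
      exact: lt_le_trans s1.
    by rewrite ler_pdivrMl// -mulrA ler_wpM2r// mulr_ge0 ?dot_ge0// ltW.
  rewrite [(4 * c_max A)^-1 * _]mulrC.
  have arith (a x y z v : R) : a <= y -> - (x - y) <= z + v -> a - z - v <= x by lra.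
  exact: arith.
(* Here the lower bound on [slack_sum] matters: |ideal_mix| is at most |gradPhi| / [c_min]. *)
have h3 : mean (fun w => dot (round_mix w) (round_mix w)) <= 2 * (gg2 / c_min A ^+ 2) +
    2 * del.
  rewrite [gg2 / _]mulrC /gg2 /del -!meanZ -meanD; apply: ler_mean => h h0.
  rewrite -{1 2}(subrK (ideal_mix (pick h)) (round_mix (pick h))); apply: le_trans
      (dotD_le _ _) _.
  rewrite addrC lerD2r ler_pM2l// (idealE _ h0) !(dotZl, dotZr).
  have /andP[s1 s2] := ss _ h0; have s0 := lt_le_trans cm0 s1.
  rewrite !mulrA -[leLHS]mul1r ler_wpM2r ?dot_ge0// -mulrA -expr2 mulrC.
  rewrite ler_pdivlMr ?exprn_gt0// mul1r ler_sqr ?nnegrE//; exact: ltW.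
have h4 := mean_step.
have g0 : 0 <= gg2 by apply: mean_ge0 => w; exact: dot_ge0.
have d0 : 0 <= del by apply: mean_ge0 => w; exact: dot_ge0.
have Leta : smoothPhi A * eta <= smoothPhi A * eta_eff_bar A by rewrite ler_pM2l.
(* At [eta = eta_eff_bar] this is an equality by definition of that threshold. *)
have Lg : smoothPhi A * eta * (gg2 / c_min A ^+ 2) <= gg2 / (48 * c_max A).
  apply: le_trans (ler_wpM2r _ Leta) _; first by rewrite divr_ge0 ?sqr_ge0.
  rewrite le_eqVlt; apply/orP; left; apply/eqP; rewrite /eta_eff_bar.
  by field; rewrite !gt_eqF.
have Ld : smoothPhi A * eta * del <= smoothPhi A * eta_eff_bar A * del.
  exact: ler_wpM2r.
have Le0 : 0 <= smoothPhi A * eta by apply: mulr_ge0; exact: ltW.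
have h5 := ler_wpM2l Le0 h3.
have h6 := ler_wpM2l Le0 h4.
have desc' : mean (fun w => dot (gradPhi w) (round_step w)) <=
   (mean (fun w => Phi (theta t w)) - mean (fun w => Phi (theta t.+1 w))) / eta +
   smoothPhi A / 2 * eta * mean (fun w => dot (round_step w) (round_step w)).
  rewrite -(ler_pM2l eta0) mulrDr mulrCA divff ?gt_eqF// mulr1.
  by move: desc; lra.
rewrite cross in desc'.
have e1 : gg2 / c_max A = 4 * (gg2 / (4 * c_max A)) by field; rewrite gt_eqF.
have e2 : gg2 / (48 * c_max A) = gg2 / (4 * c_max A) / 12 by field; rewrite gt_eqF.
rewrite e1 in h2; rewrite e2 in Lg.
have x0 : 0 <= gg2 / (4 * c_max A) by rewrite divr_ge0// mulr_ge0// ltW.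
have le0 : 0 <= smoothPhi A * eta_eff_bar A * del.
  by apply: mulr_ge0 => //; apply: mulr_ge0; apply: ltW => //; exact: eta_eff_bar_gt0.
(* The budget, with [x = gg2 / (4 * c_max)]: of [4 x], drift and weight error take [x] each and
   [3 L e y] takes at most [x / 4]. The [3 L e dl] from the same term is covered by the 6 in
   [Ewt]. *)
have arith (L e eb c D S H dl x y p u v mm st : R) :
    u + v <= p + L / 2 * e * st -> - u <= x + c * D -> 4 * x - x - c * dl <= v ->
    L * e * mm <= L * e * (2 * y + 2 * dl) ->
    L * e * st <= L * e * (3 * (S + D + (mm + H))) ->
    L * e * y <= x / 12 -> L * e * dl <= L * eb * dl -> 0 <= x -> 0 <= L * eb * dl ->
    x <= p + 3 / 2 * L * e * (S + H) + (c + 3 / 2 * L * e) * D + (c + 6 * L * eb) * dl.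
  by lra.
rewrite /Ewt; apply: arith desc' h1 h2 h5 h6 Lg Ld x0 le0.
Qed.


Lemma mix_le h : 0 < mass P hist h -> dot (round_mix (pick h)) (round_mix (pick h)) <=
    Gmax A ^+ 2.
Proof.
move=> h0; have [[sx _ _ _ _ _ _] _] := good h0 tT.
exact: enorm_sqr_le (mix_grad_le hA sx (weight_ge0 t _) (weight_sum1 t _)).
Qed.

(** [VT] expressed through [eta_l] (see [step_boundE]); the coefficients 6 exceed the 3 that
    [mean_step] yields. *)
Definition step_bound : R :=
  6 * Gmax A ^+ 2 + 3 * (Sigma2 A / K%:R) + 6 * HN A + 3 * drift_bound.

Lemma mean_step_le : mean (fun w => dot (round_step w) (round_step w)) <= step_bound.
Proof.
apply: le_trans mean_step _.
have : mean (fun w => dot (round_mix w) (round_mix w)) <= Gmax A ^+ 2.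
  rewrite -[leRHS](mean_cst P measurable_hist pickK); apply: ler_mean => h h0.
  exact: mix_le.
have H0 := HN_ge0 hA; have G0 := sqr_ge0 (Gmax A); rewrite /step_bound.
by move: (mean _) (Sigma2 A / _) drift_bound => x y z; lra.
Qed.

Definition loss_err w : R :=
  \big[Num.max/0]_(i < m) `|fhat eta_g eta_l Z t w i - f_obj i (theta t w)|.

Lemma factored_loss_err : factored loss_err.
Proof.
by move=> w w' ww'; rewrite /loss_err (factored_fhat tT ww') (factored_theta (ltnW tT)
    ww').
Qed.

End Round.

(** * Cost of the lagging weights and telescoping *)

Lemma weight_lag t : (t.+1 < T)%N ->
  mean (fun w => dot (round_mix t.+1 w - ideal_mix t.+1 w) (round_mix t.+1 w -
      ideal_mix t.+1 w)) <=
  2 * Gmax A ^+ 2 * (2 / rho_clip A) ^+ 2 * (mean (fun w => loss_err t w ^+ 2) +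
    Gmax A ^+ 2 * ((eta_g * eta_l * K%:R) ^+ 2 * mean (fun w => dot (round_step t w)
        (round_step t w)))).
Proof.
move=> tT; have tT' := ltnW tT; set eta := eta_g * eta_l * K%:R.
rewrite -!meanZ -meanD -meanZ; apply: ler_mean => h h0.
have [sr _] := good h0 tT'; have [sr' _] := good h0 tT.
have sx : safe (theta t.+1 (pick h)) := safe_theta sr'.
move: (pick h) sr sx => w sr sx.
have wE : weight t.+1 w = next_weight (fhat eta_g eta_l Z t w).
  rewrite /Defs.weight /= /fhat /Defs.theta; by case: (state t w).
have G0 := Gmax_ge0 A.
(* Report error at theta^t plus the change of the losses up to theta^{t+1}, which is Lipschitz with
   constant [Gmax] along the safe segment. *)
set e := loss_err t w + Gmax A * enorm (- eta *: round_step t w).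
have dist i : `|fhat eta_g eta_l Z t w i - f_obj i (theta t.+1 w)| <= e.
  have := safe_seg_theta sr; rewrite theta_next// => /(f_obj_lipschitz hA i) h1.
  have h2 : `|fhat eta_g eta_l Z t w i - f_obj i (theta t w)| <= loss_err t w.
    exact: (@le_bigmax _ _ _ 0
      (fun i => `|fhat eta_g eta_l Z t w i - f_obj i (theta t w)|) i).
  rewrite -[X in `|X|](subrKA (f_obj i (theta t w))).
  by apply: le_trans (ler_normD _ _) _; rewrite lerD// distrC.
have e0 : 0 <= e.
  by rewrite addr_ge0 ?mulr_ge0 ?enorm_ge0//; exact: bigmax_ge_id.
have rc0 := rho_clip_gt0 hA.
have h3 : enorm (round_mix t.+1 w - ideal_mix t.+1 w) <= Gmax A * (2 / rho_clip A * e).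
  apply: le_trans (mix_grad_dist hA _ _ sx) _.
  by rewrite ler_wpM2l// wE; exact: next_weight_dist.
apply: le_trans (enorm_sqr_le h3) _.
have e2 : e ^+ 2 <= 2 * loss_err t w ^+ 2 + 2 * (Gmax A ^+ 2 * (eta ^+ 2 * dot
    (round_step t w) (round_step t w))).
  have -> : Gmax A ^+ 2 * (eta ^+ 2 * dot (round_step t w) (round_step t w)) =
      (Gmax A * enorm (- eta *: round_step t w)) ^+ 2.
    by rewrite [RHS]exprMn enorm_sqr dotZl dotZr; ring.
  rewrite /e; move: (loss_err t w) (Gmax A * _) => x y.
  by have := sqr_ge0 (x - y); lra.
rewrite exprMn [(_ * e) ^+ 2]exprMn; set g2 := Gmax A ^+ 2; set c2 := (2 / _) ^+ 2.
have gc0 : 0 <= g2 * c2 by apply: mulr_ge0; exact: sqr_ge0.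
have := ler_wpM2l gc0 e2; rewrite -/g2.
by move: (e ^+ 2) (loss_err t w ^+ 2) (g2 * (_ * _)) => x y z; lra.
Qed.

(** No report precedes round 0, so only the trivial l^1-distance 2 between probability vectors is
    available. This is the source of the [A7] term. *)
Lemma weight_lag0 : (0 < T)%N ->
  mean (fun w => dot (round_mix 0 w - ideal_mix 0 w) (round_mix 0 w - ideal_mix 0 w))
      <= 4 * Gmax A ^+ 2.
Proof.
move=> T0; rewrite -[leRHS](mean_cst P measurable_hist pickK); apply: ler_mean => h h0.
have [sr _] := good h0 T0; have sx : safe (theta 0 (pick h)) := safe_theta sr.
have -> : 4 * Gmax A ^+ 2 = (Gmax A * 2) ^+ 2 by ring.
apply: enorm_sqr_le; apply: le_trans (mix_grad_dist hA _ _ sx) _.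
rewrite ler_wpM2l ?Gmax_ge0//.
apply: (@le_trans _ _ (\sum_i (weight 0 (pick h) i +
   next_weight (fun i => f_obj i (theta 0 (pick h))) i))).
  apply: ler_sum => i _; apply: le_trans (ler_normB _ _) _.
  by rewrite !ger0_norm ?next_weight_ge0 ?weight_ge0.
by rewrite big_split /= weight_sum1 next_weight_sum1//; lra.
Qed.

Lemma average_bound (X : R) : (0 < T)%N -> 0 < eta_g * eta_l * K%:R <= eta_eff_bar A ->
  (forall t, (t < T)%N -> mean (fun w => loss_err t w ^+ 2) <= X) ->
  T%:R^-1 * \sum_(t < T) mean (fun w => dot (gradPhi t w) (gradPhi t w)) <=
  4 * c_max A * ((Phi (init A) - Phi_lb A) / (T%:R * (eta_g * eta_l * K%:R)) +
    3 / 2 * smoothPhi A * (eta_g * eta_l * K%:R) * (Sigma2 A / K%:R + HN A) +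
    (c_max A + 3 / 2 * smoothPhi A * (eta_g * eta_l * K%:R)) * drift_bound +
    Ewt A * (4 * Gmax A ^+ 2 / T%:R + 2 * Gmax A ^+ 2 * (2 / rho_clip A) ^+ 2 *
      (X + Gmax A ^+ 2 * ((eta_g * eta_l * K%:R) ^+ 2 * step_bound)))).
Proof.
set eta := eta_g * eta_l * K%:R => T0 eta_le lossX.
have /andP[eta0 _] := eta_le.
have Tp : 0 < T%:R :> R by rewrite ltr0n.
have c0 := c_max_gt0 hA.
pose del t := mean (fun w => dot (round_mix t w - ideal_mix t w) (round_mix t w -
    ideal_mix t w)).
pose F t := mean (fun w => Phi (theta t w)).
have gc0 : 0 <= 2 * Gmax A ^+ 2 * (2 / rho_clip A) ^+ 2.
  by apply: mulr_ge0 (mulr_ge0 _ (sqr_ge0 _)) (sqr_ge0 _).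
pose B := 2 * Gmax A ^+ 2 * (2 / rho_clip A) ^+ 2 *
      (X + Gmax A ^+ 2 * (eta ^+ 2 * step_bound)).
(* Only [T - 1] rounds carry the lag; nonnegativity of [B] allows counting [T] of them. *)
have B0 : 0 <= B.
  have X0 : 0 <= X.
    by apply: le_trans (lossX 0 T0); apply: mean_ge0 => w; exact: sqr_ge0.
  have s0 : 0 <= step_bound.
    by apply: le_trans (mean_step_le T0); apply: mean_ge0 => w; exact: dot_ge0.
  rewrite /B; apply: mulr_ge0 => //; apply: addr_ge0 => //; apply: mulr_ge0; first
      exact: sqr_ge0.
  by apply: mulr_ge0 => //; exact: sqr_ge0.
have delS : \sum_(t < T) del t <= 4 * Gmax A ^+ 2 + T%:R * B.
  rewrite -(prednK T0) big_ord_recl /=.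
  apply: lerD; first exact: weight_lag0.
  apply: (@le_trans _ _ (\sum_(t < T.-1) B)); last first.
    by rewrite sumr_const card_ord -[leLHS]mulr_natl ler_wpM2r// ler_nat (prednK T0)
        leq_pred.
  apply: ler_sum => t _; have tT : (t.+1 < T)%N.
    by have := ltn_ord t; rewrite -ltnS (prednK T0).
  apply: le_trans (weight_lag tT) _; rewrite /B ler_wpM2l//.
  apply: lerD; first exact: lossX (ltnW tT).
  by rewrite !ler_wpM2l ?sqr_ge0// mean_step_le// ltnW.
have tele : \sum_(t < T) (F t - F t.+1) = F 0%N - F T.
  elim: (T) => [|n IH]; first by rewrite big_ord0 subrr.
  by rewrite big_ord_recr /= IH addrA subrK.
have FT : Phi_lb A <= F T.
  rewrite -[Phi_lb A](mean_cst P measurable_hist pickK); apply: ler_mean => h h0.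
  (* Safety is assumed for rounds below [T]; the final iterate is safe as the successor in round
     [T - 1]. *)
  have T1 : (T.-1 < T)%N by rewrite prednK.
  have [sr _] := good h0 T1; have := safe_theta_next sr; rewrite (prednK T0) => sx.
  exact: Phi_ge.
have F0 : F 0%N = Phi (init A).
  by rewrite -[RHS](mean_cst P measurable_hist pickK).
pose D := 3 / 2 * smoothPhi A * eta * (Sigma2 A / K%:R + HN A) +
  (c_max A + 3 / 2 * smoothPhi A * eta) * drift_bound.
have sumle : (\sum_(t < T) mean (fun w => dot (gradPhi t w) (gradPhi t w))) / (4 *
    c_max A) <=
    (F 0%N - F T) / eta + T%:R * D + Ewt A * \sum_(t < T) del t.
  have -> : (F 0%N - F T) / eta + T%:R * D + Ewt A * \sum_(t < T) del t =
      \sum_(t < T) ((F t - F t.+1) / eta + D + Ewt A * del t).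
    rewrite big_split big_split /=; congr (_ + _ + _).
    - by rewrite -mulr_suml tele.
    - by rewrite sumr_const card_ord [LHS]mulr_natl.
    - by rewrite mulr_sumr.
  rewrite mulr_suml; apply: ler_sum => t _; have := round_descent (ltn_ord t) eta_le.
  by rewrite -/eta /D -/(del t) -/(F t) -/(F t.+1) !addrA.
have E0 := Ewt_gt0 hA; have c40 : 0 < 4 * c_max A by exact: mulr_gt0 _ c0.
rewrite ler_pdivrMl//; rewrite ler_pdivrMr// in sumle.
apply: le_trans sumle _.
have h1 : (F 0%N - F T) / eta <= (Phi (init A) - Phi_lb A) / eta.
  by rewrite ler_pM2r ?invr_gt0// F0 lerD2l lerN2.
have h2 := ler_wpM2l (ltW E0) delS.
have -> : T%:R * (4 * c_max A * ((Phi (init A) - Phi_lb A) / (T%:R * eta) +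
    3 / 2 * smoothPhi A * eta * (Sigma2 A / K%:R + HN A) +
    (c_max A + 3 / 2 * smoothPhi A * eta) * drift_bound +
    Ewt A * (4 * Gmax A ^+ 2 / T%:R + B))) =
    ((Phi (init A) - Phi_lb A) / eta + T%:R * D + Ewt A * (4 * Gmax A ^+ 2 + T%:R * B))
        *
    (4 * c_max A).
  by rewrite /D; field; rewrite !gt_eqF// ltr0n (local_steps_ge1 hA).
apply: ler_wpM2r; first exact: ltW.
by apply: lerD => //; rewrite lerD2r.
Qed.

End Process.

(** * The rate *)

Lemma ae_good_run (R : realType) (A : fedhv R) (eta_g eta_l : R) (T : nat)
    (d : measure_display) (Omega : measurableType d) (P : probability Omega R)
    (Z : randomness A Omega) : process_ok eta_g eta_l P Z T ->
  {ae P, forall w, good_run eta_g eta_l T Z w}.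
Proof.
move=> hP; apply: filterS2 (process_safe hP) (process_heter hP) => w sw hw t tT.
by split=> [|i]; [exact: sw|exact: hw].
Qed.

Ltac nonneg := repeat first
  [assumption | exact: sqr_ge0 | exact: ler0n | apply: ltW; assumption
  | apply: divr_ge0 | apply: mulr_ge0 | apply: addr_ge0].

(** * Explicit constants and a constant uniform in the horizon *)

Section Average.
Context (R : realType) (A : fedhv R) (eta_g eta0 : R).
Hypothesis hA : setup_ok A.
Hypotheses (eta_g_gt0 : 0 < eta_g) (eta0_gt0 : 0 < eta0).
Hypothesis eta0_le : eta0 <= Num.min (eta_g / (4 * Lw A)) (eta_eff_bar A).
Local Notation K := ((local_steps A)%:R : R).
Local Notation C := (2 / rho_clip A).
Local Notation A1 := (4 * c_max A).
Local Notation A2 := (6 * c_max A * smoothPhi A).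
Local Notation A3 := (12 * c_max A * smoothPhi A).
Local Notation A4 := (c_max A * Lw A ^+ 2 * Gbar2 A
            * (c_max A + smoothPhi A * eta_eff_bar A)).
Local Notation A5 := (8 * c_max A * Ewt A * Gmax A ^+ 2 * C ^+ 2).
Local Notation A6 := (8 * c_max A * Ewt A * Gmax A ^+ 4 * C ^+ 2).
Local Notation A7 := (16 * c_max A * Ewt A * Gmax A ^+ 2).

(** This and [lag_bound] are the right-hand side on either side of the [A5] term. Neither mentions
    the probability space or the process. *)
Definition det_bound (T : nat) : R :=
  A1 * (Phi (init A) - Phi_lb A) / (eta0 * Num.sqrt T%:R)
      + A2 * eta0 * Sigma2 A / Num.sqrt T%:R
      + A3 * eta0 * HN A / Num.sqrt T%:R
      + A4 * eta0 ^+ 2 * (K - 1) * (2 * K - 1) / (eta_g ^+ 2 * K ^+ 2 * T%:R).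

Definition lag_bound (T : nat) : R :=
  A6 * eta0 ^+ 2 / T%:R * VT A eta_g eta0 T + A7 / T%:R.

Let K_gt0 : 0 < K.
Proof. by rewrite ltr0n (local_steps_ge1 hA). Qed.

Let K_ge1 : 1 <= K.
Proof. by rewrite ler1n (local_steps_ge1 hA). Qed.

Section Horizon.
Variable T : nat.
Hypothesis T_gt0 : (1 <= T)%N.
Local Notation s := (Num.sqrt T%:R : R).
Local Notation eta_l := (eta0 / (eta_g * K * s)).

Lemma sqrt_horizon_ge1 : 1 <= s.
Proof. by rewrite -[X in X <= _]sqrtr1 ler_wsqrtr// ler1n. Qed.

Let s_gt0 : 0 < s.
Proof. exact: lt_le_trans ltr01 sqrt_horizon_ge1. Qed.

(** Eliminating [T] in favour of its root makes the later identities rational, within reach of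
    [field]. *)
Lemma sqr_sqrt_horizon : T%:R = s ^+ 2 :> R.
Proof. by rewrite sqr_sqrtr. Qed.

Lemma eta_effE : eta_g * eta_l * K = eta0 / s.
Proof. by field; rewrite !gt_eqF. Qed.

Lemma eta_eff_le : 0 < eta_g * eta_l * K <= eta_eff_bar A.
Proof.
rewrite eta_effE divr_gt0//=.
move: eta0_le; rewrite le_min => /andP[_]; apply: le_trans.
rewrite ler_pdivrMr//; apply: ler_peMr; first exact: ltW.
exact: sqrt_horizon_ge1.
Qed.

Lemma eta_l_ge0 : 0 <= eta_l.
Proof. by apply: divr_ge0; apply: ltW => //; rewrite !mulr_gt0. Qed.

Lemma eta_l_Lw_le : K * (eta_l * Lw A) <= 1 / 4.
Proof.
have L0 := Lw_gt0 hA.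
have -> : K * (eta_l * Lw A) = eta0 * Lw A / eta_g / s by field; rewrite !gt_eqF.
rewrite ler_pdivrMr// ler_pdivrMr//.
move: eta0_le; rewrite le_min => /andP[h _]; move: h; rewrite ler_pdivlMr ?mulr_gt0//
    => h.
have : 1 / 4 * eta_g <= 1 / 4 * s * eta_g.
  by rewrite ler_pM2r// ler_peMr// sqrt_horizon_ge1.
by lra.
Qed.

Lemma step_boundE : step_bound A eta_l = VT A eta_g eta0 T.
Proof.
rewrite /step_bound /VT /drift_bound; congr (_ + _).
have := sqr_sqrt_horizon; have := s_gt0; move: (Num.sqrt _) => z z0 ->.
by field; rewrite !gt_eqF.
Qed.

(** The lag and potential terms match exactly. There is slack elsewhere: [Sigma2 / K <= Sigma2], 6
    against 12 before [HN], and in the drift [(2/3) c_max + z <= c_max + e]. *)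
Lemma average_bound_explicit (X : R) : 0 <= X ->
  4 * c_max A * ((Phi (init A) - Phi_lb A) / (T%:R * (eta_g * eta_l * K)) +
    3 / 2 * smoothPhi A * (eta_g * eta_l * K) * (Sigma2 A / K + HN A) +
    (c_max A + 3 / 2 * smoothPhi A * (eta_g * eta_l * K)) * drift_bound A eta_l +
    Ewt A * (4 * Gmax A ^+ 2 / T%:R + 2 * Gmax A ^+ 2 * (2 / rho_clip A) ^+ 2 *
      (X + Gmax A ^+ 2 * ((eta_g * eta_l * K) ^+ 2 * step_bound A eta_l)))) <=
  det_bound T + A5 * X + lag_bound T.
Proof.
move=> X0; rewrite step_boundE; have eta_le := eta_eff_le.
have c0 := c_max_gt0 hA; have L0 := smoothPhi_gt0 hA; have S0 := Sigma2_ge0 A.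
have H0 := HN_ge0 hA; have G0 := Gbar2_ge0 A; have e0 := eta_eff_bar_gt0 hA.
pose W := (K - 1) * (2 * K - 1).
have W0 : 0 <= W by apply: mulr_ge0; move: K_ge1; lra.
set D := Lw A ^+ 2 * Gbar2 A * (eta0 ^+ 2 / (eta_g ^+ 2 * K ^+ 2 * T%:R)) * W.
have D0 : 0 <= D by rewrite /D; nonneg.
have driftE : drift_bound A eta_l = D / 6.
  rewrite /drift_bound /D /W.
  have := sqr_sqrt_horizon; have := s_gt0; move: (Num.sqrt _) => z z0 ->.
  by field; rewrite !gt_eqF.
have lagE : 4 * c_max A * (Ewt A * (4 * Gmax A ^+ 2 / T%:R +
    2 * Gmax A ^+ 2 * (2 / rho_clip A) ^+ 2 *
      (X + Gmax A ^+ 2 * ((eta_g * eta_l * K) ^+ 2 * VT A eta_g eta0 T)))) =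
    A5 * X + lag_bound T.
  rewrite /lag_bound eta_effE; move: (VT _ _ _ _) => v.
  have := sqr_sqrt_horizon; have := s_gt0; move: (Num.sqrt _) => z z0 ->.
  by field; rewrite !gt_eqF// (rho_clip_gt0 hA).
have phiE : 4 * c_max A * ((Phi (init A) - Phi_lb A) / (T%:R * (eta_g * eta_l * K))) =
    A1 * (Phi (init A) - Phi_lb A) / (eta0 * s).
  rewrite eta_effE.
  have := sqr_sqrt_horizon; have := s_gt0; move: (Num.sqrt _) => z z0 ->.
  by field; rewrite !gt_eqF.
have sigE : 4 * c_max A * (3 / 2 * smoothPhi A * (eta_g * eta_l * K) * (Sigma2 A / K +
    HN A)) <=
    A2 * eta0 * Sigma2 A / s + A3 * eta0 * HN A / s.
  rewrite eta_effE; set cl := c_max A * smoothPhi A * (eta0 / s).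
  have cl0 : 0 <= cl by rewrite /cl; nonneg.
  have -> : A2 * eta0 * Sigma2 A / s + A3 * eta0 * HN A / s = 6 * cl * (Sigma2 A + 2 *
      HN A).
    by rewrite /cl; field; rewrite gt_eqF.
  have -> : 4 * c_max A * (3 / 2 * smoothPhi A * (eta0 / s) * (Sigma2 A / K + HN A)) =
      6 * cl * (Sigma2 A / K + HN A).
    by rewrite /cl; field; rewrite !gt_eqF.
  apply: ler_wpM2l; first exact: mulr_ge0.
  apply: lerD; first by rewrite ler_pdivrMr// ler_peMr.
  by move: H0; lra.
have dE : 4 * c_max A * ((c_max A + 3 / 2 * smoothPhi A * (eta_g * eta_l * K)) *
    drift_bound A eta_l) <=
    A4 * eta0 ^+ 2 * (K - 1) * (2 * K - 1) / (eta_g ^+ 2 * K ^+ 2 * T%:R).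
  have -> : A4 * eta0 ^+ 2 * (K - 1) * (2 * K - 1) / (eta_g ^+ 2 * K ^+ 2 * T%:R) =
      c_max A * (c_max A + smoothPhi A * eta_eff_bar A) * D.
    rewrite /D /W.
    have := sqr_sqrt_horizon; have := s_gt0; move: (Num.sqrt _) => z z0 ->.
    by field; rewrite !gt_eqF.
  rewrite driftE -mulrA [leRHS](_ : _ = 4 * (c_max A * ((c_max A +
    smoothPhi A * eta_eff_bar A) * (D / 4)))); last by field.
  rewrite -mulrA ler_pM2l// ler_pM2l//.
  have -> : D / 6 = D / 4 * (2 / 3) by field.
  have le_e : smoothPhi A * (eta_g * eta_l * K) <= smoothPhi A * eta_eff_bar A.
    by rewrite ler_pM2l//; case/andP: eta_le.
  have arith (c z e : R) : 0 < c -> z <= e -> (c + 3 / 2 * z) * (D / 4 * (2 / 3)) <= (c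
      + e) * (D / 4).
    move=> cp ze; have -> : (c + 3 / 2 * z) * (D / 4 * (2 / 3)) = (2 / 3 * c + z) * (D
        / 4) by field.
    by apply: ler_wpM2r; [exact: divr_ge0|lra].
  exact: arith.
have arith (p a b c e w1 w2 w3 w4 x l : R) : p * a = w1 -> p * b <= w2 + w3 ->
    p * c <= w4 -> p * e = x + l ->
    p * (a + b + c + e) <= w1 + w2 + w3 + w4 + x + l.
  by move=> h1 h2 h3 h4; rewrite !mulrDr; lra.
exact: arith phiE sigE dE lagE.
Qed.

End Horizon.

(** Every term decays like [1 / sqrt T] or [1 / T], and [VT] does not increase with [T]; so the
    value at horizon 1 serves as the constant. Only the [1 / T] terms need to be nonnegative. *)
Lemma deterministic_rate (T : nat) : (1 <= T)%N ->
  det_bound T + lag_bound T <= (det_bound 1 + lag_bound 1) / Num.sqrt T%:R.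
Proof.
move=> T1; set s := Num.sqrt T%:R.
have s1 : 1 <= s := sqrt_horizon_ge1 T1.
have s0 : 0 < s by exact: lt_le_trans ltr01 s1.
have TE : T%:R = s ^+ 2 :> R := sqr_sqrt_horizon T.
have c0 := c_max_gt0 hA; have L0 := smoothPhi_gt0 hA; have E0 := Ewt_gt0 hA.
have G0 := Gbar2_ge0 A; have e0 := eta_eff_bar_gt0 hA; have rc0 := rho_clip_gt0 hA.
have S0 := Sigma2_ge0 A; have H0 := HN_ge0 hA.
have W0 : 0 <= (K - 1) * (2 * K - 1) by apply: mulr_ge0; move: K_ge1; lra.
have inv_le (a : R) : 0 <= a -> a / s ^+ 2 <= a / s.
  move=> a0; rewrite ler_wpM2l// lef_pV2 ?posrE ?exprn_gt0//.
  by rewrite expr2 ler_peMr// ltW.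
have V_le : VT A eta_g eta0 T <= VT A eta_g eta0 1.
  rewrite /VT lerD2l -!(mulrA _ (K - 1)) ler_wpM2r// ler_wpM2l//; first by nonneg.
  rewrite ler_wpM2l ?sqr_ge0//.
  have den_gt0 (n : nat) : (0 < n)%N -> 0 < eta_g ^+ 2 * K ^+ 2 * n%:R.
    by move=> n0; apply: mulr_gt0; [apply: mulr_gt0; exact: exprn_gt0|rewrite ltr0n].
  rewrite lef_pV2 ?posrE ?den_gt0//; apply: ler_wpM2l; first by nonneg.
  by rewrite ler_nat.
have V0 : 0 <= VT A eta_g eta0 1.
  by rewrite /VT -[_ * (K - 1) * _]mulrA; nonneg.
pose a4 := A4 * eta0 ^+ 2 * ((K - 1) * (2 * K - 1)) / (eta_g ^+ 2 * K ^+ 2).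
have a40 : 0 <= a4 by rewrite /a4; nonneg.
pose a6 := A6 * eta0 ^+ 2 * VT A eta_g eta0 1 + A7.
have A60 : 0 <= A6 * eta0 ^+ 2.
  by rewrite -[4%N]/(2 * 2)%N exprM; nonneg.
have A70 : 0 <= A7 by nonneg.
have lag_le : lag_bound T <= a6 / s ^+ 2.
  rewrite /lag_bound TE /a6 [leRHS]mulrDl lerD2r.
  rewrite mulrAC ler_wpM2r ?invr_ge0 ?sqr_ge0//.
  by rewrite ler_wpM2l.
have a60 : 0 <= a6 by rewrite addr_ge0// mulr_ge0.
have lag1 : lag_bound 1 = a6 by rewrite /lag_bound /a6 !divr1.
pose a123 := A1 * (Phi (init A) - Phi_lb A) / eta0 + A2 * eta0 * Sigma2 A + A3 * eta0 *
    HN A.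
have detE : det_bound T = a123 / s + a4 / s ^+ 2.
  by rewrite /det_bound /a123 /a4 -/s TE; field; rewrite !gt_eqF.
have det1 : det_bound 1 = a123 + a4.
  by rewrite /det_bound /a123 /a4 sqrtr1; field; rewrite !gt_eqF.
rewrite detE det1 lag1.
rewrite (_ : (a123 + a4 + a6) / s = a123 / s + (a4 / s + a6 / s)); last by ring.
rewrite -addrA lerD2l.
by apply: lerD; [exact: inv_le|exact: le_trans lag_le (inv_le _ a60)].
Qed.

End Average.

Theorem corollaryA24 (R : realType) (A : fedhv R) (eta_g eta0 : R)
  (hA : setup_ok A) (eta_g_gt0 : 0 < eta_g) (eta0_gt0 : 0 < eta0)
  (eta0_le : eta0 <= Num.min (eta_g / (4 * Lw A)) (eta_eff_bar A)) :
  let K : R := (local_steps A)%:R in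
  let C := 2 / rho_clip A in
  let A1 := 4 * c_max A in
  let A2 := 6 * c_max A * smoothPhi A in
  let A3 := 12 * c_max A * smoothPhi A in
  let A4 := c_max A * Lw A ^+ 2 * Gbar2 A
            * (c_max A + smoothPhi A * eta_eff_bar A) in
  let A5 := 8 * c_max A * Ewt A * Gmax A ^+ 2 * C ^+ 2 in
  let A6 := 8 * c_max A * Ewt A * Gmax A ^+ 4 * C ^+ 2 in
  let A7 := 16 * c_max A * Ewt A * Gmax A ^+ 2 in
  exists Cst : R, forall (T : nat) (d : measure_display)
    (Omega : measurableType d) (P : probability Omega R)
    (Z : randomness A Omega), (1 <= T)%N ->
  let eta_l := eta0 / (eta_g * K * Num.sqrt T%:R) in
  process_ok eta_g eta_l P Z T ->
  let Xi := Xi_loss eta_g eta_l P Z T in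
  let min_grad := (\big[mine/+oo]_(t < T) grad_sq eta_g eta_l P Z t)%E in
  let rhs :=
    ((A1 * (Phi (init A) - Phi_lb A) / (eta0 * Num.sqrt T%:R)
      + A2 * eta0 * Sigma2 A / Num.sqrt T%:R
      + A3 * eta0 * HN A / Num.sqrt T%:R
      + A4 * eta0 ^+ 2 * (K - 1) * (2 * K - 1)
        / (eta_g ^+ 2 * K ^+ 2 * T%:R))%:E
     + A5%:E * Xi
     + (A6 * eta0 ^+ 2 / T%:R * VT A eta_g eta0 T + A7 / T%:R)%:E)%E in
  [/\ eta_g * eta_l * K = eta0 / Num.sqrt T%:R,
      ((T%:R^-1)%:E * \sum_(t < T) grad_sq eta_g eta_l P Z t <= rhs)%E,
      (min_grad <= rhs)%E &
      (min_grad <= (Cst / Num.sqrt T%:R)%:E + A5%:E * Xi)%E].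
Proof.
move=> K C A1 A2 A3 A4 A5 A6 A7.
(* The constant is fixed before [T], the probability space and the process are introduced. *)
exists (det_bound A eta_g eta0 1 + lag_bound A eta_g eta0 1).
move=> T d Omega P Z T1 eta_l hP Xi min_grad rhs.
have [pick [pickK good]] := exists_pick (measurable_hist hP) (ae_good_run hP).
have el0 : 0 <= eta_l by apply: eta_l_ge0.
have elL : K * (eta_l * Lw A) <= 1 / 4 by apply: eta_l_Lw_le.
have eeff : 0 < eta_g * eta_l * K <= eta_eff_bar A by apply: eta_eff_le.
pose g t := mean P (hist T Z) pick (fun w =>
  dot (gradPhi eta_g eta_l Z t w) (gradPhi eta_g eta_l Z t w)).
pose l t := mean P (hist T Z) pick (fun w => loss_err eta_g eta_l Z t w ^+ 2).
have gE (t : 'I_T) : grad_sq eta_g eta_l P Z t = (g t)%:E.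
  rewrite /grad_sq unlock /g.
  rewrite (integral_mean P (measurable_hist hP) pickK); last first.
  - by move=> w; exact: sqr_ge0.
  - move=> w w' ww'; congr (enorm (grad _ _) ^+ 2).
    by apply: factored_theta ww'; exact: ltnW.
  congr _%:E; congr mean; apply/funext => w; exact: enorm_sqr.
have lE (t : 'I_T) : ('E_P[fun w => ((\big[Num.max/0]_(i < tasks A)
    `|fhat eta_g eta_l Z t w i - f_obj i (theta eta_g eta_l Z t w)|) ^+ 2)%R])%E = (l
        t)%:E.
  rewrite unlock (integral_mean P (measurable_hist hP) pickK)//.
  - move=> w w' ww'; congr (_ ^+ 2).
    by apply: factored_loss_err ww'; exact: ltn_ord.
  - by move=> w; exact: sqr_ge0.
have XiE : Xi = (\big[maxe/-oo]_(t < T) (l t)%:E)%E.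
  by rewrite /Xi /Xi_loss; apply: eq_bigr => t _; exact: lE.
have Xi_ge (t : 'I_T) : ((l t)%:E <= Xi)%E.
  by rewrite XiE; exact: (@le_bigmax _ _ _ -oo%E (fun t : 'I_T => (l t)%:E) t).
(* A maximum of finitely many real means; [T >= 1] excludes the default [-oo]. From here on
   everything is real. *)
have Xi_fin : Xi \is a fin_num.
  rewrite fin_numElt (lt_le_trans (ltNyr _) (Xi_ge (Ordinal T1))) XiE /=.
  by apply/bigmax_ltP; split => // t _; exact: ltry.
pose X := fine Xi; have XE : Xi = X%:E by rewrite fineK.
have lX t : (t < T)%N -> l t <= X.
  by move=> tT; rewrite -lee_fin -XE; exact: (Xi_ge (Ordinal tT)).
have X0 : 0 <= X.
  by apply: le_trans (lX _ T1); apply: mean_ge0 => w; exact: sqr_ge0.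
have avg : T%:R^-1 * \sum_(t < T) g t <=
    det_bound A eta_g eta0 T + A5 * X + lag_bound A eta_g eta0 T.
  apply: le_trans (average_bound hA hP pickK good el0 elL T1 eeff lX) _.
  exact: average_bound_explicit.
have rhsE : rhs = (det_bound A eta_g eta0 T + A5 * X + lag_bound A eta_g eta0 T)%:E.
  by rewrite /rhs XE.
have Tp : 0 < T%:R :> R by rewrite ltr0n.
have min_le : (min_grad <= rhs)%E.
  (* The smallest term is attained, as [T >= 1], and does not exceed the average. *)
  rewrite rhsE; case: (@Order.TotalTheory.arg_minP _ _ _ (Ordinal T1) xpredT (fun t :
      'I_T => g t))
    => // t0 _ gmin.
  apply: (@le_trans _ _ (g t0)%:E).
    by rewrite -gE; exact: (@bigmin_le_cond _ _ _ +oo%E t0 xpredT (fun t : 'I_T =>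
        grad_sq eta_g eta_l P Z t)).
  rewrite lee_fin; apply: le_trans avg; rewrite ler_pdivlMl//.
  rewrite mulr_natl -[X in _ *+ X]card_ord -sumr_const.
  by apply: ler_sum => t _; exact: gmin.
split => //.
- exact: eta_effE.
- rewrite rhsE (eq_bigr (fun t : 'I_T => (g t)%:E))//.
  by rewrite sumEFin -EFinM lee_fin.
- apply: le_trans min_le _; rewrite rhsE XE -EFinM -EFinD lee_fin.
  have : det_bound A eta_g eta0 T + lag_bound A eta_g eta0 T <=
      (det_bound A eta_g eta0 1 + lag_bound A eta_g eta0 1) / Num.sqrt T%:R.
    by apply: deterministic_rate.
  by move: (det_bound _ _ _ T) (lag_bound _ _ _ T) (_ / Num.sqrt _) (A5 * X) => x y z
      v; lra.
Qed.
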